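(* For $w\in\{s_3,s_{23},s_{323}\}$ let $\mathrm{Flag}^{\perp,F,V}_{w,6}$ be the variety of full symplectic flags in $\mathbb F^6$ stable under $F_w$ and $V_w$. Below, $\begin{pmatrix}a&b\\c&d\end{pmatrix}$ runs through $\mathrm{GL}_2(\mathbb F)$ and $(\alpha,\beta)$ runs through $\mathbb F^2\setminus\{0\}$, unless specified otherwise. (1) $\mathrm{Flag}^{\perp,F,V}_{s_3,6}$ has exactly two irreducible components $X$ and $Y$, given by - $X=\{\Phi(ae_5+ce_6,\ be_5+de_6,\ \alpha e_1+\beta e_4)\}\simeq\mathbb P^1_{\mathbb F}\times\mathbb P^1_{\mathbb F}$, - $Y=\{\Phi(e_6,\ ae_1+be_4+ce_5,\ e_5)\mid (a,b,c)\in\mathbb F^3\setminus\mathbb F\cdot(0,0,1)\}\cup\{\Phi(e_6,\ e_5,\ \alpha e_1+\beta e_4)\}$, which is isomorphic to the blowing-up of $\mathbb P^2_{\mathbb F}$ in a closed point. Both have dimension $2$, and $X$ and $Y$ intersect in the exceptional curve of $Y$. (2) $\mathrm{Flag}^{\perp,F,V}_{s_{23},6}$ has exactly five irreducible components $X,Y_1,Y_2,Z_1,Z_2$, given by - $X=\{\Phi(ae_5+ce_6,\ be_5+de_6,\ \alpha e_1+\beta e_4)\}\simeq\mathbb P^1_{\mathbb F}\times\mathbb P^1_{\mathbb F}$, - $Y_1=\{\Phi(e_5,\ ae_4+ce_6,\ be_4+de_6)\}\simeq\mathbb P^1_{\mathbb F}$, - $Y_2=\{\Phi(e_6,\ ae_1+ce_5,\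 be_1+de_5)\}\simeq\mathbb P^1_{\mathbb F}$, - $Z_1=\{\Phi(e_6,\ e_1,\ \alpha e_2+\beta e_5)\}\simeq\mathbb P^1_{\mathbb F}$, - $Z_2=\{\Phi(e_5,\ e_4,\ \alpha e_3+\beta e_6)\}\simeq\mathbb P^1_{\mathbb F}$. One has $Y_1\cap Y_2=Z_1\cap Z_2=X\cap Z_1=X\cap Z_2=\emptyset$; the curves $Y_1$ and $Y_2$ each intersect $X$ in precisely one point; and the intersections $Y_1\cap Z_2$ and $Y_2\cap Z_1$ consist of precisely one point each. (3) $\mathrm{Flag}^{\perp,F,V}_{s_{323},6}$ has exactly three irreducible components $X,Y,Z$, each isomorphic to $\mathbb P^1_{\mathbb F}$, given by - $X=\{\Phi(e_6,\ e_1,\ \alpha e_2+\beta e_5)\}$, - $Y=\{\Phi(e_6,\ e_5,\ \alpha e_1+\beta e_4)\}$, - $Z=\{\Phi(e_6,\ ae_1+ce_5,\ be_1+de_5)\}$. One has $X\cap Y=\emptyset$, while $X\cap Z$ and $Y\cap Z$ consist of precisely one point each.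
   Context: Let $p$ be a prime and $\mathbb F$ an algebraic closure of $\mathbb F_p$ with Frobenius $\sigma(x)=x^p$. Varieties are reduced schemes of finite type over $\mathbb F$; subvarieties are reduced and are specified by their $\mathbb F$-valued points. On $\mathbb F^6$ with standard basis $e_1,\dots,e_6$ consider the alternating pairing with $\langle e_i,e_j\rangle=0=\langle e_{3+i},e_{3+j}\rangle$ and $\langle e_i,e_{3+j}\rangle=\delta_{ij}$ for $1\le i,j\le3$. The maps $F_w$ are $\sigma$-linear, the maps $V_w$ are $\sigma^{-1}$-linear, and they are given on the standard basis as follows (basis vectors not listed are mapped to $0$): - $w=s_3$: $F_w:e_1\mapsto e_6,\ e_2\mapsto e_5,\ e_3\mapsto e_1$; $V_w: e_2\mapsto -e_5,\ e_3\mapsto -e_4,\ e_4\mapsto e_6$. - $w=s_{23}$: $F_w:e_1\mapsto e_6,\ e_2\mapsto e_1,\ e_3\mapsto e_5$; $V_w: e_2\mapsto -e_6,\ e_3\mapsto -e_4,\ e_4\mapsto e_5$. - $w=s_{323}$: $F_w:e_1\mapsto e_6,\ e_2\mapsto e_1,\ e_3\mapsto e_2$; $V_w: e_3\mapsto -e_4,\ e_4\mapsto e_5,\ e_5\mapsto e_6$. (These are standard forms of the polarized Dieudonné modules of the $p$-torsion of principally polarized abelian threefolds of $p$-rank $0$ in the 1-, 2- and 3-dimensional Ekedahl–Oort stratum, respectively; $s_3,s_{23},s_{323}$ are used only as labels.) $\mathrm{Flag}^{\perp,F,V}_{w,6}$ is the reduced closed subvariety of the variety of full flags in $\mathbb F^6$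 whose $\mathbb F$-valued points are the flags $(W_i)_{i=0}^6$, $\dim W_i=i$, with $W_{6-i}=W_i^\perp$ and $F_w(W_i),V_w(W_i)\subset W_i$ for all $i$. For linearly independent $c_1,c_2,c_3\in\mathbb F^6$ spanning a totally isotropic subspace, $\Phi(c_1,c_2,c_3)$ denotes the full symplectic flag with $W_j=\langle c_1,\dots,c_j\rangle$ for $0\le j\le3$ and $W_{6-j}=W_j^\perp$. *)

(* Defs.v *)
From HB Require Import structures.
From mathcomp Require Import all_boot all_order all_algebra.
From mathcomp Require Import sesquilinear ring.
From mathcomp Require Import all_classical.
From mathcomp Require Import topology.
(* the notations of mpoly clash with those of topology *)
From mathcomp Require Import -(notations) mpoly.

Set Implicit Arguments.
Unset Strict Implicit.
Unset Printing Implicit Defensive.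

Import GRing.Theory.
Local Open Scope classical_set_scope.
Local Open Scope ring_scope.

(** Topological notions *)

Section Irreducible.
Variable T : topologicalType.
Implicit Types Z V S : set T.

Definition irreducible Z := Z !=set0 /\
  forall A B, closed A -> closed B -> Z `<=` A `|` B -> Z `<=` A \/ Z `<=` B.

Definition closed_in V S := exists2 C, closed C & S = V `&` C.

Definition irr_component V S := [/\ S `<=` V, irreducible S &
  forall S', S' `<=` V -> irreducible S' -> S `<=` S' -> S' = S].

Definition irr_components_are V (s : seq (set T)) :=
  uniq s /\ forall S, irr_component V S <-> S \in s.

(* C 0 `<` C 1 `<` ... `<` C n *)
Definition irr_chain V n (C : nat -> set T) :=
  (forall i, (i <= n)%N -> closed_in V (C i) /\ irreducible (C i)) /\
  (forall i, (i < n)%N -> C i `<` C i.+1).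

(* Krull dimension *)
Definition has_dim V n :=
  (exists C, irr_chain V n C) /\ (forall m C, irr_chain V m C -> (m <= n)%N).

Definition one_point V := exists x, V = [set x].

End Irreducible.

(** Varieties *)

(* A variety is given by its set of F-points together with the systems of
   homogeneous coordinates of each point: [coords x P] means that x is one of
   the coordinate vectors of P.  In the cases below the coordinate vectors form
   an open subset D of an affine space, and D -> pts is the quotient by a free
   action of a group G admitting local sections: G = G_m for a projective
   space, G the Borel subgroup for a flag variety (D = GL_n), and products of
   these.  Hence the Zariski topology and the regular functions of the variety
   are the quotient ones. *)
Record hvariety (F : fieldType) := HVariety {
  pts : choiceType;
  ncoords : nat;
  coords : 'rV[F]_ncoords -> pts -> Prop
}.

(* Points carrying the Zariski topology *)
Definition point (F : fieldType) (X : hvariety F) : Type := pts X.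
Coercion point : hvariety >-> Sortclass.
HB.instance Definition _ (F : fieldType) (X : hvariety F) :=
  Choice.copy (point X) (pts X).

Section Zariski.
Variables (F : fieldType) (X : hvariety F).

Definition pval n (q : mpoly n F) (x : 'rV[F]_n) : F := meval (x ord0) q.

Definition zclosed (A : set X) :=
  exists S : set (mpoly (ncoords X) F), forall x (P : X), coords x P ->
    (A P <-> forall q, S q -> pval q x = 0).

Definition zopen (A : set X) := zclosed (~` A).

Lemma zopenT : zopen setT.
Proof.
exists [set 1] => x P _; split => [[]//|/(_ 1 erefl)/eqP].
by rewrite /pval meval1 oner_eq0.
Qed.

Lemma zopenI : setI_closed zopen.
Proof.
move=> A B [S hS] [T hT].
exists [set q | exists s t, [/\ S s, T t & q = s * t]] => x P xP.
rewrite setCI; split.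
  move=> [/(hS _ _ xP) h|/(hT _ _ xP) h] _ [s [t [Ss Tt ->]]].
    by rewrite /pval mevalM -/(pval s x) h// mul0r.
  by rewrite /pval mevalM -/(pval t x) h// mulr0.
move=> h; have [|nA] := pselect ((~` A) P); first by left.
right; apply/(hT _ _ xP) => t Tt; apply: contrapT => /eqP t0.
apply: nA; apply/(hS _ _ xP) => s Ss.
have /eqP := h (s * t) (ex_intro _ s (ex_intro _ t (And3 Ss Tt erefl))).
rewrite /pval mevalM -/(pval s x) -/(pval t x) mulf_eq0 (negPf t0) orbF.
by move/eqP.
Qed.

Lemma zopen_bigU (J : Type) (f : J -> set X) :
  (forall i, zopen (f i)) -> zopen (\bigcup_i f i).
Proof.
move=> /choice[S hS]; exists (\bigcup_i S i) => x P xP.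
rewrite setC_bigcup; split.
  by move=> h q [i _ Sq]; have /(hS i _ _ xP) := h i I; exact.
by move=> h i _; apply/(hS i _ _ xP) => q Sq; apply: h; exists i.
Qed.

HB.instance Definition _ :=
  isOpenTopological.Build (point X) zopenT zopenI zopen_bigU.

(* Regular functions on a locally closed subset A with its reduced structure:
   functions which are locally a quotient of polynomials in the coordinates. *)
Definition regular (A : set X) (f : X -> F) :=
  forall (P : X) x, A P -> coords x P ->
    exists a b : mpoly (ncoords X) F, pval b x != 0 /\
      forall (Q : X) y, A Q -> coords y Q -> pval b y != 0 ->
        f Q = pval a y / pval b y.

End Zariski.

Section Morphisms.
Variables (F : fieldType) (X Y : hvariety F).

Definition morphism_on (A : set X) (B : set Y) (phi : X -> Y) :=
  [/\ forall P, A P -> B (phi P),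
      {within A, continuous phi} &
      forall (V : set Y) (g : Y -> F), open V -> regular (B `&` V) g ->
        regular (A `&` phi @^-1` V) (g \o phi)].

End Morphisms.

Definition inverse_isos (F : fieldType) (X Y : hvariety F)
    (A : set X) (B : set Y) (phi : X -> Y) (psi : Y -> X) :=
  [/\ morphism_on A B phi, morphism_on B A psi,
      {in A, cancel phi psi} & {in B, cancel psi phi}].

Definition isomorphic (F : fieldType) (X Y : hvariety F)
    (A : set X) (B : set Y) :=
  exists phi psi, inverse_isos A B phi psi.

(** Projective spaces, products, flag varieties *)

Section Examples.
Variable F : fieldType.

Definition line n := {U : {vspace 'rV[F]_n} | \dim U == 1}.

Definition projective_space n : hvariety F :=
  @HVariety F (line n.+1) n.+1 (fun x U => val U = <[x]>%VS).

Definition hprod (X Y : hvariety F) : hvariety F :=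
  @HVariety F (pts X * pts Y)%type (ncoords X + ncoords Y)
    (fun z PQ => coords (lsubmx z) PQ.1 /\ coords (rsubmx z) PQ.2).

Definition is_full_flag n (W : {ffun 'I_n.+1 -> {vspace 'rV[F]_n}}) :=
  [forall i : 'I_n.+1, \dim (W i) == i] &&
  [forall i : 'I_n.+1, forall j : 'I_n.+1, (i <= j)%N ==> (W i <= W j)%VS].

Definition full_flag n :=
  {W : {ffun 'I_n.+1 -> {vspace 'rV[F]_n}} | is_full_flag W}.

(* The coordinates of a flag are the matrices whose rows form a basis of F^n
   adapted to it; these are automatically invertible. *)
Definition flag_variety n : hvariety F :=
  @HVariety F (full_flag n) (n * n)
    (fun g W => forall i : 'I_n.+1,
       val W i = <<[seq row k (vec_mx g) | k : 'I_n <- enum 'I_n & (k < i)%N]>>%VS).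

(* the subspaces W_0, ..., W_n of a flag *)
Definition steps n (W : flag_variety n) : {ffun 'I_n.+1 -> {vspace 'rV[F]_n}} :=
  val (W : full_flag n).

End Examples.

(* The blowing-up of P^2 in the point [0 : 0 : 1], as the closed subset
   x0 y1 = x1 y0 of P^2 x P^1, and its exceptional curve. *)
Section BlowUp.
Variable F : fieldType.

Definition blowup_P2 : set (hprod (projective_space F 2) (projective_space F 1)) :=
  [set PQ | exists (x : 'rV[F]_3) (y : 'rV[F]_2), [/\ val PQ.1 = <[x]>%VS, val PQ.2 = <[y]>%VS &
    x 0 0 * y 0 1 = x 0 1 * y 0 0]].

Definition exceptional_curve : set (hprod (projective_space F 2) (projective_space F 1)) :=
  [set PQ | blowup_P2 PQ /\ val PQ.1 = <[(delta_mx 0 2 : 'rV[F]_3)%R]>%VS].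

End BlowUp.

Arguments blowup_P2 : clear implicits.
Arguments exceptional_curve : clear implicits.

(** The symplectic space F^6 *)

Section Symplectic.
Variable F : fieldType.

(* e 1, ..., e 6 is the standard basis *)
Definition e (k : nat) : 'rV[F]_6 := delta_mx 0 (inord k.-1).

Definition pairing (x y : 'rV[F]_(3 + 3)) : F :=
  \sum_(i < 3) (x 0 (lshift 3 i) * y 0 (rshift 3 i)
              - x 0 (rshift 3 i) * y 0 (lshift 3 i)).

Lemma pairing_bilinear : bilinear_for *%R (idfun \; *%R) pairing.
Proof.
split=> z a x y; rewrite /pairing /= mulr_sumr -big_split /=;
  by apply: eq_bigr => i _; rewrite !mxE; ring.
Qed.

HB.instance Definition _ := bilinear_isBilinear.Build F
  'rV[F]_(3 + 3) 'rV[F]_(3 + 3) F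
  (GRing.Scale.Law.clone _ _ *%R _) (GRing.Scale.Law.clone _ _ (idfun \; *%R) _)
  pairing pairing_bilinear.

Lemma pairing_skew (x y : 'rV[F]_(3 + 3)) :
  pairing x y = (-1) ^+ true * idfun (pairing y x).
Proof.
rewrite expr1 mulN1r /pairing -sumrN; apply: eq_bigr => i _.
by rewrite opprB mulrC [X in _ - X]mulrC.
Qed.

HB.instance Definition _ := isHermitianSesquilinear.Build F
  'rV[F]_(3 + 3) true idfun pairing pairing_skew.

Definition perp (U : {vspace 'rV[F]_6}) : {vspace 'rV[F]_6} := orthov pairing U.

(* Meaningful when c1, c2, c3 are independent and span a totally isotropic
   subspace, as in all the families below. *)
Definition Phi (c1 c2 c3 : 'rV[F]_6) : {ffun 'I_7 -> {vspace 'rV[F]_6}} :=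
  let c := [:: c1; c2; c3] in
  [ffun j : 'I_7 => if (j <= 3)%N then <<take j c>>%VS
                    else perp <<take (6 - j) c>>%VS].

End Symplectic.

Section FV.
Variables (p : nat) (F : fieldType).

Definition frob (x : F) : F := x ^+ p.

(* the p-th root, which exists and is unique in an algebraically closed field
   of characteristic p *)
Definition frob_inv (x : F) : F := xget 0 [set y | y ^+ p = x].

Definition semilinear_ext (tau : F -> F) (b : nat -> 'rV[F]_6) (x : 'rV[F]_6) :=
  \sum_(i < 6) tau (x 0 i) *: b i.+1.

Inductive EOlabel := s3 | s23 | s323.

Notation e := (@e F).

Definition F_basis (w : EOlabel) (k : nat) : 'rV[F]_6 :=
  match w, k with
  | s3, 1 => e 6 | s3, 2 => e 5 | s3, 3 => e 1
  | s23, 1 => e 6 | s23, 2 => e 1 | s23, 3 => e 5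
  | s323, 1 => e 6 | s323, 2 => e 1 | s323, 3 => e 2
  | _, _ => 0
  end.

Definition V_basis (w : EOlabel) (k : nat) : 'rV[F]_6 :=
  match w, k with
  | s3, 2 => - e 5 | s3, 3 => - e 4 | s3, 4 => e 6
  | s23, 2 => - e 6 | s23, 3 => - e 4 | s23, 4 => e 5
  | s323, 3 => - e 4 | s323, 4 => e 5 | s323, 5 => e 6
  | _, _ => 0
  end.

Definition Fmap w := semilinear_ext frob (F_basis w).
Definition Vmap w := semilinear_ext frob_inv (V_basis w).

(* rev_ord i is 6 - i in 'I_7 *)
Definition Flag_perp_FV (w : EOlabel) : set (flag_variety F 6) :=
  [set W | (forall i : 'I_7, steps W (rev_ord i) = perp (steps W i)) /\
           (forall (i : 'I_7) x, x \in steps W i ->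
              Fmap w x \in steps W i /\ Vmap w x \in steps W i)].

End FV.

Arguments Flag_perp_FV : clear implicits.

(** The families of flags *)

Section Families.
Variable F : fieldType.
Notation e := (@e F).
Implicit Types (a b c d : F) (u v w : 'rV[F]_6).

(* the matrix with rows (a, b) and (c, d) is in GL_2 *)
Definition gl2 a b c d := a * d - b * c != 0.

(* Phi(a e5 + c e6, b e5 + d e6, al e1 + be e4) *)
Definition fam_56_14 : set (flag_variety F 6) :=
  [set W | exists a b c d al be, [/\ gl2 a b c d, (al, be) != (0, 0) &
    steps W = Phi (a *: e 5 + c *: e 6) (b *: e 5 + d *: e 6)
                (al *: e 1 + be *: e 4)]].

(* Phi(u, a v + c w, b v + d w) *)
Definition fam_gl2 u v w : set (flag_variety F 6) :=
  [set W | exists a b c d, gl2 a b c d /\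
    steps W = Phi u (a *: v + c *: w) (b *: v + d *: w)].

(* Phi(u1, u2, al v + be w) *)
Definition fam_line u1 u2 v w : set (flag_variety F 6) :=
  [set W | exists al be, (al, be) != (0, 0) /\
    steps W = Phi u1 u2 (al *: v + be *: w)].

(* Phi(e6, a e1 + b e4 + c e5, e5) with (a, b, c) not in F (0, 0, 1) *)
Definition fam_6_145_5 : set (flag_variety F 6) :=
  [set W | exists a b c, ~ (exists t, (a, b, c) = (0, 0, t)) /\
    steps W = Phi (e 6) (a *: e 1 + b *: e 4 + c *: e 5) (e 5)].

End Families.

Arguments fam_56_14 : clear implicits.
Arguments fam_6_145_5 : clear implicits.

(* Main.v *)
Require Import Defs.
From HB Require Import structures.
From mathcomp Require Import all_boot all_order all_algebra.
From mathcomp Require Import sesquilinear ring zify.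
From mathcomp Require Import all_classical.
From mathcomp Require Import topology.
From mathcomp Require Import -(notations) mpoly.

Set Implicit Arguments.
Unset Strict Implicit.
Unset Printing Implicit Defensive.

Import GRing.Theory.
Local Open Scope classical_set_scope.
Local Open Scope ring_scope.

(** Write W_i for the members of a symplectic flag and c_1, c_2, c_3 for a basis of W_3
adapted to W_1, W_2.  Since F and V are nilpotent, stability of the flag means that they
kill c_1, map c_2 into W_1 and c_3 into W_2; together with isotropy this is a small system
of polynomial equations whose solutions are the listed families.  Each family is closed,
being cut out among symplectic flags by inclusions of some W_i in fixed subspaces.

A family is isomorphic to its model because in both directions the coordinates of the
image point are local rational functions: the model coordinates are entries of the matrix
of the flag, and conversely the matrix of a symplectic flag is completed locally from its
first three rows to a basis whose Gram matrix is antitriangular.  The models P^1, P^1 x P^1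
and the blowing-up of P^2 are images of open sets of affine spaces, hence irreducible, so
the families are the components as soon as none contains another.  Finally P^1 x P^1 and
the blowing-up are covered by open affine planes, and chains in the plane have length at
most 2: for irreducible closed sets C1 < C2 < A^2, elimination shows that each coordinate
is constant on C1. *)

(** * Irreducible sets and chains *)

Section Topology.
Variables T1 T2 : topologicalType.

(** A map into the flag variety must produce a whole invertible 6 x 6 matrix, although the data fix
    only [W_1], [W_2], [W_3]. This is why frames are used: a Gram matrix that vanishes strictly
    above the antidiagonal and nowhere on it gives at once invertibility, a flag, and its
    symplecticity. No single formula is defined on a whole family, so an isomorphism is described by
    a relation with local formulas in both directions; these formulas force the partner of a point
    to be unique, and no inverse has to be computed. Nilpotency works through the lines
    [W_(k+1) / W_k], on which a semilinear map with injective twist is zero or injective. The upper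
    half of a flag follows from the lower one because [F] and [V] are adjoint up to Frobenius. The
    blowing-up appears because the pairing on the span of [e 1], [e 4], [e 5] has radical spanned by
    [e 5]: once [W_1] is spanned by [e 6], [W_2] determines [W_3] unless [W_2] is spanned by [e 6]
    and [e 5]. *)

Lemma within_continuous_closed (A : set T1) (f : T1 -> T2) (C : set T2) :
  {within A, continuous f} -> closed C ->
  exists2 D, closed D & forall x, A x -> (D x <-> C (f x)).
Proof.
move=> /continuous_closedP fc /fc /closed_subspaceP[D Dcl DE]; exists D => // x Ax.
have := congr1 (fun S : set T1 => S x) DE; rewrite /setI /preimage /=.
by move=> E; split=> [Dx|Cx]; [suff [] : C (f x) /\ A x by [] | suff [] : D x /\ A x by []];
  rewrite ?E // -?E.
Qed.

Lemma irreducible_image (A : set T1) (f : T1 -> T2) :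
  {within A, continuous f} -> irreducible A -> irreducible (f @` A).
Proof.
move=> fc [[x Ax] Airr]; split; first by exists (f x), x.
move=> C D Ccl Dcl CD.
have [C' C'cl C'E] := within_continuous_closed fc Ccl.
have [D' D'cl D'E] := within_continuous_closed fc Dcl.
have [y Ay|AC|AD] := Airr _ _ C'cl D'cl.
- by have [/(C'E _ Ay)|/(D'E _ Ay)] := CD (f y) (imageP f Ay); [left|right].
- by left=> _ [y Ay <-]; apply/(C'E _ Ay)/AC.
- by right=> _ [y Ay <-]; apply/(D'E _ Ay)/AD.
Qed.

End Topology.

Section Components.
Variable T : topologicalType.
Implicit Types (V S : set T) (s : seq (set T)).

Lemma irreducible1 (x : T) : irreducible [set x].
Proof.
split; first by exists x.
move=> A B _ _ /(_ x erefl)[] h; [left|right] => y ->; exact: h.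
Qed.

Lemma irreducible_sub_seq S s : irreducible S -> (forall C, C \in s -> closed C) ->
  S `<=` [set x | exists2 C, C \in s & C x] -> exists2 C, C \in s & S `<=` C.
Proof.
move=> [[x0 Sx0] Sirr]; elim: s => [_ /(_ _ Sx0)[]//|C s IHs] scl Ss.
pose D := [set x | exists2 C, C \in s & C x].
have Dcl : closed D.
  rewrite {}/D {IHs Ss}; elim: s scl => [|B s IHs] scl.
    rewrite (_ : [set x | _] = set0); first exact: closed0.
    by rewrite -subset0 => x [].
  rewrite (_ : [set x | _] = B `|` [set x | exists2 C, C \in s & C x]); last first.
    apply/seteqP; split=> x /=.
      by move=> [E]; rewrite inE => /predU1P[->|Es] Ex; [left | right; exists E].
    move=> [Bx|[E Es Ex]]; [exists B | exists E]; rewrite ?mem_head//.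
    by rewrite in_cons Es orbT.
  apply: closedU; first by apply: scl; rewrite !inE eqxx orbT.
  by apply: IHs => E; rewrite in_cons => /predU1P[->|Es]; apply: scl;
    rewrite !inE ?eqxx ?Es ?orbT.
have [||x /Ss[E]|SC|SD] := Sirr C D; [exact: scl (mem_head _ _)|exact: Dcl| | |].
- by rewrite in_cons => /predU1P[->|Es] Ex; [left | right; exists E].
- by exists C; rewrite ?mem_head.
- have [|E Es SE] := IHs _ SD; last by exists E; rewrite // in_cons Es orbT.
  by move=> E Es; apply: scl; rewrite in_cons Es orbT.
Qed.

(** Every irreducible subset of [V] is trapped in one member of the list, so a maximal one equals
    that member. Conversely, enlarging a member traps it in some member, which by the absence of
    inclusions is the same one. *)
Lemma irr_components_areP V s :
  uniq s -> (forall C, C \in s -> closed C) -> (forall C, C \in s -> irreducible C) ->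
  (V = [set x | exists2 C, C \in s & C x]) ->
  (forall C D, C \in s -> D \in s -> C `<=` D -> C = D) ->
  irr_components_are V s.
Proof.
move=> s_uniq scl sirr VE sinc; split=> // S; split=> [[SV Sirr Smax]|Ss].
  have [|C Cs SC] := irreducible_sub_seq Sirr scl; first by rewrite -VE.
  rewrite -(Smax C) //; last exact: sirr.
  by move=> y Cy; rewrite VE; exists C.
split; [by move=> y Sy; rewrite VE; exists S | exact: sirr |].
move=> S' S'V S'irr SS'.
have [|C Cs S'C] := irreducible_sub_seq S'irr scl; first by rewrite -VE.
by have SC := sinc S C Ss Cs (subset_trans SS' S'C); apply/seteqP; split=> //; rewrite SC.
Qed.

End Components.

Lemma inverse_isos_sym (F : fieldType) (X Y : hvariety F) (A : set X) (B : set Y) phi psi :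
  inverse_isos A B phi psi -> inverse_isos B A psi phi.
Proof. by case. Qed.

Lemma inverse_isos_image (F : fieldType) (X Y : hvariety F) (A : set X) (B : set Y) phi psi :
  inverse_isos A B phi psi -> phi @` A = B.
Proof.
move=> [[AB _ _] [BA _ _] _ psiK]; apply/seteqP; split=> [_ [P AP <-]|Q BQ].
  exact: AB.
by exists (psi Q); [exact: BA | rewrite psiK ?inE].
Qed.

Lemma inverse_isos_irreducible (F : fieldType) (X Y : hvariety F)
    (A : set X) (B : set Y) phi psi :
  inverse_isos A B phi psi -> irreducible B -> irreducible A.
Proof.
move=> /inverse_isos_sym iso; rewrite -(inverse_isos_image iso).
by case: iso => -[_ psic _] _ _ _; exact: irreducible_image.
Qed.

Lemma irr_chain_pullback (F : fieldType) (X Y : hvariety F)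
    (A : set X) (B O : set Y) phi psi n C :
  inverse_isos A (B `&` O) phi psi -> open O ->
  irr_chain B n C -> C 0%N `&` O !=set0 ->
  irr_chain A n (fun i => A `&` phi @^-1` C i).
Proof.
move=> [[phiA phic _] [psiB psic _] phiK psiK] Oop [Ci Clt] [Q0 [C0Q0 OQ0]].
have CB i : (i <= n)%N -> C i `<=` B.
  by move=> /Ci[[D Dcl ->] _] Q [].
have C0i i : (i <= n)%N -> C 0%N `<=` C i.
  elim: i => [|i IHi] ltin; first by move=> Q.
  apply: subset_trans (IHi (ltnW ltin)) _.
  by have /properW := Clt _ ltin.
split=> [i lein|i ltin].
  have [[D Dcl CE] [_ Cirr]] := Ci _ lein; split.
    have [E Ecl EE] := within_continuous_closed phic Dcl.
    exists E => //; apply/seteqP; split=> P /= [AP].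
      by rewrite /preimage /= CE => -[_ DP]; split=> //; apply/EE.
    move=> EP; split=> //; rewrite /preimage /= CE; split; last exact/EE.
    by case: (phiA P AP).
  have psiQ0 : (B `&` O) Q0 by split=> //; apply: (CB i) => //; exact: (C0i i).
  split.
    exists (psi Q0); split; first exact: psiB.
    by rewrite /preimage /= psiK ?inE//; exact: (C0i i).
  move=> D1 D2 D1cl D2cl cov.
  have [E1 E1cl E1E] := within_continuous_closed psic D1cl.
  have [E2 E2cl E2E] := within_continuous_closed psic D2cl.
  have notO : closed (~` O) by exact: open_closedC.
  have finish D' E : (forall x, (B `&` O) x -> E x <-> D' (psi x)) -> C i `<=` E ->
      A `&` phi @^-1` C i `<=` D'.
    move=> EE CE' P [AP CP].
    by have /EE := CE' _ CP; rewrite phiK ?inE//; apply; exact: phiA.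
  (* The cover of the trace by [D1] and [D2] is turned into a cover of all of [C i] by throwing the
     complement of [O] into the first piece; it is discarded again below because [Q0] lies in
     [O]. *)
  have [||Q CQ|h|h] := Cirr (E1 `|` ~` O) E2; [exact: closedU|exact: E2cl| | |].
  - have [OQ|] := pselect (O Q); last by left; right.
    have BOQ : (B `&` O) Q by split=> //; exact: CB CQ.
    have [|/(E1E _ BOQ)|/(E2E _ BOQ)] := cov (psi Q); [|by left; left|by right].
    by split; [exact: psiB|rewrite /preimage /= psiK ?inE].
  - left; apply: finish E1E _.
    by have [||Q /h|//|/(_ Q0 (C0i i lein _ C0Q0))] := Cirr E1 (~` O).
  - by right; apply: finish E2E _.
have leS : (i <= n)%N by exact: ltnW.
have [sub nsub] := Clt _ ltin; split=> [P [AP /sub]//|nP]; apply: nsub => Q CQ.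
have [[D Dcl CE] _] := Ci _ leS; have [_ [_ Cirr]] := Ci _ ltin.
have [||R CR|h|h] := Cirr D (~` O); [exact: Dcl|exact: open_closedC| | |].
- have [OR|] := pselect (O R); last by right.
  have BOR : (B `&` O) R by split=> //; exact: CB CR.
  have [|_] := nP (psi R).
    by split; [exact: psiB|rewrite /preimage /= psiK ?inE].
  by rewrite /preimage /= psiK ?inE// CE => -[_]; left.
- by rewrite CE; split; [exact: CB CQ|exact: h].
- by have := h Q0 (C0i _ ltin _ C0Q0).
Qed.

(** * Morphisms given by local formulas *)

Section PolynomialFunctions.
Variables (F : fieldType).

(** Induction on polynomials, stated for an arbitrary class [K] of functions: it is used for
    polynomial functions, for functions with denominators a power of [b], for restrictions to a
    line, and for rewriting as a polynomial in one variable over polynomials in the other. *)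
Lemma pval_closed T (K : (T -> F) -> Prop) n (m : T -> 'rV[F]_n) (q : mpoly n F) :
  (forall c, K (fun=> c)) ->
  (forall f g, K f -> K g -> K (fun x => f x + g x)) ->
  (forall f g, K f -> K g -> K (fun x => f x * g x)) ->
  (forall j, K (fun x => m x 0 j)) -> K (fun x => pval q (m x)).
Proof.
move=> Kc KD KM Km.
have Ksum I r (f : I -> T -> F) : (forall i, K (f i)) -> K (fun x => \sum_(i <- r) f i x).
  move=> Kf; elim: r => [|i r IHr].
    by rewrite (_ : (fun x => _) = fun=> 0)//; apply/funext => x; rewrite big_nil.
  rewrite (_ : (fun x => _) = fun x => f i x + \sum_(i <- r) f i x); first exact: KD.
  by apply/funext => x; rewrite big_cons.
have Kprod I r (f : I -> T -> F) : (forall i, K (f i)) -> K (fun x => \prod_(i <- r) f i x).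
  move=> Kf; elim: r => [|i r IHr].
    by rewrite (_ : (fun x => _) = fun=> 1)//; apply/funext => x; rewrite big_nil.
  rewrite (_ : (fun x => _) = fun x => f i x * \prod_(i <- r) f i x); first exact: KM.
  by apply/funext => x; rewrite big_cons.
rewrite (_ : (fun x => _) = fun x =>
  \sum_(u <- msupp q) mcoeff u q * \prod_(i < n) \prod_(k < u i) m x 0 i); last first.
  apply/funext => x; rewrite /pval mevalE; apply: eq_bigr => u _; congr (_ * _).
  by apply: eq_bigr => i _; rewrite prodr_const card_ord.
by apply: (Ksum) => u; apply: KM => //; apply: (Kprod) => i; apply: (Kprod) => k.
Qed.

Definition polyfun n (f : 'rV[F]_n -> F) := exists q : mpoly n F, forall x, f x = pval q x.

Lemma polyfun_cst n c : @polyfun n (fun=> c).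
Proof. by exists (mpolyC n c) => x; rewrite /pval mevalC. Qed.

Lemma polyfun_coord n j : @polyfun n (fun x => x 0 j).
Proof. by exists (mpolyX F (mnm1 j)) => x; rewrite /pval mevalXU. Qed.

Lemma polyfun_pval n (q : mpoly n F) : polyfun (pval q).
Proof. by exists q. Qed.

Lemma polyfunD n (f g : 'rV[F]_n -> F) :
  polyfun f -> polyfun g -> polyfun (fun x => f x + g x).
Proof. by move=> [q Eq] [r Er]; exists (q + r) => x; rewrite /pval mevalD Eq Er. Qed.

Lemma polyfunM n (f g : 'rV[F]_n -> F) :
  polyfun f -> polyfun g -> polyfun (fun x => f x * g x).
Proof. by move=> [q Eq] [r Er]; exists (q * r) => x; rewrite /pval mevalM Eq Er. Qed.

Lemma polyfunN n (f : 'rV[F]_n -> F) : polyfun f -> polyfun (fun x => - f x).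
Proof. by move=> [q Eq]; exists (- q) => x; rewrite /pval mevalN Eq. Qed.

Lemma polyfunX n (f : 'rV[F]_n -> F) k : polyfun f -> polyfun (fun x => f x ^+ k).
Proof. by move=> [q Eq]; exists (q ^+ k) => x; rewrite /pval rmorphXn Eq. Qed.

Lemma polyfun_sum n I (r : seq I) (f : I -> 'rV[F]_n -> F) :
  (forall i, polyfun (f i)) -> polyfun (fun x => \sum_(i <- r) f i x).
Proof.
move=> /choice[q Eq]; exists (\sum_(i <- r) q i) => x.
by rewrite /pval rmorph_sum; apply: eq_bigr => i _; rewrite Eq.
Qed.

Lemma polyfun_comp n k (f : 'rV[F]_k -> F) (m : 'rV[F]_n -> 'rV[F]_k) :
  polyfun f -> (forall j, polyfun (fun x => m x 0 j)) -> polyfun (fun x => f (m x)).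
Proof.
move=> [q Eq] pm; rewrite (_ : (fun x => _) = fun x => pval q (m x)).
  apply: pval_closed => //; [exact: polyfun_cst|exact: polyfunD|exact: polyfunM].
by apply/funext.
Qed.

(* f is regular on the principal open set b <> 0 *)
Definition ratfun n (b f : 'rV[F]_n -> F) :=
  exists k a, polyfun a /\ forall x, b x != 0 -> f x = a x / b x ^+ k.

Lemma polyfun_ratfun n (b f : 'rV[F]_n -> F) : polyfun f -> ratfun b f.
Proof. by move=> pf; exists 0%N, f; split=> // x _; rewrite expr0 divr1. Qed.

Lemma ratfunD n (b f g : 'rV[F]_n -> F) : polyfun b ->
  ratfun b f -> ratfun b g -> ratfun b (fun x => f x + g x).
Proof.
move=> pb [k [a [pa fE]]] [l [c [pc gE]]].
exists (k + l)%N, (fun x => a x * b x ^+ l + c x * b x ^+ k); split.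
  by apply: polyfunD; apply: polyfunM => //; apply: polyfunX.
move=> x bx; rewrite fE // gE // exprD.
have bk k' : b x ^+ k' != 0 by rewrite expf_neq0.
by field; rewrite !bk.
Qed.

Lemma ratfunM n (b f g : 'rV[F]_n -> F) :
  ratfun b f -> ratfun b g -> ratfun b (fun x => f x * g x).
Proof.
move=> [k [a [pa fE]]] [l [c [pc gE]]].
exists (k + l)%N, (fun x => a x * c x); split; first exact: polyfunM.
move=> x bx; rewrite fE // gE // exprD.
have bk k' : b x ^+ k' != 0 by rewrite expf_neq0.
by field; rewrite !bk.
Qed.

Lemma ratfun_pval n k (b : 'rV[F]_n -> F) (q : mpoly k F) (m : 'rV[F]_n -> 'rV[F]_k) :
  polyfun b -> (forall j, ratfun b (fun x => m x 0 j)) -> ratfun b (fun x => pval q (m x)).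
Proof.
move=> pb pm; apply: pval_closed => // [c|f g|f g].
- by apply: polyfun_ratfun; apply: polyfun_cst.
- exact: ratfunD.
- exact: ratfunM.
Qed.

End PolynomialFunctions.

Section Orbital.
Variable F : fieldType.

(* The coordinate vectors of a point form an orbit of a group acting by
   polynomial maps; this makes the images in X of open sets of coordinates open. *)
Definition orbital (X : hvariety F) :=
  [/\ forall x (P Q : X), coords x P -> coords x Q -> P = Q,
      forall P : X, exists x, coords x P &
      forall x y (P : X), coords x P -> coords y P ->
      exists g : 'rV[F]_(ncoords X) -> 'rV[F]_(ncoords X),
        [/\ forall j, polyfun (fun z => g z 0 j), g x = y &
            forall z (Q : X), coords z Q -> coords (g z) Q]].

Variables X : hvariety F.
Hypothesis Xorb : orbital X.

(** The complement is cut out by all translates of [b] under polynomial coordinate changes: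
    evaluating them at one coordinate vector of a point tests [b] on every coordinate vector of that
    point. *)
Lemma open_nonvanishing (b : 'rV[F]_(ncoords X) -> F) : polyfun b ->
  open [set P : X | exists2 x, coords x P & b x != 0].
Proof.
move=> pb; have [_ _ orb] := Xorb.
exists [set q | exists g : 'rV[F]_(ncoords X) -> 'rV[F]_(ncoords X),
  [/\ forall j, polyfun (fun z => g z 0 j),
  forall z (Q : X), coords z Q -> coords (g z) Q & forall z, pval q z = b (g z)]].
move=> x P xP; split=> [nP q [g [_ gc ->]]|qx [y yP]].
  by apply/eqP/negPn/negP => bg; apply: nP; exists (g x); [exact: gc|].
have [g [pg gx gc]] := orb _ _ _ xP yP; have [q qE] := polyfun_comp pb pg.
by rewrite -gx qE qx ?eqxx//; exists g; split=> // z; rewrite -qE.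
Qed.

Lemma closed_vanishing (K : set ('rV[F]_(ncoords X) -> F)) :
  (forall b, K b -> polyfun b) ->
  closed [set P : X | forall x b, coords x P -> K b -> b x = 0].
Proof.
move=> Kp; rewrite (_ : [set P | _] =
  \bigcap_(b in K) ~` [set P : X | exists2 x, coords x P & b x != 0]).
  by apply: closed_bigI => b Kb; apply: open_closedC; apply: open_nonvanishing; exact: Kp.
apply/seteqP; split=> [P h b Kb [x xP]|P h x b xP Kb]; first by rewrite h ?eqxx.
by apply/eqP/negPn/negP => bx; apply: (h b Kb); exists x.
Qed.

Lemma closed_zclosed (A : set X) : closed A -> zclosed A.
Proof. by move=> /closed_openC h; rewrite -[A]setCK; exact: h. Qed.

End Orbital.

Section Graphs.
Variable F : fieldType.

(** [R] is the graph of the map to be built. Near a point, [m] sends every coordinate vector to one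
    of the partner, with powers of [b] as denominators. Since [m y] does not mention [Q'], the
    formula also forces the partner to be unique wherever coordinate vectors determine points. *)
Definition formula (X Y : hvariety F) (A : set X) (B : set Y) (R : X -> Y -> Prop) :=
  forall (P : X) x, A P -> coords x P ->
    exists b (m : 'rV[F]_(ncoords X) -> 'rV[F]_(ncoords Y)),
    [/\ polyfun b, b x != 0, forall j, ratfun b (fun z => m z 0 j) &
        forall (P' : X) (Q' : Y) y, A P' -> B Q' -> R P' Q' -> coords y P' -> b y != 0 ->
          coords (m y) Q'].

Lemma morphism_of_formula (X Y : hvariety F) (A : set X) (B : set Y) R phi :
  orbital X -> formula A B R -> (forall P, A P -> B (phi P) /\ R P (phi P)) ->
  morphism_on A B phi.
Proof.
move=> Xorb fR phiP; split=> [P /phiP[]//||V g Vop greg].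
  apply/subspace_continuousP => P AP U; rewrite /= nbhsE => -[V [Vop VP] VU].
  have [_ exc _] := Xorb; have [x xP] := exc P.
  have [b [m [pb bx rm mc]]] := fR P x AP xP.
  have [BP RP] := phiP _ AP; have mx := mc _ _ _ AP BP RP xP bx.
  have [S SE] := closed_zclosed (open_closedC Vop).
  have [q Sq qx] : exists2 q, S q & pval q (m x) != 0.
    apply: contrapT => nq; suff : (~` V) (phi P) by apply.
    by apply/(SE _ _ mx) => q Sq; apply/eqP/negPn/negP => ?; apply: nq; exists q.
  have [k [a [pa aE]]] := ratfun_pval q pb rm.
  (* The numerator [a] of the pulled back polynomial detects the open set around the image point;
     [b * a] then cuts out a neighbourhood on which the formula applies and the image stays in that
     open set. *)
  have ax : a x != 0.
    by move: qx; rewrite aE// mulf_eq0 negb_or => /andP[].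
  have Wop := open_nonvanishing Xorb (polyfunM pb pa).
  exists [set P : X | exists2 x, coords x P & b x * a x != 0].
  split; [exact: Wop|by exists x; rewrite ?mulf_neq0|].
  move=> Q /= [y yQ]; rewrite mulf_eq0 negb_or => /andP[by0 ay0] AQ; apply: VU.
  have [BQ RQ] := phiP _ AQ; have my := mc _ _ _ AQ BQ RQ yQ by0.
  apply: contrapT => /(SE _ _ my)/(_ q Sq)/eqP; apply/negP.
  by rewrite aE// mulf_neq0// invr_eq0 expf_neq0.
move=> P x [AP VP] xP.
have [b [m [pb bx rm mc]]] := fR P x AP xP.
have [BP RP] := phiP _ AP; have mx := mc _ _ _ AP BP RP xP bx.
have [c [d [dx cd]]] := greg (phi P) _ (conj BP VP) mx.
have [k [c' [pc cE]]] := ratfun_pval c pb rm.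
have [l [d' [pd dE]]] := ratfun_pval d pb rm.
(* With [c] and [d] pulling back to [c' / b ^ k] and [d' / b ^ l], the quotient is
   [c' b ^ l / (d' b ^ k)]. The extra factor [b] above and below ensures that a nonzero denominator
   gives [b y != 0], even when [k] is 0. *)
have [s sE] := polyfunM (polyfunM pc (polyfunX l pb)) pb.
have [t tE] := polyfunM (polyfunM pd (polyfunX k pb)) pb.
exists s, t; split.
  rewrite -tE !mulf_neq0// ?expf_neq0//.
  by move: dx; rewrite dE// mulf_eq0 negb_or => /andP[].
move=> Q y [AQ VQ] yQ; rewrite -tE -sE !mulf_eq0 !negb_or => /andP[/andP[dy bky] by0].
have [BQ RQ] := phiP _ AQ; have my := mc _ _ _ AQ BQ RQ yQ by0.
have bk j : b y ^+ j != 0 by rewrite expf_neq0.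
rewrite /= (cd _ _ (conj BQ VQ) my) ?dE// ?cE//; last by rewrite mulf_neq0 ?invr_eq0.
by field; rewrite dy by0 !bk.
Qed.

(** The two maps are chosen from the relation. They are inverse to each other because [psi (phi P)]
    and [P] are both partners of [phi P], and the backward formula assigns the same coordinate
    vector to both. The point of [A] and its partner serve as default values outside [A] and [B]. *)
Lemma iso_of_graph (X Y : hvariety F) (A : set X) (B : set Y) (R : X -> Y -> Prop) :
  orbital X -> orbital Y -> A !=set0 ->
  (forall P, A P -> exists2 Q, B Q & R P Q) ->
  (forall Q, B Q -> exists2 P, A P & R P Q) ->
  formula A B R -> formula B A (fun Q P => R P Q) ->
  exists phi psi, inverse_isos A B phi psi /\ forall P, A P -> R P (phi P).
Proof.
move=> Xorb Yorb [P0 AP0] AB BA fR fR'; have [Q0 BQ0 _] := AB _ AP0.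
have [phi phiP] : {phi : X -> Y & forall P, A P -> B (phi P) /\ R P (phi P)}.
  apply: (@choice _ _ (fun P Q => A P -> B Q /\ R P Q)) => P;
    have [/AB[Q BQ RQ]|nA] := pselect (A P);
    by [exists Q|exists Q0].
have [psi psiP] : {psi : Y -> X & forall Q, B Q -> A (psi Q) /\ R (psi Q) Q}.
  apply: (@choice _ _ (fun Q P => B Q -> A P /\ R P Q)) => Q;
    have [/BA[P AP RP]|nB] := pselect (B Q);
    by [exists P|exists P0].
exists phi, psi; split; last by move=> P /phiP[].
split.
- exact: morphism_of_formula fR phiP.
- exact: morphism_of_formula fR' psiP.
- move=> P; rewrite inE => AP; have [BP RP] := phiP _ AP; have [AP' RP'] := psiP _ BP.
  have [Xinj _ _] := Xorb; have [_ exc _] := Yorb; have [y yP] := exc (phi P).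
  have [b [m [_ by0 _ mc]]] := fR' _ _ BP yP.
  exact: Xinj (mc _ _ _ BP AP' RP' yP by0) (mc _ _ _ BP AP RP yP by0).
- move=> Q; rewrite inE => BQ; have [AQ RQ] := psiP _ BQ; have [BQ' RQ'] := phiP _ AQ.
  have [Yinj _ _] := Yorb; have [_ exc _] := Xorb; have [x xQ] := exc (psi Q).
  have [b [m [_ bx0 _ mc]]] := fR _ _ AQ xQ.
  exact: Yinj (mc _ _ _ AQ BQ' RQ' xQ bx0) (mc _ _ _ AQ BQ RQ xQ bx0).
Qed.

End Graphs.

(** * Dimension of the affine plane *)

Section AffinePlane.
Variable F : closedFieldType.

Definition affine_space n : hvariety F :=
  @HVariety F 'rV[F]_n n (fun x P => x = P).

Lemma orbital_affine_space n : orbital (affine_space n).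
Proof.
split=> [x P Q <- <-|P|x y P -> <-]; [by []|by exists P|].
by exists id; split=> // j; exact: polyfun_coord.
Qed.

Lemma polyfun_line n (f : 'rV[F]_n -> F) (x y : 'rV[F]_n) : polyfun f ->
  exists p : {poly F}, forall t, p.[t] = f (x + t *: (y - x)).
Proof.
move=> [q Eq]; have [||||p pE] := @pval_closed F F
  (fun g => exists p : {poly F}, forall t, p.[t] = g t) n (fun t => x + t *: (y - x)) q.
- by move=> c; exists c%:P => t; rewrite hornerC.
- by move=> g h [p pE] [r rE]; exists (p + r) => t; rewrite hornerD pE rE.
- by move=> g h [p pE] [r rE]; exists (p * r) => t; rewrite hornerM pE rE.
- move=> j; exists ((x 0 j)%:P + (y 0 j - x 0 j) *: 'X) => t.
  by rewrite !hornerE !mxE mulrC.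
- by exists p => t; rewrite Eq.
Qed.

(** On the line joining [x] to [y] both functions become polynomials in one variable, nonzero
    because of their values at 0 and at 1. Their product has a nonroot, as the field is
    algebraically closed. *)
Lemma polyfun_nonzeroM n (f g : 'rV[F]_n -> F) x y : polyfun f -> polyfun g ->
  f x != 0 -> g y != 0 -> exists2 z, f z != 0 & g z != 0.
Proof.
move=> pf pg fx gy; have [p pE] := polyfun_line x y pf; have [r rE] := polyfun_line x y pg.
have p0 : p != 0.
  by apply: contraNneq fx => p0; have := pE 0; rewrite p0 horner0 scale0r addr0 => <-.
have r0 : r != 0.
  by apply: contraNneq gy => r0; have := rE 1; rewrite r0 horner0 scale1r addrC subrK => <-.
have /closed_nonrootP[t] : p * r != 0 by rewrite mulf_neq0.
rewrite rootM negb_or !rootE pE rE => /andP[]; by exists (x + t *: (y - x)).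
Qed.

(** If a closed set [A] misses a point of the image, some polynomial function is not identically
    zero and, wherever it is nonzero, the parameter lies in [D] and its image lies outside [A]. For
    two closed sets, a common nonzero of the two functions gives an image point outside both. *)
Lemma irreducible_param (X : hvariety F) n (D : set 'rV[F]_n)
    (u : 'rV[F]_n -> 'rV[F]_(ncoords X)) :
  D !=set0 ->
  (forall x, D x -> exists d, [/\ polyfun d, d x != 0 & forall y, d y != 0 -> D y]) ->
  (forall j, polyfun (fun x => u x 0 j)) ->
  (forall x, D x -> exists P : X, coords (u x) P) ->
  irreducible [set P : X | exists2 x, D x & coords (u x) P].
Proof.
move=> [x0 Dx0] Dop pu uc; split; first by have [P uP] := uc _ Dx0; exists P, x0.
have sep (A : set X) : closed A ->
    ~ ([set P : X | exists2 x, D x & coords (u x) P] `<=` A) ->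
    exists f : 'rV[F]_n -> F, [/\ polyfun f, exists x, f x != 0 &
      forall x, f x != 0 -> D x /\ forall P, coords (u x) P -> ~ A P].
  move=> /closed_zclosed[S SE] /existsNP[P /not_implyP[[x Dx uP]] nAP].
  have [q Sq qx] : exists2 q, S q & pval q (u x) != 0.
    apply: contrapT => nq; apply: nAP; apply/(SE _ _ uP) => q Sq.
    by apply/eqP/negPn/negP => ?; apply: nq; exists q.
  have [d [pd dx dD]] := Dop _ Dx; exists (fun z => d z * pval q (u z)); split.
  - by apply: polyfunM => //; apply: polyfun_comp => //; exact: polyfun_pval.
  - by exists x; rewrite mulf_neq0.
  move=> z; rewrite mulf_eq0 negb_or => /andP[dz qz]; split=> [|Q uQ]; first exact: dD.
  by move=> /(SE _ _ uQ)/(_ _ Sq)/eqP; apply/negP.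
move=> A B Acl Bcl cov; apply: contrapT => /not_orP[/sep-/(_ Acl)[f [pf [x fx] fA]]].
move=> /sep-/(_ Bcl)[g [pg [y gy] gB]].
have [z fz gz] := polyfun_nonzeroM pf pg fx gy.
have [Dz nA] := fA _ fz; have [_ nB] := gB _ gz; have [P uP] := uc z Dz.
by have [|/(nA _ uP)|/(nB _ uP)] := cov P; first by exists z.
Qed.

Section TwoVariables.
Variables i j : 'I_2.
Hypothesis neq_ij : i != j.

(** The outer variable stands for coordinate [j] and the coefficients are polynomials in coordinate
    [i], so that the resultant eliminates coordinate [j]. *)
Let ev (P : {poly {poly F}}) (x : 'rV[F]_2) : F := P.[(x 0 j)%:P].[x 0 i].

Let polyfun_ev P : polyfun (ev P).
Proof.
rewrite (_ : ev P = fun x => \sum_(k < size P) (\sum_(l < size P`_k) P`_k`_l * x 0 i ^+ l) * x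
  0 j ^+ k).
  apply: polyfun_sum => k; apply: polyfunM; last exact/polyfunX/polyfun_coord.
  apply: polyfun_sum => l; apply: polyfunM; first exact: polyfun_cst.
  exact/polyfunX/polyfun_coord.
apply/funext => x; rewrite /ev [P.[_]]horner_coef horner_sum; apply: eq_bigr => k _.
by rewrite hornerM horner_coef -rmorphXn hornerC.
Qed.

Let ev_surj f : polyfun f -> exists P, forall x, f x = ev P x.
Proof.
move=> [q Eq]; have [||||P PE] := @pval_closed F _
  (fun g => exists P, forall x, g x = ev P x) 2 id q.
- by move=> c; exists c%:P%:P => x; rewrite /ev !hornerC.
- by move=> g h [p pE] [r rE]; exists (p + r) => t; rewrite pE rE /ev !hornerD.
- by move=> g h [p pE] [r rE]; exists (p * r) => t; rewrite pE rE /ev !hornerM.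
- move=> k; have [->|nki] := eqVneq k i.
    by exists 'X%:P => x; rewrite /ev hornerC hornerX.
  exists 'X => x; rewrite /ev hornerX hornerC; congr (x 0 _); apply/val_inj => /=.
  by move: neq_ij nki; rewrite -!val_eqE /=; case: i j k => [[|[|]]//] ? [[|[|]]//] ? [[|[|]]].
- by exists P => x; rewrite Eq.
Qed.

Let evM P Q x : ev (P * Q) x = ev P x * ev Q x.
Proof. by rewrite /ev !hornerM. Qed.

Let evD P Q x : ev (P + Q) x = ev P x + ev Q x.
Proof. by rewrite /ev !hornerD. Qed.

Let evC r x : ev r%:P x = r.[x 0 i].
Proof. by rewrite /ev hornerC. Qed.

Let vanishes (C : set (affine_space 2)) P := forall x, C x -> ev P x = 0.

Let vanishesM (C : set (affine_space 2)) P Q : irreducible C ->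
  vanishes C (P * Q) -> vanishes C P \/ vanishes C Q.
Proof.
move=> [_ Cirr] CPQ.
have cl R : closed [set x : affine_space 2 | ev R x = 0].
  rewrite (_ : [set x | _] = [set x : affine_space 2 | forall y b, coords y x ->
     [set ev R] b -> b y = 0]); last first.
    by apply/seteqP; split=> [x Rx y b -> ->//|x /(_ x _ erefl)]; apply.
  by apply: closed_vanishing => [|b ->]; [exact: orbital_affine_space|exact: polyfun_ev].
have [x Cx|h|h] := Cirr _ _ (cl P) (cl Q).
- have /eqP := CPQ x Cx; rewrite evM mulf_eq0 => /orP[]/eqP; by [left|right].
- by left.
- by right.
Qed.

(* C lies in the union of finitely many lines x_i = a, hence in one of them. *)
Let vanishes_polyC (C : set (affine_space 2)) r : irreducible C -> r != 0 ->
  vanishes C r%:P -> exists a, forall x, C x -> x 0 i = a.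
Proof.
move=> Cirr r0; have [s rE] := closed_field_poly_normal r.
have lr : lead_coef r != 0 by rewrite lead_coef_eq0.
have -> : vanishes C r%:P <-> vanishes C (\prod_(z <- s) ('X - z%:P))%:P.
  rewrite {1}rE; split=> h x /h; rewrite !evC hornerZ => /eqP.
    by rewrite mulf_eq0 (negPf lr) => /eqP.
  by move=> /eqP->; rewrite mulr0.
elim: s {rE} => [|z s IHs].
  by case: Cirr => -[x Cx] _ /(_ x Cx); rewrite big_nil evC hornerC => /eqP; rewrite oner_eq0.
rewrite big_cons polyCM => /(vanishesM Cirr)[h|]; last exact: IHs.
by exists z => x /h; rewrite evC !hornerE => /eqP; rewrite subr_eq0 => /eqP.
Qed.

(* Take f of least degree in x_j vanishing on C2, and g vanishing on C1 but not on C2.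
   As C2 is irreducible, f and g have no common factor of positive degree in x_j, so that
   their resultant is a nonzero polynomial in x_i, and it vanishes on C1. *)
Lemma irreducible_in_curve (C1 C2 : set (affine_space 2)) :
  closed C1 -> closed C2 -> irreducible C1 -> irreducible C2 ->
  C1 `<` C2 -> C2 != setT -> exists a, forall x, C1 x -> x 0 i = a.
Proof.
have sep (C : set (affine_space 2)) x : closed C -> ~ C x ->
    exists P, vanishes C P /\ ev P x != 0.
  move=> /closed_zclosed[S SE] nCx.
  have [q Sq qx] : exists2 q, S q & pval q x != 0.
    apply: contrapT => nq; apply: nCx; apply/(SE x x erefl) => q Sq.
    by apply/eqP/negPn/negP => ?; apply: nq; exists q.
  have [P PE] := ev_surj (polyfun_pval q).
  exists P; split; last by rewrite -PE.
  by move=> y /(SE y y erefl)/(_ q Sq); rewrite PE.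
move=> C1cl C2cl C1irr C2irr [C12 /existsNP[x /not_implyP[C2x nC1x]]] C2T.
have [g [C1g gx]] := sep _ _ C1cl nC1x.
have nC2g : ~ vanishes C2 g by move=> /(_ x C2x)/eqP; apply/negP.
have sub P : vanishes C2 P -> vanishes C1 P by move=> h y /C12/h.
(* Such an [f] exists because [C2] is not the whole plane; the degree minimised here is the one in
   coordinate [j] alone. *)
have exf : exists n, `[< exists f, [/\ f != 0, vanishes C2 f & size f = n] >].
  have [y nC2y] : exists y, ~ C2 y.
    by apply/existsNP => h; move/eqP: C2T; apply; apply/seteqP; split.
  have [f [C2f fy]] := sep _ _ C2cl nC2y; exists (size f); apply/asboolP; exists f.
  by split=> //; apply: contraNneq fy => ->; rewrite /ev !horner0.
case: (ex_minnP exf) => n /asboolP[f [f0 C2f sf]] fmin {exf}.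
have {fmin sf}fmin P : P != 0 -> vanishes C2 P -> (size f <= size P)%N.
  by move=> P0 C2P; rewrite sf; apply: fmin; apply/asboolP; exists P.
have g0 : g != 0 by apply: contraNneq gx => ->; rewrite /ev !horner0.
have constant P : P != 0 -> vanishes C1 P -> (size P <= 1)%N ->
    exists a, forall x, C1 x -> x 0 i = a.
  move=> P0 C1P /size1_polyC PE; apply: (@vanishes_polyC C1 P`_0) => //.
    by apply: contraNneq P0 => P00; rewrite PE P00.
  by rewrite -PE.
have [sf|sf] := leqP (size f) 1; first exact: (constant f f0 (sub _ C2f)).
have [sg|sg] := leqP (size g) 1; first exact: (constant g g0 C1g).
have [|r0] := eqVneq (resultant f g) 0; last first.
  have [[u v] /= _ rE] := resultant_in_ideal sf sg.
  apply: vanishes_polyC r0 _ => // y C1y; rewrite rE evD !evM (sub _ C2f y C1y) (C1g y C1y).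
  by rewrite !mulr0 addr0.
move=> /eqP; rewrite resultant_eq0; set h := gcdp f g => sh.
have h0 : h != 0 by rewrite -size_poly_gt0 (ltn_trans _ sh).
(* The coefficients form a domain but not a field, so [h] divides [f] and [g] only up to nonzero
   factors [c] and [d] that are polynomials in coordinate [i]. *)
have /Pdiv.Idomain.dvdpP[[c q]/= c0 fE] := dvdp_gcdl f g.
have /Pdiv.Idomain.dvdpP[[d k]/= d0 gE] := dvdp_gcdr f g.
have q0 : q != 0.
  apply: contraNneq c0 => q0; have /eqP := fE; rewrite q0 mul0r -mul_polyC mulf_eq0 polyC_eq0.
  by rewrite (negPf f0) orbF.
have [C2q|C2h] : vanishes C2 q \/ vanishes C2 h.
  by apply: vanishesM => //; rewrite -fE -mul_polyC => y /C2f fy; rewrite evM fy mulr0.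
(* As [h] has positive degree, [q] would be a nonzero polynomial of smaller degree than [f]
   vanishing on [C2]. *)
- have := fmin q q0 C2q; have := congr1 (fun P : {poly {poly F}} => size P) fE.
  rewrite size_scale // size_mul // => ->.
  rewrite -subn1 leq_subLR addnC leq_add2r => /leq_trans/(_ (leqnn _)).
  by rewrite leqNgt sh.
(* If [h] vanishes on [C2] then so does [d g], but [g] does not; hence [d], of degree 0 in
   coordinate [j], vanishes there, against the minimality of [f]. *)
- have [C2d|//] : vanishes C2 d%:P \/ vanishes C2 g.
    by apply: vanishesM => //; rewrite mul_polyC gE => y /C2h hy; rewrite evM hy mulr0.
  have := fmin d%:P; rewrite polyC_eq0 size_polyC d0 => /(_ isT C2d).
  by rewrite leqNgt sf.
Qed.

End TwoVariables.

(** A third strict inclusion would make [C 2] a proper subset of the plane. Elimination in both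
    orders, applied to [C 1] inside [C 2], then makes both coordinates constant on [C 1], and a
    single point has no nonempty proper subset to serve as [C 0]. *)
Lemma irr_chain_affine_plane n C : irr_chain [set: affine_space 2] n C -> (n <= 2)%N.
Proof.
move=> [Ci Clt]; rewrite leqNgt; apply/negP => n2.
have Ccl k : (k <= n)%N -> closed (C k) by move=> /Ci[[D Dcl ->] _]; rewrite setTI.
have Cirr k : (k <= n)%N -> irreducible (C k) by move=> /Ci[].
have C2T : C 2%N != setT.
  by apply/eqP => C2T; have [_] := Clt _ n2; apply; rewrite C2T.
have lt1n := ltnW n2; have lt0n := ltnW lt1n.
have coord i j : i != j -> exists a, forall x, C 1%N x -> x 0 i = a.
  move=> ij; apply: (irreducible_in_curve ij) C2T; [exact: Ccl|exact: Ccl|exact: Cirr|exact: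
    Cirr|].
  exact: Clt.
have [|a aE] := coord 0 1; first by [].
have [|b bE] := coord 1 0; first by [].
have [sub nsub] := Clt _ lt0n; have [[y C0y] _] := Cirr _ (ltnW lt0n); apply: nsub => x C1x.
suff -> : x = y by [].
apply/rowP => k; case: (fintype.unliftP 0 k) => [k' ->|->].
  by rewrite ord1 (_ : lift 0 0 = 1) ?bE//; [exact: sub|exact/val_inj].
by rewrite !aE//; exact: sub.
Qed.

End AffinePlane.

(** * Projective spaces, products and the blowing-up *)

Section ProjectiveSpaces.
Variable F : fieldType.

Lemma vline_eqP n (x y : 'rV[F]_n) : y != 0 ->
  <[x]>%VS = <[y]>%VS <-> exists2 c, c != 0 & y = c *: x.
Proof.
move=> y0; split=> [xy|[c c0 ->]].
  have /vlineP[c yE] : y \in <[x]>%VS by rewrite xy memv_line.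
  by exists c => //; apply: contraNneq y0 => c0; rewrite yE c0 scale0r.
apply/eqP; rewrite eqEsubv -!memvE memvZ ?memv_line// andbT.
by apply/vlineP; exists c^-1; rewrite scalerA mulVf ?scale1r.
Qed.

Lemma coords_proj_neq0 n x (P : projective_space F n) : coords x P -> x != 0.
Proof. by move=> /= xP; have := valP P; rewrite /= xP dim_vline; case: (x != 0). Qed.

Lemma coords_projZ n x (P : projective_space F n) c :
  c != 0 -> coords x P -> coords (c *: x) P.
Proof.
move=> c0 xP; have x0 := coords_proj_neq0 xP; rewrite /= xP.
by apply/vline_eqP; [rewrite scaler_eq0 negb_or c0|exists c].
Qed.

Lemma coords_proj_eq n x y (P : projective_space F n) :
  coords x P -> coords y P -> exists2 c, c != 0 & y = c *: x.
Proof.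
by move=> xP yP; apply/(vline_eqP _ (coords_proj_neq0 yP)); rewrite -[LHS]xP -[RHS]yP.
Qed.

Lemma coords_proj_inj n x (P Q : projective_space F n) : coords x P -> coords x Q -> P = Q.
Proof. by move=> xP xQ; apply: val_inj; rewrite [LHS]xP [RHS]xQ. Qed.

Lemma coords_proj_ex n (x : 'rV[F]_n.+1) : x != 0 -> exists P : projective_space F n, @coords F
  (projective_space F n) x P.
Proof.
by move=> x0; have d1 : \dim <[x]>%VS == 1%N by [rewrite dim_vline x0];
  exists (exist (fun U : {vspace _} => \dim U == 1%N) _ d1).
Qed.

Lemma orbital_projective_space n : orbital (projective_space F n).
Proof.
split=> [x P Q|P|x y P xP yP]; first exact: coords_proj_inj.
  exists (vpick (val P)); apply/eqP; rewrite eq_sym eqEdim -memvE memv_pick dim_vline vpick0.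
  by rewrite -dimv_eq0 (eqP (valP P)).
have [c c0 yE] := coords_proj_eq xP yP; exists (fun z : 'rV[F]_n.+1 => c *: z); split=> //.
  move=> j; rewrite (_ : (fun z => _) = fun z : 'rV[F]_n.+1 => c * z 0 j).
    by apply: polyfunM; [exact: polyfun_cst|exact: polyfun_coord].
  by apply/funext => z; rewrite mxE.
by move=> z Q; exact: coords_projZ.
Qed.

Lemma polyfun_lsubmx n k (i : 'I_n) : polyfun (fun z : 'rV[F]_(n + k) => lsubmx z 0 i).
Proof.
rewrite (_ : (fun z => _) = fun z : 'rV[F]_(n + k) => z 0 (lshift k i));
  first exact: polyfun_coord.
by apply/funext => z; rewrite mxE.
Qed.

Lemma polyfun_rsubmx n k (i : 'I_k) : polyfun (fun z : 'rV[F]_(n + k) => rsubmx z 0 i).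
Proof.
rewrite (_ : (fun z => _) = fun z : 'rV[F]_(n + k) => z 0 (rshift n i));
  first exact: polyfun_coord.
by apply/funext => z; rewrite mxE.
Qed.

Lemma polyfun_row_mx n k l (f : 'rV[F]_n -> 'rV[F]_k) (g : 'rV[F]_n -> 'rV[F]_l) :
  (forall j, polyfun (fun z => f z 0 j)) -> (forall j, polyfun (fun z => g z 0 j)) ->
  forall j, polyfun (fun z : 'rV[F]_n => row_mx (f z) (g z) 0 j).
Proof.
move=> pf pg j; rewrite (_ : (fun z => _) =
  match fintype.split j with inl i => (fun z : 'rV[F]_n => f z 0 i) | inr i => (fun z => g z 0
    i) end).
  by case: (fintype.split j).
by apply/funext => z; rewrite mxE; case: (fintype.split j).
Qed.

Definition row_of n (s : seq F) : 'rV[F]_n := \row_(j < n) s`_j.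

Lemma polyfun_row_of n k (s : 'rV[F]_n -> seq F) :
  (forall j, (j < k)%N -> polyfun (fun z : 'rV[F]_n => (s z)`_j)) ->
  forall j, polyfun (fun z : 'rV[F]_n => row_of k (s z) 0 j).
Proof.
move=> ps j; rewrite (_ : (fun z => _) = fun z : 'rV[F]_n => (s z)`_j); first exact: ps.
by apply/funext => z; rewrite mxE.
Qed.

Lemma ratfun_row_of n k b (s : 'rV[F]_n -> seq F) :
  (forall j, (j < k)%N -> ratfun b (fun z : 'rV[F]_n => (s z)`_j)) ->
  forall j, ratfun b (fun z : 'rV[F]_n => row_of k (s z) 0 j).
Proof.
move=> ps j; rewrite (_ : (fun z => _) = fun z : 'rV[F]_n => (s z)`_j); first exact: ps.
by apply/funext => z; rewrite mxE.
Qed.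

Lemma orbital_hprod (X Y : hvariety F) : orbital X -> orbital Y -> orbital (hprod X Y).
Proof.
move=> [Xinj Xex Xorb] [Yinj Yex Yorb]; split.
- move=> z [P Q] [P' Q'] /= [zP zQ] [zP' zQ'].
  by rewrite (Xinj _ _ _ zP zP') (Yinj _ _ _ zQ zQ').
- move=> [P Q]; have [x xP] := Xex P; have [y yQ] := Yex Q.
  by exists (row_mx x y); rewrite /= row_mxKl row_mxKr.
move=> x y [P Q] /= [xP xQ] [yP yQ].
have [g [pg gx gc]] := Xorb _ _ _ xP yP; have [h [ph hx hc]] := Yorb _ _ _ xQ yQ.
exists (fun z : 'rV[F]_(ncoords X + ncoords Y) => row_mx (g (lsubmx z)) (h (rsubmx z))); split.
- apply: polyfun_row_mx => j.
    by apply: (polyfun_comp (pg j)) => k; exact: polyfun_lsubmx.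
  by apply: (polyfun_comp (ph j)) => k; exact: polyfun_rsubmx.
- by rewrite gx hx hsubmxK.
- by move=> z [P' Q'] /= [zP zQ]; rewrite row_mxKl row_mxKr; split; [exact: gc|exact: hc].
Qed.

End ProjectiveSpaces.

Section Models.
Variable F : closedFieldType.
Notation P1 := (projective_space F 1).
Notation P2 := (projective_space F 2).

Lemma ord2P (i : 'I_2) : i = 0 \/ i = 1.
Proof. by case: i => [[|[|//]] k]; [left|right]; exact/val_inj. Qed.

Lemma rV_neq0 n (x : 'rV[F]_n) : x != 0 -> exists i, x 0 i != 0.
Proof.
move=> x0; apply/existsP; apply: contraNT x0; rewrite negb_exists => /forallP h.
by apply/eqP/rowP => i; rewrite mxE; apply/eqP/negPn.
Qed.

Lemma coord_neq0 n (x : 'rV[F]_n) i : x 0 i != 0 -> x != 0.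
Proof. by apply: contraNneq => ->; rewrite mxE. Qed.

Lemma irreducible_projective_space n : irreducible [set: projective_space F n].
Proof.
rewrite (_ : setT = [set P : projective_space F n | exists2 x, x != 0 & coords (id x) P]).
  apply: irreducible_param => [|x /rV_neq0[i xi]|j|x].
  - by exists (delta_mx 0 0); apply: (@coord_neq0 _ _ 0); rewrite mxE !eqxx oner_eq0.
  - by exists (fun y : 'rV[F]_n.+1 => y 0 i); split=> // [|y /coord_neq0];
      first exact: polyfun_coord.
  - exact: polyfun_coord.
  - exact: coords_proj_ex.
apply/seteqP; split=> // P _; have [_ ex _] := orbital_projective_space F n.
by have [x xP] := ex P; exists x => //; exact: coords_proj_neq0 xP.
Qed.

Lemma irreducible_P1xP1 : irreducible [set: hprod P1 P1].
Proof.
rewrite (_ : setT = [set P : hprod P1 P1 | exists2 x : 'rV[F]_(2 + 2),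
  lsubmx x != 0 /\ rsubmx x != 0 & @coords F (hprod P1 P1) (id x) P]).
  apply: (@irreducible_param F (hprod P1 P1)) => [|x [/rV_neq0[i xi] /rV_neq0[j xj]]|j|x [x0
    x1]].
  - exists (row_mx (delta_mx 0 0) (delta_mx 0 0)); rewrite row_mxKl row_mxKr.
    by split; apply: (@coord_neq0 _ _ 0); rewrite mxE !eqxx oner_eq0.
  - exists (fun y : 'rV[F]_(2 + 2) => lsubmx y 0 i * rsubmx y 0 j); split; last first.
    + by move=> y; rewrite mulf_eq0 negb_or => /andP[/coord_neq0 ? /coord_neq0].
    + by rewrite mulf_neq0.
    + by apply: polyfunM; [exact: polyfun_lsubmx|exact: polyfun_rsubmx].
  - exact: polyfun_coord.
  - have [P xP] := coords_proj_ex x0; have [Q xQ] := coords_proj_ex x1.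
    by exists (P, Q).
apply/seteqP; split=> // -[P Q] _; have [_ ex _] := orbital_projective_space F 1.
have [x xP] := ex P; have [y yQ] := ex Q.
exists (row_mx x y); rewrite /= row_mxKl row_mxKr //.
by split; [exact: coords_proj_neq0 xP|exact: coords_proj_neq0 yQ].
Qed.

(* A point of the blowing-up is ([t y0 : t y1 : s], [y0 : y1]): it is a
   P^1-bundle over P^1. *)
Definition blowup_row (z : 'rV[F]_(2 + 2)) : 'rV[F]_(3 + 2) :=
  row_mx (row_of 3 [:: rsubmx z 0 0 * lsubmx z 0 0; rsubmx z 0 0 * lsubmx z 0 1; rsubmx z 0 1])
         (lsubmx z).

Lemma polyfun_blowup_row j : polyfun (fun z => blowup_row z 0 j).
Proof.
apply: polyfun_row_mx; last by move=> k; exact: polyfun_lsubmx.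
apply: polyfun_row_of => -[|[|[|k]]] //= _; do ?apply: polyfunM;
  by [exact: polyfun_lsubmx|exact: polyfun_rsubmx].
Qed.

Lemma coords_blowup_row z (P : hprod P2 P1) : @coords F (hprod P2 P1) (blowup_row z) P ->
  blowup_P2 F P.
Proof.
case: P => P Q /= []; rewrite row_mxKl row_mxKr => xP yQ.
by eexists; eexists; split; [exact: xP|exact: yQ|]; rewrite !mxE /= mulrAC.
Qed.

Lemma blowup_row_ex (z : 'rV[F]_(2 + 2)) : lsubmx z != 0 -> rsubmx z != 0 ->
  exists P : hprod P2 P1, @coords F (hprod P2 P1) (blowup_row z) P.
Proof.
move=> l0 r0; have [Q zQ] := coords_proj_ex l0.
have [|P zP] := @coords_proj_ex F 2
    (row_of 3 [:: rsubmx z 0 0 * lsubmx z 0 0; rsubmx z 0 0 * lsubmx z 0 1; rsubmx z 0 1]).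
  have [i ri] := rV_neq0 r0; have [k lk] := rV_neq0 l0.
  have [i0|i1] := ord2P i; rewrite ?i0 ?i1 in ri.
    have [k0|k1] := ord2P k; rewrite ?k0 ?k1 in lk.
      by apply: (@coord_neq0 _ _ 0); rewrite mxE /= mulf_neq0.
    by apply: (@coord_neq0 _ _ 1); rewrite mxE /= mulf_neq0.
  by apply: (@coord_neq0 _ _ 2); rewrite mxE.
by exists (P, Q); split; rewrite /= ?row_mxKl ?row_mxKr.
Qed.

Lemma blowup_rowP (P : hprod P2 P1) : blowup_P2 F P ->
  exists z, [/\ lsubmx z != 0, rsubmx z != 0 & @coords F (hprod P2 P1) (blowup_row z) P].
Proof.
case: P => P Q [x [y /= [xP yQ xy]]].
have x0 : x != 0 by exact: (@coords_proj_neq0 _ _ x P).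
have y0 : y != 0 by exact: (@coords_proj_neq0 _ _ y Q).
(* The factor [t] relating the first two coordinates of [x] to [y] is read off at a nonzero
   coordinate of [y]; the equation of the blowing-up gives the other coordinate. *)
have [t xt] : exists t, x 0 0 = t * y 0 0 /\ x 0 1 = t * y 0 1.
  have [i yi] := rV_neq0 y0; have [i0|i1] := ord2P i; rewrite ?i0 ?i1 in yi.
    exists (x 0 0 / y 0 0); split; first by rewrite divfK.
    by rewrite mulrAC xy mulfK.
  exists (x 0 1 / y 0 1); split; last by rewrite divfK.
  by rewrite mulrAC -xy mulfK.
exists (row_mx y (row_of 2 [:: t; x 0 2])).
have xE : x = row_of 3 [:: t * y 0 0; t * y 0 1; x 0 2].
  apply/rowP => -[[|[|[|]]]//= k]; rewrite mxE /=.
  - by case: xt => <- _; congr (x 0 _); exact/val_inj.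
  - by case: xt => _ <-; congr (x 0 _); exact/val_inj.
  - by congr (x 0 _); exact/val_inj.
rewrite /blowup_row !row_mxKl !row_mxKr; split=> //.
  apply: contraNneq x0 => /rowP ts0; rewrite xE; apply/eqP/rowP => k; rewrite !mxE.
  have := ts0 0; have := ts0 1; rewrite !mxE /= => -> ->.
  by case: k => [[|[|[|]]]]//= _; rewrite mul0r.
by split=> //; rewrite ![in row_of 2 _ _ _]mxE /= -xE.
Qed.

Lemma irreducible_blowup_P2 : irreducible (blowup_P2 F).
Proof.
rewrite (_ : blowup_P2 F = [set P : hprod P2 P1 | exists2 z,
  lsubmx z != 0 /\ rsubmx z != 0 & @coords F (hprod P2 P1) (blowup_row z) P]).
  apply: (@irreducible_param F (hprod P2 P1)) => [|x [/rV_neq0[i xi] /rV_neq0[j xj]]|j|x [x0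
    x1]].
  - exists (row_mx (delta_mx 0 0) (delta_mx 0 0)); rewrite row_mxKl row_mxKr.
    by split; apply: (@coord_neq0 _ _ 0); rewrite mxE !eqxx oner_eq0.
  - exists (fun y : 'rV[F]_(2 + 2) => lsubmx y 0 i * rsubmx y 0 j); split; last first.
    + by move=> y; rewrite mulf_eq0 negb_or => /andP[/coord_neq0 ? /coord_neq0].
    + by rewrite mulf_neq0.
    + by apply: polyfunM; [exact: polyfun_lsubmx|exact: polyfun_rsubmx].
  - exact: polyfun_blowup_row.
  - exact: blowup_row_ex.
apply/seteqP; split=> [P /blowup_rowP[z [z0 z1 zP]]|P [z _ /coords_blowup_row]//].
by exists z.
Qed.

(** Here [u] parametrises the chart and [m] recovers the parameter. The last hypothesis makes the
    condition [b w != 0] independent of the coordinate vector, so that [m] is available at every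
    coordinate vector of a point of the chart. *)
Lemma affine_chart (X : hvariety F) (B : set X) n
    (u : 'rV[F]_n -> 'rV[F]_(ncoords X)) (b : 'rV[F]_(ncoords X) -> F)
    (m : 'rV[F]_(ncoords X) -> 'rV[F]_n) :
  orbital X -> polyfun b -> (forall j, polyfun (fun z => u z 0 j)) ->
  (forall j, ratfun b (fun w => m w 0 j)) ->
  (forall z, b (u z) != 0 /\ exists2 P, B P & coords (u z) P) ->
  (forall z w P, coords (u z) P -> coords w P -> b w != 0 -> m w = z) ->
  (forall P w, B P -> coords w P -> b w != 0 -> exists z, coords (u z) P) ->
  (forall P w w', coords w P -> coords w' P -> b w != 0 -> b w' != 0) ->
  exists phi psi, inverse_isos [set: affine_space F n]
    (B `&` [set P | exists2 w, coords w P & b w != 0]) phi psi.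
Proof.
move=> Xorb pb pu rm uB mu Bu binv.
have [|||||||phi [psi [iso _]]] := @iso_of_graph F (affine_space F n) X setT
  (B `&` [set P | exists2 w, coords w P & b w != 0]) (fun z P => coords (u z) P).
- exact: orbital_affine_space.
- exact: Xorb.
- by exists 0.
- by move=> z _; have [bu [P BP uP]] := uB z; exists P; [split=> //; exists (u z)|].
- by move=> P [BP [w wP bw]]; have [z zP] := Bu _ _ BP wP bw; exists z.
- move=> z x _ ->; exists (fun=> 1), u; split.
  + exact: polyfun_cst.
  + exact: oner_neq0.
  + by move=> j; exact: polyfun_ratfun.
  + by move=> z' P y _ _ uP ->.
- move=> P w [BP [w' w'P bw']] wP; exists b, m; split=> //; first exact: binv w'P wP bw'.
  by move=> Q z y _ _; exact: mu.
by exists phi, psi.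
Qed.

End Models.

(** * Affine charts of the two surface models, and their dimension bounds *)

Section Charts.
Variable F : closedFieldType.
Notation P1 := (projective_space F 1).
Notation P2 := (projective_space F 2).

Lemma rev_ord2 : (rev_ord 0 = 1 :> 'I_2) * (rev_ord 1 = 0 :> 'I_2).
Proof. by split; exact/val_inj. Qed.

(** The standard chart of P^1 x P^1 in which coordinate [i] of the first factor and coordinate [j]
    of the second are normalised to 1; [rev_ord] will denote the other index. *)
Definition chart_row (i j : 'I_2) (z : 'rV[F]_2) : 'rV[F]_(2 + 2) :=
  row_mx (\row_k (if k == i then 1 else z 0 0)) (\row_k (if k == j then 1 else z 0 1)).

Lemma polyfun_chart_row i j k : polyfun (fun z => chart_row i j z 0 k).
Proof.
have polyfun_entry (a c : 'I_2) : polyfun (fun z : 'rV[F]_2 => if a == c then 1 else z 0 (0 :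
  'I_2)) /\
    polyfun (fun z : 'rV[F]_2 => if a == c then 1 else z 0 (1 : 'I_2)).
  by case: eqP => _; split; do ?[exact: polyfun_cst|exact: polyfun_coord].
apply: polyfun_row_mx => l; under eq_fun do rewrite mxE.
  by case: (polyfun_entry l i).
by case: (polyfun_entry l j).
Qed.

Lemma chart_rowE (x : 'rV[F]_2) l t : t = x 0 (rev_ord l) / x 0 l -> x 0 l != 0 ->
  \row_k (if k == l then 1 else t) = (x 0 l)^-1 *: x.
Proof.
move=> -> x0; apply/rowP => k; rewrite !mxE; case: eqP => [->|]; first by rewrite mulVf.
by have [->|->] := ord2P k; have [->|->] := ord2P l; rewrite ?rev_ord2 //= mulrC.
Qed.

Lemma chart_row_neq0 i j z : lsubmx (chart_row i j z) != 0 /\ rsubmx (chart_row i j z) != 0.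
Proof.
rewrite row_mxKl row_mxKr; split; [apply: (@coord_neq0 _ _ _ i)|apply: (@coord_neq0 _ _ _ j)];
  by rewrite mxE eqxx oner_eq0.
Qed.

Lemma ratfun_frac n (b f g h : 'rV[F]_n -> F) :
  polyfun f -> polyfun h -> (forall w, b w = g w * h w) -> ratfun b (fun w => f w / g w).
Proof.
move=> pf ph bE; exists 1%N, (fun w => f w * h w); split; first exact: polyfunM.
move=> w; rewrite bE mulf_eq0 negb_or => /andP[g0 h0].
by field; rewrite g0 h0.
Qed.

Lemma P1xP1_chart i j : exists phi psi, inverse_isos [set: affine_space F 2]
  ([set: hprod P1 P1] `&` [set P | exists2 w : 'rV[F]_(2 + 2), @coords F (hprod P1 P1) w P &
     lsubmx w 0 i * rsubmx w 0 j != 0]) phi psi.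
Proof.
have P1orb := orbital_projective_space F 1.
apply: (@affine_chart F (hprod P1 P1) setT 2 (chart_row i j)
  (fun w : 'rV[F]_(2 + 2) => lsubmx w 0 i * rsubmx w 0 j)
  (fun w : 'rV[F]_(2 + 2) => row_of 2 [:: lsubmx w 0 (rev_ord i) / lsubmx w 0 i;
                         rsubmx w 0 (rev_ord j) / rsubmx w 0 j])).
- exact: orbital_hprod.
- by apply: polyfunM; [exact: polyfun_lsubmx|exact: polyfun_rsubmx].
- exact: polyfun_chart_row.
- apply: ratfun_row_of => -[|[|//]] _ /=.
    apply: (ratfun_frac (h := fun w => rsubmx w 0 j)) => //;
    by [exact: polyfun_lsubmx|exact: polyfun_rsubmx].
  apply: (ratfun_frac (h := fun w => lsubmx w 0 i)) => [||w];
    by [exact: polyfun_lsubmx|exact: polyfun_rsubmx|exact: mulrC].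
- move=> z; split; first by rewrite row_mxKl row_mxKr !mxE !eqxx mulr1 oner_eq0.
  have [l0 r0] := chart_row_neq0 i j z.
  by have [P zP] := coords_proj_ex l0; have [Q zQ] := coords_proj_ex r0; exists (P, Q).
- move=> z w [P Q] [zP zQ] [wP wQ] _.
  have [c c0 lE] := coords_proj_eq zP wP; have [d d0 rE] := coords_proj_eq zQ wQ.
  apply/rowP => k; rewrite mxE lE rE row_mxKl row_mxKr !mxE !eqxx !mulr1.
  have revN l : (rev_ord l == l :> 'I_2) = false by have [->|->] := ord2P l; rewrite rev_ord2.
  by have [->|->] := ord2P k; rewrite /= revN mulrC mulKf.
- move=> [P Q] w _ [wP wQ]; rewrite mulf_eq0 negb_or => /andP[wi wj].
  exists (row_of 2 [:: lsubmx w 0 (rev_ord i) / lsubmx w 0 i;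
                         rsubmx w 0 (rev_ord j) / rsubmx w 0 j]).
  split; rewrite /= ?row_mxKl ?row_mxKr.
    rewrite (chart_rowE (x := lsubmx w) (l := i) _ wi); last by rewrite mxE.
    by apply: (@coords_projZ _ 1 _ P _ _ wP); rewrite invr_eq0.
  rewrite (chart_rowE (x := rsubmx w) (l := j) _ wj); last by rewrite mxE.
  by apply: (@coords_projZ _ 1 _ Q _ _ wQ); rewrite invr_eq0.
- move=> [P Q] w w' [wP wQ] [w'P w'Q].
  have [c c0 ->] := coords_proj_eq wP w'P; have [d d0 ->] := coords_proj_eq wQ w'Q.
  by rewrite !mxE !mulf_eq0 !negb_or c0 d0.
Qed.

(** Over the part of P^1 where [y 0 i] is nonzero, the fibre of the blowing-up is a P^1 with
    homogeneous coordinates [(x_i : x_2)]; [j] selects one of the two. Together [i] and [j] index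
    the four charts. *)
Definition bundle_coord (i j : 'I_2) (x : 'rV[F]_3) := x 0 (if j == 0 then widen_ord (leqnSn 2)
  i else 2).

Lemma bundle_coord_row i j z :
  bundle_coord i j (lsubmx (blowup_row z)) =
  if j == 0 then rsubmx z 0 0 * lsubmx z 0 i else rsubmx z 0 1.
Proof.
rewrite /bundle_coord row_mxKl mxE; case: eqP => //= _.
by have [->|->] := ord2P i.
Qed.

Lemma bundle_coordZ i j c x : bundle_coord i j (c *: x) = c * bundle_coord i j x.
Proof. by rewrite /bundle_coord mxE. Qed.

Lemma polyfun_bundle_coord i j :
  polyfun (fun w : 'rV[F]_(3 + 2) => bundle_coord i j (lsubmx w)).
Proof. exact: polyfun_lsubmx. Qed.

Lemma blowup_chart i j : exists phi psi, inverse_isos [set: affine_space F 2]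
  (blowup_P2 F `&` [set P | exists2 w : 'rV[F]_(3 + 2), @coords F (hprod P2 P1) w P &
     rsubmx w 0 i * bundle_coord i j (lsubmx w) != 0]) phi psi.
Proof.
have P1orb := orbital_projective_space F 1; have P2orb := orbital_projective_space F 2.
have revN l : (rev_ord l == l :> 'I_2) = false by have [->|->] := ord2P l; rewrite rev_ord2.
apply: (@affine_chart F (hprod P2 P1) (blowup_P2 F) 2 (fun z => blowup_row (chart_row i j z))
  (fun w : 'rV[F]_(3 + 2) => rsubmx w 0 i * bundle_coord i j (lsubmx w))
  (fun w : 'rV[F]_(3 + 2) => row_of 2 [:: rsubmx w 0 (rev_ord i) / rsubmx w 0 i;
     bundle_coord i (rev_ord j) (lsubmx w) / bundle_coord i j (lsubmx w)])).
- exact: orbital_hprod.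
- by apply: polyfunM; [exact: polyfun_rsubmx|exact: polyfun_bundle_coord].
- move=> k; have := polyfun_comp (@polyfun_blowup_row F k) (m := chart_row i j).
  by apply => l; exact: polyfun_chart_row.
- apply: ratfun_row_of => -[|[|//]] _ /=.
    apply: (ratfun_frac (h := fun w => bundle_coord i j (lsubmx w))) => //;
    by [exact: polyfun_bundle_coord|exact: polyfun_rsubmx].
  apply: (ratfun_frac (h := fun w => rsubmx w 0 i)) => [||w];
    by [exact: polyfun_bundle_coord|exact: polyfun_rsubmx|exact: mulrC].
- move=> z; split.
    rewrite bundle_coord_row /blowup_row /chart_row !row_mxKr row_mxKl !mxE eqxx mul1r mulr1.
    by have [->|->] := ord2P j; rewrite /= oner_eq0.
  have [l0 r0] := chart_row_neq0 i j z.
  have [P zP] := blowup_row_ex l0 r0; exists P => //; exact: coords_blowup_row zP.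
- move=> z w [P Q] [zP zQ] [wP wQ] _.
  have [c c0 lE] := coords_proj_eq zP wP; have [d d0 rE] := coords_proj_eq zQ wQ.
  apply/rowP => k; rewrite mxE lE rE !bundle_coordZ !bundle_coord_row.
  rewrite /blowup_row /chart_row !row_mxKr row_mxKl !mxE !eqxx.
  have [->|->] := ord2P k; rewrite /= ?revN ?mulr1; first by rewrite mulrC mulKf.
  by have [->|->] := ord2P j; rewrite !rev_ord2 /= !mulr1 mulrC mulKf.
- move=> [P Q] w BPQ [wP wQ]; have [z [_ _ [zP zQ]]] := blowup_rowP BPQ.
  have [c c0 lE] := coords_proj_eq zP wP; have [d d0 rE] := coords_proj_eq zQ wQ.
  rewrite lE rE bundle_coordZ bundle_coord_row /= row_mxKr mxE !mulf_eq0 !negb_or.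
  move=> /andP[/andP[_ yi] /andP[_ tj]].
  (* The second parameter is the quotient of the fibre coordinates [t y_i] and [s], in the order
     that normalises the one selected by [j]. *)
  exists (row_of 2 [:: lsubmx z 0 (rev_ord i) / lsubmx z 0 i;
    if j == 0 then rsubmx z 0 1 / (rsubmx z 0 0 * lsubmx z 0 i)
    else rsubmx z 0 0 * lsubmx z 0 i / rsubmx z 0 1]).
  have zQ' : @coords F P1 (lsubmx z) Q by move: zQ; rewrite /= row_mxKr.
  have zP' : @coords F P2 (row_of 3 [:: rsubmx z 0 0 * lsubmx z 0 0;
      rsubmx z 0 0 * lsubmx z 0 1; rsubmx z 0 1]) P by move: zP; rewrite /= row_mxKl.
  move: (lsubmx z) (rsubmx z) yi tj zQ' zP' => y r yi tj zQ' zP'.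
  have yE : \row_k (if k == i then 1 else y 0 (rev_ord i) / y 0 i) = (y 0 i)^-1 *: y.
    exact: chart_rowE.
  split; rewrite /= /blowup_row ?row_mxKl ?row_mxKr; last first.
    by rewrite mxE /= yE; apply: (@coords_projZ _ 1 _ Q _ _ zQ'); rewrite invr_eq0.
  rewrite [row_of _ [:: _; _; _]](_ : _ =
    (if j == 0 then r 0 0 * y 0 i else r 0 1)^-1 *: row_of 3 [:: r 0 0 * y 0 0; r 0 0 * y 0 1;
      r 0 1]).
    by apply: (@coords_projZ _ 2 _ P _ _ zP'); rewrite invr_eq0.
  have yEk k : (if k == i then 1 else y 0 (rev_ord i) / y 0 i) = (y 0 i)^-1 * y 0 k.
    by have := congr1 (fun x : 'rV_2 => x 0 k) yE; rewrite !mxE.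
  apply/rowP => -[k k3]; rewrite !mxE /= !yEk.
  have [j0|j1] := ord2P j; rewrite ?j0 ?j1 /= in tj *.
    move: tj; rewrite mulf_eq0 negb_or => /andP[r0 _].
    by case: k k3 => [|[|[|//]]] _ /=; field; rewrite r0 yi.
  by case: k k3 => [|[|[|//]]] _ /=; field; rewrite tj ?yi.
- move=> [P Q] w w' [wP wQ] [w'P w'Q].
  have [c c0 ->] := coords_proj_eq wP w'P; have [d d0 ->] := coords_proj_eq wQ w'Q.
  by move=> h; rewrite bundle_coordZ mxE mulrACA mulf_neq0// mulf_neq0.
Qed.

(** A single chart is enough for a given chain: taken around a point of the smallest member, it
    meets every member. *)
Lemma irr_chain_charts (X : hvariety F) (B : set X) n C :
  (forall P, B P -> exists O phi psi, [/\ open O, O P &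
     inverse_isos [set: affine_space F 2] (B `&` O) phi psi]) ->
  irr_chain B n C -> (n <= 2)%N.
Proof.
move=> charts CB; have [/(_ 0%N (leq0n n))[[D _ CE] [[P CP] _]] _] := CB.
have [|O [phi [psi [Oop OP iso]]]] := charts P; first by move: CP; rewrite CE => -[].
by apply: irr_chain_affine_plane (irr_chain_pullback iso Oop CB _); exists P.
Qed.

Lemma irr_chain_P1xP1 n C : irr_chain [set: hprod P1 P1] n C -> (n <= 2)%N.
Proof.
have P1orb := orbital_projective_space F 1.
apply: irr_chain_charts => -[P Q] _; have [_ ex _] := P1orb.
have [x xP] := ex P; have [y yQ] := ex Q.
have [i xi] := rV_neq0 (coords_proj_neq0 xP); have [j yj] := rV_neq0 (coords_proj_neq0 yQ).
have [phi [psi iso]] := P1xP1_chart i j; eexists; exists phi, psi; split; last exact: iso.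
  apply: open_nonvanishing; first exact: orbital_hprod.
  by apply: polyfunM; [exact: polyfun_lsubmx|exact: polyfun_rsubmx].
exists (row_mx x y); first by rewrite /= row_mxKl row_mxKr.
by rewrite row_mxKl row_mxKr mulf_neq0.
Qed.

Lemma irr_chain_blowup_P2 n C : irr_chain (blowup_P2 F) n C -> (n <= 2)%N.
Proof.
apply: irr_chain_charts => P /blowup_rowP[z [/rV_neq0[i yi] /rV_neq0[j rj] zP]].
have [phi [psi iso]] := blowup_chart i j; eexists; exists phi, psi; split; last exact: iso.
  apply: open_nonvanishing.
    by apply: orbital_hprod; exact: orbital_projective_space.
  by apply: polyfunM; [exact: polyfun_rsubmx|exact: polyfun_bundle_coord].
exists (blowup_row z) => //; rewrite bundle_coord_row row_mxKr mulf_neq0//.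
by move: rj; have [->|->] := ord2P j => //= rj; rewrite mulf_neq0.
Qed.

Lemma irr_chain_iso (X Y : hvariety F) (A : set X) (B : set Y) n C :
  isomorphic A B -> irr_chain B n C -> exists C', irr_chain A n C'.
Proof.
move=> [phi [psi iso]] CB; have iso' : inverse_isos A (B `&` setT) phi psi by rewrite setIT.
eexists; apply: (irr_chain_pullback iso' _ CB); first exact: openT.
by rewrite setIT; case: CB => /(_ 0%N (leq0n _))[_ []].
Qed.

End Charts.

(** * Flags and the symplectic form *)

Section FlagCoordinates.
Variables (F : fieldType) (n : nat).
Implicit Types (M : 'M[F]_n) (W : flag_variety F n).

Definition span_rows M i := <<[seq row k M | k : 'I_n <- enum 'I_n & (k < i)%N]>>%VS.

Lemma row_in_span_rows M i (k : 'I_n) : (k < i)%N -> row k M \in span_rows M i.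
Proof.
by move=> ki; apply/memv_span/mapP; exists k; rewrite // mem_filter ki mem_enum.
Qed.

Lemma span_rows_sub M i (U : {vspace 'rV[F]_n}) :
  (forall k : 'I_n, (k < i)%N -> row k M \in U) -> (span_rows M i <= U)%VS.
Proof.
move=> MU; apply/span_subvP => x /mapP[k]; rewrite mem_filter => /andP[ki _] ->.
exact: MU.
Qed.

Lemma mem_span_rows M i x : x \in span_rows M i ->
  exists2 c : 'rV_n, (forall k : 'I_n, (i <= k)%N -> c 0 k = 0) & x = c *m M.
Proof.
rewrite /span_rows span_def big_map big_filter big_enum_cond /= => /memv_sumP[v vM ->].
have /choice[c cE] : forall k : 'I_n, exists c, (k < i)%N -> v k = c *: row k M.
  move=> k; have [ki|] := boolP (k < i)%N; last by exists 0.
  by have /vlineP[c ->] := vM k ki; exists c.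
exists (\row_k (if (k < i)%N then c k else 0)) => [k|].
  by rewrite mxE leqNgt => /negPf->.
rewrite mulmx_sum_row big_mkcond /=; apply: eq_bigr => k _; rewrite mxE.
by case: ifP => [ki|_]; [rewrite cE|rewrite scale0r].
Qed.

Lemma span_rowsT M : M \in unitmx -> span_rows M n = fullv.
Proof.
move=> Mu; apply/eqP; rewrite eqEsubv subvf; apply/subvP => x _.
rewrite -(mulmxKV Mu x) mulmx_sum_row; apply: memv_suml => k _.
by apply: memvZ; apply: row_in_span_rows.
Qed.

Lemma span_rowsT_unitmx M : span_rows M n = fullv -> M \in unitmx.
Proof.
move=> MT; rewrite -row_full_unit -sub1mx; apply/row_subP => k.
have /mem_span_rows[c _ ->] : row k 1%:M \in span_rows M n by rewrite MT memvf.
exact: submxMl.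
Qed.

(** The number of generators only bounds dimensions from above. The lower bound comes from the
    remaining [n - i] rows, which together with the first ones span everything. *)
Lemma dim_span_rows M i : M \in unitmx -> (i <= n)%N -> \dim (span_rows M i) = i.
Proof.
move=> Mu lein; pose s P := [seq row k M | k <- enum 'I_n & P k].
have szs : size (s (fun k => (k < i)%N)) = i.
  rewrite size_map size_filter -(count_map val (fun k => k < i)%N) val_enum_ord.
  by rewrite -size_filter (@filter_iota_ltn 0 n i) // size_iota.
have szC : size (s (fun k => ~~ (k < i)%N)) = (n - i)%N.
  have := size_map (fun k => row k M) (enum 'I_n); rewrite size_enum_ord => szn.
  move: szs; rewrite /s !size_map !size_filter => szs.
  by rewrite -[in LHS]/(count (predC (fun k : 'I_n => (k < i)%N)) _) -{1}szs
    -[in RHS](size_enum_ord n) -(count_predC (fun k : 'I_n => (k < i)%N)) szs addKn.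
apply/eqP; rewrite eqn_leq -{2}szs dim_span /=.
have : (fullv <= span_rows M i + <<s (fun k => ~~ (k < i)%N)>>)%VS.
  rewrite -(span_rowsT Mu); apply: span_rows_sub => k _.
  have [ki|ki] := boolP (k < i)%N.
    by apply: subvP (addvSl _ _) _ _; exact: row_in_span_rows.
  apply: subvP (addvSr _ _) _ _; apply: memv_span; apply/mapP.
  by exists k; rewrite // mem_filter ki mem_enum.
move=> /dimvS; rewrite dimvf /dim /= mul1n => le_n.
have := leq_trans le_n (dimv_add_leqif _ _).
move=> /leq_trans/(_ (leq_add (leqnn _) (dim_span _))); rewrite szC.
by rewrite addnC -leq_subLR subKn.
Qed.

Lemma coordsP g W : coords g W ->
  forall i, (i <= n)%N -> steps W (inord i) = span_rows (vec_mx g) i.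
Proof. by move=> gW i lein; rewrite [LHS]gW inordK. Qed.

Lemma flag_dim W (i : 'I_n.+1) : \dim (steps W i) = i.
Proof. by have /andP[/forallP/(_ i)/eqP] := valP W. Qed.

Lemma flag_sub W (i j : 'I_n.+1) : (i <= j)%N -> (steps W i <= steps W j)%VS.
Proof. by have /andP[_ /forallP/(_ i)/forallP/(_ j)/implyP] := valP W; apply. Qed.

Lemma flag_eq W W' : steps W = steps W' -> W = W'.
Proof. exact: val_inj. Qed.

Lemma coords_unitmx g W : coords g W -> vec_mx g \in unitmx.
Proof.
move=> gW; apply: span_rowsT_unitmx; rewrite -(coordsP gW) //; apply/eqP.
by rewrite eqEdim subvf dimvf /dim /= mul1n flag_dim inordK.
Qed.

Lemma coords_row g W (k : 'I_n) (i : 'I_n.+1) :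
  coords g W -> (k < i)%N -> row k (vec_mx g) \in steps W i.
Proof. by move=> gW ki; rewrite [steps W i]gW; exact: row_in_span_rows. Qed.

Lemma coords_rowN g W (k : 'I_n) (i : 'I_n.+1) :
  coords g W -> (i <= k)%N -> row k (vec_mx g) \notin steps W i.
Proof.
move=> gW ik; rewrite [steps W i]gW; apply/negP => /mem_span_rows[c c0 cE].
have := coords_unitmx gW => gu.
have : delta_mx 0 k = c.
  by apply: (can_inj (mulmxK gu)); rewrite -rowE.
by move=> /rowP/(_ k)/eqP; rewrite c0// mxE !eqxx oner_eq0.
Qed.

Lemma coords_of_rows M W : M \in unitmx ->
  (forall k : 'I_n, row k M \in steps W (inord k.+1)) ->
  @coords F (flag_variety F n) (mxvec M) W.
Proof.
move=> Mu MW i; rewrite mxvecK; apply/esym/eqP.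
have lein : (i <= n)%N by rewrite -ltnS.
rewrite -/(span_rows M i) eqEdim dim_span_rows// [X in (X <= _)%N](flag_dim W i) leqnn andbT.
apply: span_rows_sub => k ki; apply: subvP (flag_sub W _) _ (MW k).
by rewrite inordK// ltnS (leq_trans ki).
Qed.

Lemma flag_of_matrix M : M \in unitmx -> exists W, @coords F (flag_variety F n) (mxvec M) W.
Proof.
move=> Mu; pose f := [ffun i : 'I_n.+1 => span_rows M i].
have ff : is_full_flag f.
  apply/andP; split; apply/forallP => i; first by rewrite ffunE dim_span_rows// -ltnS.
  apply/forallP => j; apply/implyP => ij; rewrite !ffunE; apply: span_rows_sub => k ki.
  by apply: row_in_span_rows; exact: leq_trans ij.
by exists (exist (fun f => is_full_flag f) f ff) => i; rewrite /= ffunE mxvecK.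
Qed.

(** An adapted basis is obtained by picking, for each [k], a vector of the next member outside the
    current one; it exists since the dimension jumps. *)
Lemma coords_ex W : exists g, coords g W.
Proof.
have /choice[v vW] : forall k : 'I_n, exists v,
    v \in steps W (inord k.+1) /\ v \notin steps W (inord k).
  move=> k; apply: contrapT => nv.
  have /dimvS : (steps W (inord k.+1) <= steps W (inord k))%VS.
    apply/subvP => x xW; apply/negPn/negP => nx; apply: nv; by exists x.
  have kn : (k < n.+1)%N by rewrite ltnS; exact/ltnW/ltn_ord.
  by rewrite !flag_dim !inordK ?ltnn ?ltnS.
pose M := \matrix_k v k; have rowM k : row k M = v k by rewrite rowK.
have spanM i : (i <= n)%N -> span_rows M i = steps W (inord i).
  elim: i => [_|i IHi ltin].
    apply/esym/eqP; rewrite -[X in X == _](_ : 0%VS = _); last first.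
      by apply/esym/eqP; rewrite -dimv_eq0 flag_dim inordK.
    by rewrite eq_sym -subv0; apply: span_rows_sub.
  apply/eqP; rewrite eqEdim flag_dim inordK ?ltnS//; apply/andP; split.
    apply: span_rows_sub => k ki; rewrite rowM; apply: subvP (flag_sub W _) _ (vW k).1.
    by rewrite !inordK ?ltnS//.
  rewrite ltnNge; apply/negP => dle.
  have sub : (span_rows M i <= span_rows M i.+1)%VS.
    by apply: span_rows_sub => k ki; apply: row_in_span_rows; exact: ltnW.
  have : span_rows M i == span_rows M i.+1.
    by rewrite eqEdim sub (leq_trans dle)// IHi ?(ltnW ltin)// flag_dim inordK// ltnS ltnW.
  rewrite IHi ?(ltnW ltin)// => /eqP E; have := (vW (Ordinal ltin)).2.
  by rewrite /= E -rowM row_in_span_rows.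
exists (mxvec M); apply: coords_of_rows.
  apply: span_rowsT_unitmx; rewrite spanM//; apply/eqP.
  by rewrite eqEdim subvf dimvf /dim /= mul1n flag_dim inordK.
by move=> k; rewrite rowM; case: (vW k).
Qed.

Lemma orbital_flag_variety : orbital (flag_variety F n).
Proof.
split=> [x W W' xW xW'|W|x y W xW yW].
- by apply/flag_eq/ffunP => i; rewrite [LHS]xW [RHS]xW'.
- exact: coords_ex.
have xu := coords_unitmx xW; have yu := coords_unitmx yW.
(* Two bases adapted to the same flag differ by an invertible lower triangular [B]. Left
   multiplication by this constant matrix replaces each row by a combination of itself and earlier
   rows, so it preserves adaptedness to any flag. *)
pose B := vec_mx y *m invmx (vec_mx x).
have Bu : B \in unitmx by rewrite unitmx_mul yu unitmx_inv.
have Btrig (k l : 'I_n) : (k < l)%N -> B k l = 0.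
  move=> kl; have := coords_row (i := inord k.+1) yW;
    rewrite inordK ?ltnS// => /(_ k (leqnn _)).
  rewrite (coordsP xW)// => /mem_span_rows[c c0 cE].
  have -> : B k l = row k B 0 l by rewrite [RHS]mxE.
  by rewrite row_mul cE mulmxK// c0.
exists (fun z : 'rV[F]_(n * n) => mxvec (B *m vec_mx z)); split.
- move=> j; case/mxvec_indexP: j => k l.
  rewrite (_ : (fun z => _) = fun z : 'rV[F]_(n * n) => \sum_a B k a * z 0 (mxvec_index a l)).
    apply: polyfun_sum => a; apply: polyfunM; [exact: polyfun_cst|exact: polyfun_coord].
  by apply/funext => z; rewrite mxvecE mxE; apply: eq_bigr => a _; congr (_ * _); rewrite mxE.
- by rewrite mulmxKV// vec_mxK.
move=> z Q zQ; have zu := coords_unitmx zQ; apply: coords_of_rows.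
  by rewrite unitmx_mul Bu.
move=> k; rewrite row_mul mulmx_sum_row; apply: memv_suml => l _.
have [kl|kl] := ltnP k l; first by rewrite mxE Btrig// scale0r mem0v.
by apply/memvZ/coords_row => //; rewrite inordK ?ltnS.
Qed.

End FlagCoordinates.

(** * Orthogonal complements for the symplectic form *)

Section Perp.
Variable F : fieldType.
Implicit Types (U V : {vspace 'rV[F]_6}) (x y : 'rV[F]_6).
Local Notation "<| x , y |>" := (@pairing F x y) (at level 2, format "<| x ,  y |>").

Lemma pairingC x y : <|x, y|> = - <|y, x|>.
Proof. by rewrite pairing_skew expr1 mulN1r. Qed.

Lemma pairing_alt x : <|x, x|> = 0.
Proof. by rewrite /pairing big1 // => i _; rewrite mulrC subrr. Qed.

Lemma pairingDl x y z : <|x + y, z|> = <|x, z|> + <|y, z|>.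
Proof. exact: linearDl. Qed.

Lemma pairingDr x y z : <|z, x + y|> = <|z, x|> + <|z, y|>.
Proof. exact: linearDr. Qed.

Lemma pairingZl a x z : <|a *: x, z|> = a * <|x, z|>.
Proof. exact: linearZl_LR. Qed.

Lemma pairingZr a x z : <|z, a *: x|> = a * <|z, x|>.
Proof. exact: linearZr_LR. Qed.

Lemma pairingNl x z : <|- x, z|> = - <|x, z|>.
Proof. exact: linearNl. Qed.

Lemma pairingNr x z : <|z, - x|> = - <|z, x|>.
Proof. exact: linearNr. Qed.

Lemma pairing0l z : <|0, z|> = 0.
Proof. exact: linear0l. Qed.

Lemma pairing0r z : <|z, 0|> = 0.
Proof. exact: linear0r. Qed.

Lemma pairing_sumr n (f : 'I_n -> 'rV[F]_6) x :
  <|x, \sum_i f i|> = \sum_i <|x, f i|>.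
Proof. by apply: (big_morph (fun y => <|x, y|>)) => [y z|]; rewrite ?pairingDr ?pairing0r. Qed.

Definition pairingE := (pairingDl, pairingDr, pairingZl, pairingZr, pairingNl, pairingNr,
  pairing0l, pairing0r).

Lemma mem_perp U x : reflect (forall y, y \in U -> <|x, y|> = 0) (x \in perp U).
Proof. exact: mem_orthovP. Qed.

Lemma perp_fullv : perp fullv = 0%VS :> {vspace 'rV[F]_6}.
Proof.
apply/eqP; rewrite -subv0; apply/subvP => x /mem_perp xT; rewrite memv0.
apply/eqP/rowP => k; rewrite mxE -[k](@fintype.splitK 3 3); case: (fintype.split _) => i /=.
  have := xT (delta_mx 0 (rshift 3 i)) (memvf _); rewrite /pairing (bigD1 i)//= big1 => [|j ji].
    by rewrite !mxE !eqxx (_ : (lshift 3 i == rshift 3 i) = false) ?mulr1 ?mulr0 ?subr0 ?addr0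
      ?eq_lrshift.
  by rewrite !mxE eq_rshift eq_lrshift (negPf ji) !mulr0 subr0.
have := xT (delta_mx 0 (lshift 3 i)) (memvf _); rewrite /pairing (bigD1 i)//= big1 => [|j ji].
  by rewrite !mxE !eqxx eq_rlshift mulr0 mulr1 sub0r addr0 => /eqP; rewrite oppr_eq0 => /eqP.
by rewrite !mxE eq_lshift eq_rlshift (negPf ji) !mulr0 subr0.
Qed.

Lemma dim_perp_span V (s : seq 'rV[F]_6) :
  (\dim V <= \dim (V :&: perp <<s>>)%VS + size s)%N.
Proof.
elim: s V => [|u s IHs] V.
  by rewrite span_nil /perp orthov0 capvf addn0.
have := IHs (V :&: perp <[u]>)%VS; rewrite -capvA.
have -> : (perp <[u]> :&: perp <<s>> = perp <<u :: s>>)%VS.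
  rewrite span_cons; apply/vspaceP => x; rewrite memv_cap.
  apply/andP/mem_perp => [[/mem_perp xu /mem_perp xs] _ /memv_addP[a au [b bs ->]]|h].
    by rewrite pairingDr xu// xs// addr0.
  split; apply/mem_perp => y yU; apply: h; first exact: subvP (addvSl _ _) _ yU.
  exact: subvP (addvSr _ _) _ yU.
have := @leq_dim_orthov1 _ _ _ _ (@pairing F) u V; rewrite -/(perp _).
move=> ab bc; have := leq_trans ab bc; rewrite [size (_ :: _)]/= [(_ + (size s).+1)%N]addnS.
by case: (\dim V).
Qed.

(** At least: each vector of a basis of [U] imposes at most one linear condition. At most: the
    vectors of [perp U] that are also orthogonal to a complement of [U] are orthogonal to
    everything, hence zero. *)
Lemma dim_perp U : \dim (perp U) = (6 - \dim U)%N.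
Proof.
have dim6 : \dim {:'rV[F]_6} = 6 by rewrite dimvf.
apply/eqP; rewrite eqn_leq; apply/andP; split; last first.
  have := dim_perp_span fullv (vbasis U); rewrite capfv size_tuple dim6 (span_basis (vbasisP
    U)).
  by rewrite leq_subLR addnC.
have := dim_perp_span (perp U) (vbasis U^C); rewrite (span_basis (vbasisP _)) size_tuple.
rewrite dimv_compl dim6 (_ : (_ :&: _)%VS = 0%VS) ?dimv0//.
apply/eqP; rewrite -subv0 -perp_fullv; apply/subvP => x.
rewrite memv_cap => /andP[/mem_perp xU /mem_perp xC]; apply/mem_perp => y.
rewrite -(addv_complf U) => /memv_addP[a au [b bs ->]].
by rewrite pairingDr xU// xC// addr0.
Qed.

Lemma perpK U : perp (perp U) = U.
Proof.
have le6 V : (\dim V <= 6)%N by have := dimvS (subvf V); rewrite dimvf.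
apply/esym/eqP; rewrite eqEdim !dim_perp subKn ?leqnn ?andbT//.
by apply/subvP => x xU; apply/mem_perp => y /mem_perp yU; rewrite pairingC yU ?oppr0.
Qed.

Lemma polyfun_pairing n (f g : 'rV[F]_n -> 'rV[F]_6) :
  (forall j, polyfun (fun z => f z 0 j)) -> (forall j, polyfun (fun z => g z 0 j)) ->
  polyfun (fun z => <|f z, g z|>).
Proof.
move=> pf pg; apply: polyfun_sum => i.
by apply: polyfunD; [|apply: polyfunN]; apply: polyfunM.
Qed.

Lemma polyfun_row n k (i : 'I_n) (j : 'I_k) : polyfun (fun g : 'rV[F]_(n * k) => row i (vec_mx
  g) 0 j).
Proof.
rewrite (_ : (fun g => _) = fun g : 'rV[F]_(n * k) => g 0 (mxvec_index i j)).
  exact: polyfun_coord.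
by apply/funext => g; rewrite !mxE.
Qed.

End Perp.

(** * Symplectic flags and frames adapted to them *)

Section SymplecticFlags.
Variable F : fieldType.
Implicit Types (W : flag_variety F 6) (x y c r : 'rV[F]_6) (U : {vspace 'rV[F]_6}).
Local Notation "<| x , y |>" := (@pairing F x y) (at level 2, format "<| x ,  y |>").

Definition step W k : {vspace 'rV[F]_6} := steps W (inord k).

Definition symplectic W := forall i : 'I_7, steps W (rev_ord i) = perp (steps W i).

Lemma step_dim W k : (k <= 6)%N -> \dim (step W k) = k.
Proof. by move=> k6; rewrite flag_dim inordK. Qed.

Lemma step_sub W j k : (j <= k)%N -> (k <= 6)%N -> (step W j <= step W k)%VS.
Proof. by move=> jk k6; apply: flag_sub; rewrite !inordK// ltnS (leq_trans jk). Qed.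

Lemma symplectic_step W k : symplectic W -> (k <= 6)%N -> step W (6 - k) = perp (step W k).
Proof.
move=> Ws k6; rewrite -Ws; congr (steps W _); apply/val_inj.
by rewrite /= !inordK// ltnS leq_subr.
Qed.

Lemma coords_step g W k : coords g W -> (k <= 6)%N -> step W k = span_rows (vec_mx g) k.
Proof. by move=> gW k6; exact: (coordsP gW k6). Qed.

Lemma coords_row_step g W (k : 'I_6) j : coords g W -> (k < j)%N -> (j <= 6)%N ->
  row k (vec_mx g) \in step W j.
Proof. by move=> gW kj j6; rewrite (coords_step gW j6); exact: row_in_span_rows. Qed.

Lemma coords_row_stepN g W (k : 'I_6) : coords g W -> row k (vec_mx g) \notin step W k.
Proof. by move=> gW; apply: (coords_rowN gW); rewrite inordK// ltnS ltnW. Qed.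

(** Rows are numbered from 0, so row [i] lies in [W_(i+1)], while the complement of [W_(j+1)] is
    [W_(5-j)]. The condition says that the Gram matrix vanishes strictly above its antidiagonal; it
    is polynomial in the matrix. *)
Lemma symplecticP g W : coords g W ->
  symplectic W <-> forall i j : 'I_6, (i + j < 5)%N -> <|row i (vec_mx g), row j (vec_mx g)|> =
    0.
Proof.
move=> gW; split=> [Ws i j ij|gg i].
  have : row i (vec_mx g) \in step W (6 - j.+1).
    apply: (coords_row_step gW); last exact: leq_subr.
    by rewrite subSS ltn_subRL addnC.
  by rewrite symplectic_step// => /mem_perp; apply; apply: (coords_row_step gW).
apply/eqP; rewrite eqEdim dim_perp !flag_dim /= leqnn andbT.
rewrite [steps W (rev_ord i)]gW [steps W i]gW; apply: span_rows_sub => a ai;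
  apply/mem_perp => y.
move=> /mem_span_rows[c c0 ->]; rewrite mulmx_sum_row pairing_sumr.
rewrite big1// => b _; rewrite pairingE; have [bi|ib] := ltnP b i; last by rewrite c0// mul0r.
rewrite gg ?mulr0//; have := ltn_ord i; move: ai bi; rewrite /=; lia.
Qed.


Lemma closed_symplectic : closed [set W | symplectic W].
Proof.
pose K := [set b : 'rV[F]_(6 * 6) -> F | exists i j : 'I_6, (i + j < 5)%N /\
  b = fun g => <|row i (vec_mx g), row j (vec_mx g)|>].
rewrite (_ : [set W | _] =
  [set W : flag_variety F 6 | forall g b, coords g W -> K b -> b g = 0]).
  apply: closed_vanishing; first exact: orbital_flag_variety.
  by move=> _ [i [j [_ ->]]]; apply: polyfun_pairing => l; exact: polyfun_row.
apply/seteqP; split=> W /= h; last first.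
  have [g gW] := coords_ex W; apply/(symplecticP gW) => i j ij.
  by apply: (h g (fun g => <|row i (vec_mx g), row j (vec_mx g)|>) gW); exists i, j.
by move=> g _ gW [i [j [ij ->]]]; move/(symplecticP gW): h; apply.
Qed.

(** Since [U] is the complement of [perp U], the inclusion amounts to the vanishing of pairings of
    the first rows with fixed vectors, which are linear in the matrix. *)
Lemma closed_step_sub k U : (k <= 6)%N -> closed [set W | (step W k <= U)%VS].
Proof.
move=> k6; pose K := [set b : 'rV[F]_(6 * 6) -> F | exists (i : 'I_6) (y : 'rV[F]_6),
  [/\ (i < k)%N, y \in perp U & b = fun g => <|row i (vec_mx g), y|>]].
rewrite (_ : [set W | _] =
  [set W : flag_variety F 6 | forall g b, coords g W -> K b -> b g = 0]).
  apply: closed_vanishing; first exact: orbital_flag_variety.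
  move=> _ [i [y [_ _ ->]]]; apply: polyfun_pairing => l; first exact: polyfun_row.
  exact: polyfun_cst.
apply/seteqP; split=> W /= h.
  move=> g _ gW [i [y [ik /mem_perp yU ->]]]; rewrite pairingC yU ?oppr0//.
  by apply: (subvP h); apply: (coords_row_step gW).
have [g gW] := coords_ex W; rewrite (coords_step gW k6); apply: span_rows_sub => i ik.
rewrite -[U]perpK; apply/mem_perp => y yU.
by apply: (h g (fun g => <|row i (vec_mx g), y|>) gW); exists i, y.
Qed.

Lemma mem_span_cons c (s : seq 'rV[F]_6) x : x \in <<c :: s>>%VS ->
  exists a y, y \in <<s>>%VS /\ x = a *: c + y.
Proof.
by rewrite span_cons => /memv_addP[_ /vlineP[a ->] [y ys ->]]; exists a, y.
Qed.

Lemma mem_span1 c x : x \in <<[:: c]>>%VS -> exists a, x = a *: c.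
Proof. by rewrite span_seq1 => /vlineP. Qed.

Lemma mem_span2 c1 c2 x : x \in <<[:: c1; c2]>>%VS -> exists a b, x = a *: c1 + b *: c2.
Proof. by move=> /mem_span_cons[a [y [/mem_span1[b ->] ->]]]; exists a, b. Qed.

Lemma mem_span3 c1 c2 c3 x : x \in <<[:: c1; c2; c3]>>%VS ->
  exists a b d, x = a *: c1 + b *: c2 + d *: c3.
Proof.
by move=> /mem_span_cons[a [y [/mem_span2[b [d ->]] ->]]]; exists a, b, d; rewrite addrA.
Qed.

Lemma mem_span4 c1 c2 c3 c4 x : x \in <<[:: c1; c2; c3; c4]>>%VS ->
  exists a b d f, x = a *: c1 + b *: c2 + d *: c3 + f *: c4.
Proof.
move=> /mem_span_cons[a [y [/mem_span3[b [d [f ->]]] ->]]]; exists a, b, d, f.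
by rewrite !addrA.
Qed.

Lemma Phi_small c1 c2 c3 k : (k <= 3)%N -> Phi c1 c2 c3 (inord k) = <<take k [:: c1; c2;
  c3]>>%VS.
Proof. by move=> k3; rewrite ffunE inordK ?k3// ltnS (leq_trans k3). Qed.

Lemma step_Phi W c1 c2 c3 k : steps W = Phi c1 c2 c3 -> (k <= 3)%N ->
  step W k = <<take k [:: c1; c2; c3]>>%VS.
Proof. by move=> WE k3; rewrite /step WE Phi_small. Qed.

(** Inclusions suffice: [W_k] has dimension [k] and is contained in a span of [k] vectors, so
    equality holds. The upper half is then determined by taking complements. *)
Lemma PhiP W c1 c2 c3 : symplectic W -> (step W 1 <= <<[:: c1]>>)%VS ->
  (step W 2 <= <<[:: c1; c2]>>)%VS -> (step W 3 <= <<[:: c1; c2; c3]>>)%VS ->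
  steps W = Phi c1 c2 c3.
Proof.
move=> Ws W1 W2 W3.
have E k : (k <= 3)%N -> step W k = <<take k [:: c1; c2; c3]>>%VS.
  move=> k3; apply/eqP; rewrite eqEdim step_dim ?(leq_trans k3)//; apply/andP; split;
    last first.
    by rewrite (leq_trans (dim_span _))// size_take; case: ltnP.
  case: k k3 => [_|[//|[//|[//|//]]]]; rewrite (_ : step W 0 = 0%VS) ?sub0v//.
  by apply/eqP; rewrite -dimv_eq0 step_dim.
apply/ffunP => j; rewrite ffunE; case: ifPn => [j3|]; first by rewrite -E // /step inord_val.
rewrite -ltnNge => j3; rewrite -E; last by have := ltn_ord j; lia.
have := symplectic_step Ws (k := 6 - j); rewrite leq_subr => <- //.
by rewrite subKn ?/step ?inord_val// -ltnS.
Qed.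

Definition isotropic3 c1 c2 c3 := [/\ <|c1, c2|> = 0, <|c1, c3|> = 0 & <|c2, c3|> = 0].

(** In a flag of the form [Phi] the members above the middle are complements by construction.
    Isotropy is needed for [W_3], which is contained in its own complement and has the same
    dimension. *)
Lemma Phi_symplectic W c1 c2 c3 : steps W = Phi c1 c2 c3 -> isotropic3 c1 c2 c3 -> symplectic W.
Proof.
move=> WE [c12 c13 c23].
have WC k : (k < 3)%N -> step W (6 - k) = perp (step W k).
  move=> k3; rewrite (step_Phi WE (ltnW k3)) /step WE ffunE inordK; last by lia.
  by rewrite ifN; [congr (perp <<take _ _>>); lia|rewrite -ltnNge; lia].
have W3 : step W 3 = perp (step W 3).
  apply/eqP; rewrite eqEdim dim_perp !step_dim// andbT; rewrite (step_Phi WE)//=.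
  apply/subvP => x /mem_span3[a [b [d ->]]]; apply/mem_perp => y /mem_span3[a' [b' [d' ->]]].
  rewrite !pairingE !pairing_alt c12 c13 c23 (pairingC c2 c1) (pairingC c3 c1) (pairingC c3 c2).
  by rewrite c12 c13 c23 !(oppr0, mulr0, addr0).
move=> i; have iE : steps W i = step W i by rewrite /step inord_val.
have riE : steps W (rev_ord i) = step W (6 - i).
  by congr (steps W _); apply/val_inj; rewrite /= inordK// ltnS leq_subr.
rewrite iE riE; have [i3|i3|->//] := ltngtP i 3; first exact: WC.
have i6 : (i <= 6)%N by rewrite -ltnS.
by rewrite -[step W (6 - i)]perpK -WC ?subKn//; lia.
Qed.

Lemma symplectic_isotropic3 W c1 c2 c3 : symplectic W -> c1 \in step W 3 -> c2 \in step W 3 ->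
  c3 \in step W 3 -> isotropic3 c1 c2 c3.
Proof.
move=> Ws W1 W2 W3; have W3E : step W 3 = perp (step W 3) := symplectic_step Ws (k := 3) isT.
have iso x y : x \in step W 3 -> y \in step W 3 -> <|x, y|> = 0.
  by rewrite {1}W3E => /mem_perp; apply.
by split; exact: iso.
Qed.

Lemma row_Phi g W c1 c2 c3 : coords g W -> steps W = Phi c1 c2 c3 ->
  exists a b b' d d' d'', [/\ row 0 (vec_mx g) = a *: c1, a != 0,
    row 1 (vec_mx g) = b *: c1 + b' *: c2, b' != 0 &
    row 2 (vec_mx g) = d *: c1 + d' *: c2 + d'' *: c3 /\ d'' != 0].
Proof.
move=> gW WE.
have [a aE] : exists a, row 0 (vec_mx g) = a *: c1.
  by apply: mem_span1; rewrite -(step_Phi (k := 1) WE)//; exact: (coords_row_step gW).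
have [b [b' bE]] : exists b b', row 1 (vec_mx g) = b *: c1 + b' *: c2.
  by apply: mem_span2; rewrite -(step_Phi (k := 2) WE)//; exact: (coords_row_step gW).
have [d [d' [d'' dE]]] : exists d d' d'', row 2 (vec_mx g) = d *: c1 + d' *: c2 + d'' *: c3.
  by apply: mem_span3; rewrite -(step_Phi (k := 3) WE)//; exact: (coords_row_step gW).
exists a, b, b', d, d', d''; split=> //; last split=> //.
- have := coords_row_stepN 0 gW; apply: contraNneq => a0.
  by rewrite aE a0 scale0r mem0v.
- have := coords_row_stepN 1 gW; apply: contraNneq => b0.
  by rewrite bE b0 scale0r addr0 (step_Phi (k := 1) WE)// span_seq1 memvZ ?memv_line.
- have := coords_row_stepN 2 gW; apply: contraNneq => d0.
  rewrite dE d0 scale0r addr0 (step_Phi (k := 2) WE)//.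
  by rewrite memvD// memvZ// memv_span// !inE eqxx ?orbT.
Qed.

(* The Gram matrix of the rows is antitriangular, so that they form a basis
   adapted to a symplectic flag. *)
Definition adapted r0 r1 r2 r3 r4 r5 :=
  [/\ [/\ <|r0, r1|> = 0, <|r0, r2|> = 0, <|r0, r3|> = 0 & <|r0, r4|> = 0],
      <|r1, r2|> = 0, <|r1, r3|> = 0 &
      [/\ <|r0, r5|> != 0, <|r1, r4|> != 0 & <|r2, r3|> != 0]].

Definition frame (s : seq 'rV[F]_6) : 'M[F]_6 := \matrix_(i < 6) s`_i.

Lemma row_frame s i : row i (frame s) = s`_i.
Proof. exact: rowK. Qed.

Section Adapted.
Variables r0 r1 r2 r3 r4 r5 : 'rV[F]_6.
Hypothesis ad : adapted r0 r1 r2 r3 r4 r5.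
Let M := frame [:: r0; r1; r2; r3; r4; r5].

(** Pairing a linear relation between the rows with [r0], ..., [r5] in turn is a back substitution
    along the antidiagonal: it kills the coefficients [c5], ..., [c0] in this order. *)
Lemma frame_unitmx : M \in unitmx.
Proof.
have [[r01 r02 r03 r04] r12 r13 [r05 r14 r23]] := ad.
rewrite -row_free_unit; apply: inj_row_free => c; rewrite mulmx_sum_row => cM.
have pc k : \sum_i c 0 i * <|k, [:: r0; r1; r2; r3; r4; r5]`_i|> = 0.
  have : <|k, \sum_i c 0 i *: row i M|> = 0 by rewrite cM pairing0r.
  by rewrite pairing_sumr => h; rewrite -[RHS]h; apply: eq_bigr => i _;
    rewrite row_frame pairingE.
have simp := (pairing_alt, r01, r02, r03, r04, r12, r13, pairingC r1 r0, pairingC r2 r0,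
  pairingC r3 r0, pairingC r4 r0, pairingC r2 r1, pairingC r3 r1, oppr0, mulr0, add0r, addr0).
have z (a b : F) : b != 0 -> a * b = 0 -> a = 0 by move=> b0 /eqP;
  rewrite mulf_eq0 (negPf b0) orbF => /eqP.
have := pc r0; rewrite !big_ord_recl big_ord0 /= !simp => /(z _ _ r05) c5.
have := pc r1; rewrite !big_ord_recl big_ord0 /= c5 !mul0r !simp => /(z _ _ r14) c4.
have := pc r2; rewrite !big_ord_recl big_ord0 /= c5 c4 !mul0r !simp => /(z _ _ r23) c3.
have := pc r3; rewrite !big_ord_recl big_ord0 /= c5 c4 c3 !mul0r !simp.
rewrite (pairingC r3 r2) mulrN => /eqP; rewrite oppr_eq0 => /eqP/(z _ _ r23) c2.
have := pc r4; rewrite !big_ord_recl big_ord0 /= c5 c4 c3 c2 !mul0r !simp.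
rewrite (pairingC r4 r1) mulrN => /eqP; rewrite oppr_eq0 => /eqP/(z _ _ r14) c1.
have := pc r5; rewrite !big_ord_recl big_ord0 /= c5 c4 c3 c2 c1 !mul0r !simp.
rewrite (pairingC r5 r0) mulrN => /eqP; rewrite oppr_eq0 => /eqP/(z _ _ r05) c0.
apply/rowP => k; rewrite mxE; case: k => -[|[|[|[|[|[|//]]]]]] k6.
- by rewrite -[RHS]c0; congr (c 0 _); exact/val_inj.
- by rewrite -[RHS]c1; congr (c 0 _); exact/val_inj.
- by rewrite -[RHS]c2; congr (c 0 _); exact/val_inj.
- by rewrite -[RHS]c3; congr (c 0 _); exact/val_inj.
- by rewrite -[RHS]c4; congr (c 0 _); exact/val_inj.
- by rewrite -[RHS]c5; congr (c 0 _); exact/val_inj.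
Qed.

Lemma frame_flag : exists W, @coords F (flag_variety F 6) (mxvec M) W /\ steps W = Phi r0 r1 r2.
Proof.
have [[r01 r02 r03 r04] r12 r13 [r05 r14 r23]] := ad.
have Mu := frame_unitmx; have [W MW] := flag_of_matrix Mu; exists W; split=> //.
have Ws : symplectic W.
  apply/(symplecticP MW) => i j; rewrite mxvecK !row_frame.
  wlog ij : i j / (i <= j)%N.
    by move=> h; case/orP: (leq_total i j) => ?; [exact: h|rewrite addnC pairingC => /h->];
      rewrite ?oppr0.
  case: i j ij => [[|[|[|[|[|[|//]]]]]] ?] [[|[|[|[|[|[|//]]]]]] ?] //= _ _; exact: pairing_alt.
by apply: PhiP => //; rewrite (coords_step MW)// mxvecK; apply: span_rows_sub;
  move=> [[|[|[|[|[|[|//]]]]]] ?] //= _; rewrite row_frame; apply: memv_span;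
    rewrite !inE eqxx ?orbT.
Qed.

(** The way a formula with values in the flag variety is checked: the first three members determine
    a symplectic flag, so three inclusions identify [W] with the flag of the frame. *)
Lemma frame_coords W : symplectic W -> (step W 1 <= <<[:: r0]>>)%VS ->
  (step W 2 <= <<[:: r0; r1]>>)%VS -> (step W 3 <= <<[:: r0; r1; r2]>>)%VS ->
  @coords F (flag_variety F 6) (mxvec M) W.
Proof.
move=> Ws W1 W2 W3; have [W' [W'c W'E]] := frame_flag.
by rewrite (_ : W = W')//; apply: flag_eq; rewrite W'E; exact: PhiP.
Qed.

(** Both sides are the fourth member of the flag defined by the frame, once as the complement of
    [W_2] and once as a span of rows. *)
Lemma perp_frame : perp <<[:: r0; r1]>> = <<[:: r0; r1; r2; r3]>>%VS.
Proof.
have [W [Wc WE]] := frame_flag; have [[r01 r02 r03 r04] r12 r13 _] := ad.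
have Ws : symplectic W by apply: Phi_symplectic WE _; split.
have := symplectic_step Ws (k := 2) isT; rewrite (step_Phi (k := 2) WE)// => <-.
rewrite (coords_step Wc)// mxvecK; apply/eqP; rewrite eqEsubv; apply/andP; split.
  apply: span_rows_sub; move=> [[|[|[|[|[|[|//]]]]]] ?] //= _;
    by rewrite row_frame; apply: memv_span; rewrite !inE eqxx ?orbT.
have rM k : (k < 4)%N -> [:: r0; r1; r2; r3; r4; r5]`_k \in span_rows M 4.
  move=> k4; have k6 : (k < 6)%N by rewrite (leq_trans k4).
  by rewrite -[k]/(val (Ordinal k6)) -row_frame; exact: row_in_span_rows.
by apply/span_subvP => x; rewrite !inE => /or4P[]/eqP->; [exact: (rM 0)|exact: (rM 1)|
  exact: (rM 2)|exact: (rM 3)].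
Qed.

End Adapted.

Lemma polyfun_frame n (s : 'rV[F]_n -> seq 'rV[F]_6) :
  (forall k l, (k < 6)%N -> polyfun (fun z => (s z)`_k 0 l)) ->
  forall j, polyfun (fun z => mxvec (frame (s z)) 0 j).
Proof.
move=> ps j; case/mxvec_indexP: j => k l.
rewrite (_ : (fun z => _) = fun z => (s z)`_k 0 l); first exact: ps.
by apply/funext => z; rewrite mxvecE mxE.
Qed.

Definition polyvec n k (f : 'rV[F]_n -> 'rV[F]_k) := forall l, polyfun (fun z => f z 0 l).

Lemma polyvec_cst n k (v : 'rV[F]_k) : @polyvec n k (fun=> v).
Proof. by move=> l; exact: polyfun_cst. Qed.

Lemma polyvecD n k (f g : 'rV[F]_n -> 'rV[F]_k) :
  polyvec f -> polyvec g -> polyvec (fun z => f z + g z).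
Proof. by move=> pf pg l; under eq_fun do rewrite mxE; exact: polyfunD. Qed.

Lemma polyvecZ n k (a : 'rV[F]_n -> F) (f : 'rV[F]_n -> 'rV[F]_k) :
  polyfun a -> polyvec f -> polyvec (fun z => a z *: f z).
Proof. by move=> pa pf l; under eq_fun do rewrite mxE; exact: polyfunM. Qed.

Lemma pairing_e i j : (0 < i <= 6)%N -> (0 < j <= 6)%N ->
  <|e F i, e F j|> = (i + 3 == j)%:R - (j + 3 == i)%:R.
Proof.
move=> i6 j6; rewrite /pairing !big_ord_recl big_ord0 !mxE /= -!val_eqE /= !inordK; [|lia|lia].
move: i6 j6; case: i => [//|[|[|[|[|[|[|//]]]]]]] _; case: j => [//|[|[|[|[|[|[|//]]]]]]] _;
  by rewrite /= ?(mulr0, mul0r, mulr1, oppr0, addr0, add0r, subr0, sub0r).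
Qed.

End SymplecticFlags.

(** * The families of flags *)

Local Ltac in_span := apply: memv_span; rewrite !inE eqxx ?orbT //.

Section Families.
Variable F : closedFieldType.
Notation e := (@e F).
Notation P1 := (projective_space F 1).
Notation P2 := (projective_space F 2).
Implicit Types (W : flag_variety F 6) (U : {vspace 'rV[F]_6}).
Local Notation "<| x , y |>" := (@pairing F x y) (at level 2, format "<| x ,  y |>").

Lemma row_of2_neq0 (a b : F) : (row_of 2 [:: a; b] != 0) = ((a, b) != (0, 0)).
Proof.
congr (~~ _); apply/eqP/eqP => [/rowP ab|[-> ->]].
  by have := ab 0; have := ab 1; rewrite !mxE /= => -> ->.
by apply/rowP => k; rewrite !mxE; have [->|->] := ord2P k.
Qed.

Lemma rV2E (x : 'rV[F]_2) : x = row_of 2 [:: x 0 0; x 0 1].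
Proof. by apply/rowP => k; rewrite !mxE; have [->|->] := ord2P k. Qed.

(** If the determinant vanished, [c y - d x] and [a y - b x] would lie in [U1]. Unless [a] and [c]
    are both zero this puts [y] into [U2], and if they are zero it is [x] that falls into [U1]. *)
Lemma flag_gl2 U1 U2 (v w s s' x y : 'rV[F]_6) a b c d :
  x = s + (a *: v + c *: w) -> y = s' + (b *: v + d *: w) ->
  s \in U1 -> s' \in U1 -> (U1 <= U2)%VS -> x \in U2 -> x \notin U1 -> y \notin U2 ->
  gl2 a b c d.
Proof.
move=> xE yE sU s'U /subvP U12 xU xU1 yU2; apply/negP => /eqP det0.
have yN t r : t != 0 -> t *: y - r *: x \notin U1.
  move=> t0; apply: contra yU2 => /U12 h.
  have := memvD h (memvZ r xU); rewrite subrK => /(memvZ t^-1).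
  by rewrite scalerA mulVf// scale1r.
have sN t r : t *: s' - r *: s \in U1 by rewrite memvB ?memvZ.
have c0 : c = 0.
  apply/eqP/negPn/negP => c0; have /negP := yN c d c0; apply.
  have -> : c *: y - d *: x = (c *: s' - d *: s) - (a * d - b * c) *: v.
    by rewrite xE yE; apply/rowP => k; rewrite !mxE; ring.
  by rewrite det0 scale0r subr0.
have a0 : a = 0.
  apply/eqP/negPn/negP => a0; have /negP := yN a b a0; apply.
  have -> : a *: y - b *: x = (a *: s' - b *: s) + (a * d - b * c) *: w.
    by rewrite xE yE; apply/rowP => k; rewrite !mxE; ring.
  by rewrite det0 scale0r addr0.
by move: xU1; rewrite xE a0 c0 !scale0r !addr0 sU.
Qed.

Lemma flag_line U (v w s x : 'rV[F]_6) a b :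
  x = s + (a *: v + b *: w) -> s \in U -> x \notin U -> (a, b) != (0, 0).
Proof. by move=> -> sU; apply: contra => /eqP[-> ->]; rewrite !scale0r !addr0. Qed.

(** * Flags with [W_1] and [W_2] fixed: a pencil of choices for [W_3] *)

Section Line.
Variables u1 u2 v w u2' u1' : 'rV[F]_6.
Hypothesis ad : adapted u1 u2 v w u2' u1'.
Notation fam := (fam_line u1 u2 v w).

Lemma fam_line_isotropic a b : isotropic3 u1 u2 (a *: v + b *: w).
Proof.
have [[u12 u1v u1w _] u2v u2w _] := ad.
by split; rewrite // !pairingE ?u1v ?u1w ?u2v ?u2w !mulr0 addr0.
Qed.

(** The fourth row must pair nontrivially with [x_0 v + x_1 w]: the vector [w] does so when [x_0] is
    nonzero and [v] when [x_1] is nonzero. Hence two charts, indexed by [i]. *)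
Lemma adapted_line (x : 'rV[F]_2) i : x 0 i != 0 ->
  adapted u1 u2 (x 0 0 *: v + x 0 1 *: w) (if i == 0 then w else v) u2' u1'.
Proof.
have [[u12 u1v u1w u1u2'] u2v u2w [u1u1' u2u2' vw]] := ad.
have [_ u1z u2z] := fam_line_isotropic (x 0 0) (x 0 1).
have [->|->] /= := ord2P i => xi; split=> //; split=> //.
  by rewrite !pairingE pairing_alt mulr0 addr0 mulf_neq0.
by rewrite !pairingE pairing_alt mulr0 add0r (pairingC w) mulrN oppr_eq0 mulf_neq0.
Qed.

(** The third adapted row lies in the complement of [W_2], which the frame exhibits as the span of
    [u1], [u2], [v], [w]; modulo [W_2] only its coefficients on [v] and [w] matter. *)
Lemma fam_lineP W : fam W <->
  [/\ symplectic W, (step W 1 <= <<[:: u1]>>)%VS & (step W 2 <= <<[:: u1; u2]>>)%VS].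
Proof.
split=> [[a [b [ab WE]]]|[Ws W1 W2]].
  rewrite (step_Phi (k := 1) WE)// (step_Phi (k := 2) WE)//; split=> //.
  exact: Phi_symplectic WE (fam_line_isotropic a b).
have [g gW] := coords_ex W.
have W2E : step W 2 = <<[:: u1; u2]>>%VS.
  by apply/eqP; rewrite eqEdim W2 step_dim//= (leq_trans (dim_span _)).
have : row 2 (vec_mx g) \in perp <<[:: u1; u2]>>.
  rewrite -W2E -(symplectic_step Ws)//; exact: (coords_row_step gW).
rewrite (perp_frame ad) => /mem_span4[a [b [c [d rE]]]].
have sW2 : a *: u1 + b *: u2 \in step W 2.
  by rewrite W2E memvD// memvZ//; [in_span|in_span].
exists c, d; split.
  by apply: flag_line (coords_row_stepN 2 gW); [rewrite rE -addrA|].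
apply: PhiP => //; rewrite (coords_step gW)//; apply: span_rows_sub => k.
have W3 x : x \in step W 2 -> x \in <<[:: u1; u2; (c *: v + d *: w)%R]>>%VS.
  move=> /(subvP W2)/mem_span2[a' [b' ->]].
  by rewrite memvD// memvZ//; [in_span|in_span].
rewrite ltnS leq_eqVlt => /predU1P[k2|k2]; last by apply: W3; exact: (coords_row_step gW).
rewrite (_ : k = 2); last exact/val_inj.
by rewrite rE -addrA memvD//; [exact: W3|in_span].
Qed.

Lemma fam_line_ex a b : (a, b) != (0, 0) ->
  exists W, steps W = Phi u1 u2 (a *: v + b *: w).
Proof.
rewrite -row_of2_neq0 => /rV_neq0[i /adapted_line]; rewrite !mxE /= => /frame_flag[W [_ WE]].
by exists W.
Qed.

Lemma fam_line_iso : isomorphic fam [set: P1].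
Proof.
pose R W (P : P1) := exists x : 'rV[F]_2, @coords F P1 x P /\
  steps W = Phi u1 u2 (x 0 0 *: v + x 0 1 *: w).
have [_ Pex _] := orbital_projective_space F 1.
have RA W P : R W P -> fam W.
  move=> [x [xP WE]]; exists (x 0 0), (x 0 1); split=> //.
  by rewrite -row_of2_neq0 -rV2E; exact: coords_proj_neq0 xP.
have BA (P : P1) : setT P -> exists2 W, fam W & R W P.
  move=> _; have [x xP] := Pex P.
  have := coords_proj_neq0 xP; rewrite {1}[x]rV2E row_of2_neq0 => /fam_line_ex[W WE].
  have RWP : R W P by exists x.
  by exists W; [exact: RA RWP|].
have [[u12 u1v u1w _] u2v u2w [_ _ vw]] := ad.
suff [phi [psi [iso _]]] : exists phi psi, inverse_isos fam [set: P1] phi psi /\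
  forall W, fam W -> R W (phi W) by exists phi, psi.
apply: iso_of_graph.
- exact: orbital_flag_variety.
- exact: orbital_projective_space.
- have [|P _] := @coords_proj_ex F 1 (delta_mx 0 0).
    by apply: (@coord_neq0 _ _ _ 0); rewrite mxE !eqxx oner_eq0.
  by have [W famW _] := BA P I; exists W.
- move=> W [a [b [ab WE]]]; have [|P xP] := @coords_proj_ex F 1 (row_of 2 [:: a; b]).
    by rewrite row_of2_neq0.
  by exists P => //; exists (row_of 2 [:: a; b]); rewrite !mxE.
- exact: BA.
(* Pairing the third row with [w] and with [- v] gives its coefficients on [v] and [w] up to the
   common factor [<|v, w|>], since [u1] and [u2] are orthogonal to both. *)
- move=> W g _ _; exists (fun=> 1), (fun g : 'rV[F]_(6 * 6) =>
    row_of 2 [:: <|row 2 (vec_mx g), w|>; - <|row 2 (vec_mx g), v|>]); split.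
  + exact: polyfun_cst.
  + exact: oner_neq0.
  + apply: ratfun_row_of => -[|[|//]] _ /=; apply: polyfun_ratfun; [|apply: polyfunN];
    by apply: polyfun_pairing => l; [exact: polyfun_row|exact: polyfun_cst].
  + move=> W' P {}g _ _ [x [xP WE]] gW _.
    have [_ [_ [_ [d [d' [d'' [_ _ _ _ [rE d0]]]]]]]] := row_Phi gW WE.
    rewrite rE (_ : row_of _ _ = (d'' * <|v, w|>) *: x).
      by apply: (coords_projZ _ xP); rewrite mulf_neq0.
    rewrite [x in RHS]rV2E !pairingE (pairingC w v) !pairing_alt u1v u1w u2v u2w.
    by apply/rowP => k; rewrite !mxE; have [->|->] := ord2P k; rewrite /=; ring.
- move=> P x _ xP; have [i xi] := rV_neq0 (coords_proj_neq0 xP).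
  exists (fun y : 'rV[F]_2 => y 0 i), (fun y : 'rV[F]_2 => mxvec (frame
    [:: u1; u2; y 0 0 *: v + y 0 1 *: w; if i == 0 then w else v; u2'; u1'])); split=> //.
  + exact: polyfun_coord.
  + move=> j; apply: polyfun_ratfun; apply: polyfun_frame => -[|[|[|[|[|[|//]]]]]] l _ /=;
      do ?exact: polyvec_cst.
    by apply: polyvecD; apply: polyvecZ; do ?[exact: polyfun_coord|exact: polyvec_cst].
  + move=> P' W y _ /fam_lineP[Ws W1 W2] [x' [x'P WE]] yP yi.
    apply: (frame_coords (adapted_line yi)) => //.
    have [c c0 yE] := coords_proj_eq x'P yP.
    rewrite (step_Phi (k := 3) WE)//=; apply/span_subvP => t; rewrite !inE => /or3P[]/eqP->.
    * in_span.
    * in_span.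
    * rewrite (_ : _ + _ = c^-1 *: (y 0 0 *: v + y 0 1 *: w)).
        by apply: memvZ; in_span.
      by rewrite yE !mxE scalerDr !scalerA !mulrA mulVf// !mul1r.
Qed.

Lemma closed_fam_line : closed fam.
Proof.
rewrite (_ : fam = [set W | symplectic W] `&` [set W | (step W 1 <= <<[:: u1]>>)%VS] `&`
  [set W | (step W 2 <= <<[:: u1; u2]>>)%VS]).
  by apply: closedI; [apply: closedI; [exact: closed_symplectic|]|]; exact: closed_step_sub.
by apply/seteqP; split=> W; [move=> /fam_lineP[]|move=> [[? ?] ?]; apply/fam_lineP].
Qed.

Lemma irreducible_fam_line : irreducible fam.
Proof.
have [phi [psi iso]] := fam_line_iso.
exact: inverse_isos_irreducible iso (irreducible_projective_space F 1).
Qed.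

End Line.

(** * Flags with [W_1] and [W_3] fixed: a pencil of choices for [W_2] *)

Section GL2.
Variables u v w u' v' w' : 'rV[F]_6.

(** The vectors [v'] and [w'] are dual to [v] and [w] and orthogonal to [u]: they read off the
    position of [W_2] inside [W_3] and also supply the lower rows of the moving frames. *)
Definition lagrangian_frame := [/\ isotropic3 u v w,
  [/\ <|u, v'|> = 0, <|u, w'|> = 0, <|v, w'|> = 0 & <|w, v'|> = 0],
  <|v, v'|> = 1, <|w, w'|> = 1 & <|u, u'|> != 0].

Hypothesis lf : lagrangian_frame.
Notation fam := (fam_gl2 u v w).

(** The fourth row [- x_1 v' + x_0 w'] is the combination of the dual vectors orthogonal to the
    moving second row [x_0 v + x_1 w]; the nonzero coordinate [i] decides which vectors complete the
    third and fifth rows. *)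
Lemma adapted_gl2 (x : 'rV[F]_2) i : x 0 i != 0 ->
  adapted u (x 0 0 *: v + x 0 1 *: w) (if i == 0 then w else v)
    (- x 0 1 *: v' + x 0 0 *: w') (if i == 0 then v' else w') u'.
Proof.
have [[uv uw vw] [uv' uw' vw' wv'] vv' ww' uu'] := lf.
have [->|->] /= := ord2P i => xi; rewrite /adapted !pairingE !pairing_alt ?(pairingC w v);
  rewrite ?(uv, uw, vw, uv', uw', vw', wv', vv', ww') !(oppr0, mulr0, addr0, add0r, mulr1)
    ?oppr_eq0.
  by split=> //; ring.
by split=> //; ring.
Qed.

Lemma fam_gl2P W : fam W <->
  [/\ symplectic W, (step W 1 <= <<[:: u]>>)%VS & (step W 3 <= <<[:: u; v; w]>>)%VS].
Proof.
have [[uv uw vw] _ _ _ _] := lf.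
split=> [[a [b [c [d [abcd WE]]]]]|[Ws W1 W3]].
  rewrite (step_Phi (k := 1) WE)// (step_Phi (k := 3) WE)//; split=> //.
    apply: Phi_symplectic WE _; split; rewrite !pairingE ?pairing_alt ?(pairingC w v) ?uv ?uw
      ?vw;
    by rewrite !(oppr0, mulr0, addr0).
  apply/span_subvP => x; rewrite !inE => /or3P[]/eqP->; first by in_span.
    by rewrite memvD// memvZ//; in_span.
  by rewrite memvD// memvZ//; in_span.
have [g gW] := coords_ex W.
have W1E : step W 1 = <<[:: u]>>%VS.
  by apply/eqP; rewrite eqEdim W1 step_dim//= (leq_trans (dim_span _)).
have rE (k : 'I_6) : (k < 3)%N -> exists a b c, row k (vec_mx g) = a *: u + (b *: v + c *: w).
  move=> k3; have /(subvP W3)/mem_span3[a [b [c ->]]] := coords_row_step gW k3 isT.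
  by exists a, b, c; rewrite addrA.
have [k [a [c r1]]] := rE 1 isT; have [l [b [d r2]]] := rE 2 isT.
have ku : k *: u \in step W 1 by rewrite W1E memvZ//; in_span.
have lu : l *: u \in step W 1 by rewrite W1E memvZ//; in_span.
exists a, b, c, d; split.
  apply: (flag_gl2 r1 r2 ku lu (step_sub W (j := 1) (k := 2) isT isT)).
  - exact: (coords_row_step gW).
  - exact: (coords_row_stepN 1 gW).
  - exact: (coords_row_stepN 2 gW).
have r0 : row 0 (vec_mx g) \in <<[:: u]>>%VS by apply: (subvP W1); exact: (coords_row_step gW).
have [t {}r0] := mem_span1 r0.
apply: PhiP => //; rewrite (coords_step gW)//; apply: span_rows_sub;
  move=> [[|[|[|//]]] h] //= _.
- by rewrite (_ : Ordinal h = 0) ?r0; [rewrite memvZ//; in_span|exact/val_inj].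
- by rewrite (_ : Ordinal h = 1) ?r1; [rewrite memvD ?memvZ//; in_span|exact/val_inj].
- by rewrite (_ : Ordinal h = 0) ?r0; [rewrite memvZ//; in_span|exact/val_inj].
- by rewrite (_ : Ordinal h = 1) ?r1; [rewrite memvD ?memvZ//; in_span|exact/val_inj].
- by rewrite (_ : Ordinal h = 2) ?r2; [rewrite memvD ?memvZ//; in_span|exact/val_inj].
Qed.

Lemma fam_gl2_ex (x : 'rV[F]_2) : x != 0 ->
  exists W, fam W /\ step W 2 = <<[:: u; (x 0 0 *: v + x 0 1 *: w)%R]>>%VS.
Proof.
move=> /rV_neq0[i xi]; have [W [_ WE]] := frame_flag (adapted_gl2 xi).
exists W; split; last exact: (step_Phi (k := 2) WE).
move: WE xi; have [->|->] /= := ord2P i => WE xi.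
  exists (x 0 0), 0, (x 0 1), 1; split; last by rewrite scale0r scale1r add0r.
  by rewrite /gl2 mulr1 mul0r subr0.
exists (x 0 0), 1, (x 0 1), 0; split; last by rewrite scale0r scale1r addr0.
by rewrite /gl2 mulr0 mul1r sub0r oppr_eq0.
Qed.

Lemma fam_gl2_iso : isomorphic fam [set: P1].
Proof.
have [[uv uw vw] [uv' uw' vw' wv'] vv' ww' uu'] := lf.
pose R W (P : P1) := exists x : 'rV[F]_2, @coords F P1 x P /\
  (step W 2 <= <<[:: u; (x 0 0 *: v + x 0 1 *: w)%R]>>)%VS.
have [_ Pex _] := orbital_projective_space F 1.
have BA (P : P1) : setT P -> exists2 W, fam W & R W P.
  move=> _; have [x xP] := Pex P.
  have [W [famW W2]] := fam_gl2_ex (coords_proj_neq0 xP).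
  by exists W => //; exists x; rewrite W2.
suff [phi [psi [iso _]]] : exists phi psi, inverse_isos fam [set: P1] phi psi /\
  forall W, fam W -> R W (phi W) by exists phi, psi.
apply: iso_of_graph.
- exact: orbital_flag_variety.
- exact: orbital_projective_space.
- have [|P _] := @coords_proj_ex F 1 (delta_mx 0 0).
    by apply: (@coord_neq0 _ _ _ 0); rewrite mxE !eqxx oner_eq0.
  by have [W famW _] := BA P I; exists W.
- move=> W [a [b [c [d [abcd WE]]]]]; have [|P xP] := @coords_proj_ex F 1 (row_of 2 [:: a; c]).
    rewrite row_of2_neq0; apply: contra abcd => /eqP[-> ->].
    by rewrite !(mul0r, mulr0) subrr.
  exists P => //; exists (row_of 2 [:: a; c]); split=> //.
  by rewrite !mxE /= (step_Phi (k := 2) WE).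
- exact: BA.
- move=> W g _ _; exists (fun=> 1), (fun g : 'rV[F]_(6 * 6) =>
    row_of 2 [:: <|row 1 (vec_mx g), v'|>; <|row 1 (vec_mx g), w'|>]); split.
  + exact: polyfun_cst.
  + exact: oner_neq0.
  + apply: ratfun_row_of => -[|[|//]] _ /=; apply: polyfun_ratfun;
    by apply: polyfun_pairing => l; [exact: polyfun_row|exact: polyfun_cst].
  + move=> W' P {}g /fam_gl2P[Ws W1 _] _ [x [xP W2]] gW _.
    have /(subvP W2)/mem_span2[k [c rE]] := coords_row_step gW (k := 1) (j := 2) isT isT.
    rewrite rE (_ : row_of _ _ = c *: x).
      apply: (coords_projZ _ xP); apply: contraNneq (coords_row_stepN 1 gW) => c0.
      rewrite (_ : step W' _ = <<[:: u]>>%VS).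
        by rewrite rE c0 scale0r addr0 memvZ//; in_span.
      by apply/eqP; rewrite eqEdim W1 step_dim//= (leq_trans (dim_span _)).
    rewrite [x in RHS]rV2E !pairingE uv' uw' vw' wv' vv' ww'.
    by apply/rowP => j; rewrite !mxE; have [->|->] := ord2P j; rewrite /=; ring.
- move=> P x _ xP; have [i xi] := rV_neq0 (coords_proj_neq0 xP).
  exists (fun y : 'rV[F]_2 => y 0 i), (fun y : 'rV[F]_2 => mxvec (frame
    [:: u; y 0 0 *: v + y 0 1 *: w; if i == 0 then w else v;
        - y 0 1 *: v' + y 0 0 *: w'; if i == 0 then v' else w'; u'])); split=> //.
  + exact: polyfun_coord.
  + move=> j; apply: polyfun_ratfun; apply: polyfun_frame => -[|[|[|[|[|[|//]]]]]] l _ /=;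
      do ?exact: polyvec_cst.
      by apply: polyvecD; apply: polyvecZ; do ?[exact: polyfun_coord|exact: polyvec_cst].
    apply: polyvecD; apply: polyvecZ; do ?[exact: polyfun_coord|exact: polyvec_cst].
    by apply: polyfunN; exact: polyfun_coord.
  + move=> P' W y _ /fam_gl2P[Ws W1 W3] [x' [x'P W2]] yP yi.
    have [c c0 yE] := coords_proj_eq x'P yP.
    apply: (frame_coords (adapted_gl2 yi)) => //.
      apply: (subv_trans W2); apply/span_subvP => t; rewrite !inE => /orP[]/eqP->.
        by in_span.
      rewrite (_ : _ + _ = c^-1 *: (y 0 0 *: v + y 0 1 *: w)).
        by apply: memvZ; in_span.
      by rewrite yE !mxE scalerDr !scalerA !mulrA mulVf// !mul1r.
    apply: (subv_trans W3); apply/span_subvP => t; rewrite !inE => /or3P[]/eqP->.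
    * by in_span.
    * move: yi; have [->|->] /= := ord2P i => yi; last by in_span.
      rewrite [X in X \in _](_ : v = (y 0 0)^-1 *: (y 0 0 *: v + y 0 1 *: w) - (y 0 1 / y 0 0)
        *: w).
        by rewrite memvB// memvZ//; in_span.
      by apply/rowP => j; rewrite !mxE; field.
    * move: yi; have [->|->] /= := ord2P i => yi; first by in_span.
      rewrite [X in X \in _](_ : w = (y 0 1)^-1 *: (y 0 0 *: v + y 0 1 *: w) - (y 0 0 / y 0 1)
        *: v).
        by rewrite memvB// memvZ//; in_span.
      by apply/rowP => j; rewrite !mxE; field.
Qed.

Lemma closed_fam_gl2 : closed fam.
Proof.
rewrite (_ : fam = [set W | symplectic W] `&` [set W | (step W 1 <= <<[:: u]>>)%VS] `&`
  [set W | (step W 3 <= <<[:: u; v; w]>>)%VS]).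
  by apply: closedI; [apply: closedI; [exact: closed_symplectic|]|]; exact: closed_step_sub.
by apply/seteqP; split=> W; [move=> /fam_gl2P[]|move=> [[? ?] ?]; apply/fam_gl2P].
Qed.

Lemma irreducible_fam_gl2 : irreducible fam.
Proof.
have [phi [psi iso]] := fam_gl2_iso.
exact: inverse_isos_irreducible iso (irreducible_projective_space F 1).
Qed.

End GL2.

End Families.

Section Surfaces.
Variable F : closedFieldType.
Notation e := (@e F).
Notation P1 := (projective_space F 1).
Notation P2 := (projective_space F 2).
Implicit Types (W : flag_variety F 6) (U : {vspace 'rV[F]_6}).
Local Notation "<| x , y |>" := (@pairing F x y) (at level 2, format "<| x ,  y |>").

Lemma eq_neq0 (a b : F) : b != 0 -> a = b -> a != 0.
Proof. by move=> ? ->. Qed.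

Lemma eqN_neq0 (a b : F) : b != 0 -> a = - b -> a != 0.
Proof. by move=> ? ->; rewrite oppr_eq0. Qed.

Lemma step_span W k s : (size s <= k)%N -> (k <= 6)%N -> (step W k <= <<s>>)%VS ->
  step W k = <<s>>%VS.
Proof.
move=> sk k6 Ws; apply/eqP; rewrite eqEdim Ws step_dim//=.
by rewrite (leq_trans (dim_span _)).
Qed.

Lemma mem_span2E (u v x : 'rV[F]_6) a b : x = a *: u + b *: v -> x \in <<[:: u; v]>>%VS.
Proof. by move=> ->; rewrite memvD// memvZ//; in_span. Qed.

Lemma mem_span3E (u v w x : 'rV[F]_6) a b c :
  x = a *: u + b *: v + c *: w -> x \in <<[:: u; v; w]>>%VS.
Proof. by move=> ->; rewrite memvD ?memvD// memvZ//; in_span. Qed.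

(** * The product surface: [W_2] fixed, [W_1] and [W_3] free *)

Section FiberedSurface.
Notation X := (fam_56_14 F).
Notation c1 x := (x 0 0 *: e 5 + x 0 1 *: e 6)%R.
Notation c3 y := (y 0 0 *: e 1 + y 0 1 *: e 4)%R.

(** The second row completes [c1 x] to a basis of the span of [e 5] and [e 6], the fourth completes
    [c3 y] in the span of [e 1] and [e 4], and [x_1 e 2 - x_0 e 3] is orthogonal to [c1 x]. *)
Lemma adapted_56_14 (x y : 'rV[F]_2) i j : x 0 i != 0 -> y 0 j != 0 ->
  adapted (c1 x) (if i == 0 then e 6 else e 5) (c3 y) (if j == 0 then e 4 else e 1)
    (x 0 1 *: e 2 + (- x 0 0) *: e 3) (if i == 0 then e 2 else e 3).
Proof.
move=> xi yj; rewrite /adapted; move: xi yj.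
have [->|->] := ord2P i; have [->|->] /= := ord2P j => xi yj; rewrite !pairingE !pairing_e //=;
  (split; [split|..|split]); try ring;
  by first [apply: (eq_neq0 xi); ring | apply: (eqN_neq0 xi); ring
           |apply: (eq_neq0 yj); ring | apply: (eqN_neq0 yj); ring].
Qed.

Lemma perp_e56 : perp <<[:: e 5; e 6]>> = <<[:: e 5; e 6; e 1; e 4]>>%VS.
Proof.
apply: (@perp_frame _ _ _ _ _ (e 3) (e 2)); rewrite /adapted !pairing_e //=.
split; [split|..|split]; try ring;
  by rewrite ?(sub0r, subr0) ?oppr_eq0 oner_eq0.
Qed.

(** This explains the product: [W_1] is any line in the plane [W_2], and independently [W_3 / W_2]
    is any line in the plane [perp W_2 / W_2], with basis the classes of [e 1] and [e 4]. *)
Lemma fam_56_14P W : X W <-> symplectic W /\ (step W 2 <= <<[:: e 5; e 6]>>)%VS.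
Proof.
split=> [[a [b [c [d [al [be [abcd ab WE]]]]]]]|[Ws W2]].
  rewrite (step_Phi (k := 2) WE)//; split.
    by apply: Phi_symplectic WE _; split; rewrite ?pairingE !pairing_e //=; ring.
  by apply/span_subvP => x; rewrite !inE => /orP[]/eqP->; exact: mem_span2E.
have [g gW] := coords_ex W; have W2E := step_span (k := 2) (s := [:: e 5; e 6]) isT isT W2.
have rE (k : 'I_6) : (k < 2)%N -> exists a c, row k (vec_mx g) = 0 + (a *: e 5 + c *: e 6).
  move=> k2; have /(subvP W2)/mem_span2[a [c ->]] := coords_row_step gW k2 isT.
  by exists a, c; rewrite add0r.
have [a [c r0]] := rE 0 isT; have [b [d r1]] := rE 1 isT.
have abcd : gl2 a b c d.
  apply: (flag_gl2 r0 r1 (mem0v (step W 0)) (mem0v _) (step_sub W (j := 0) (k := 1) isT isT)).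
  - exact: (coords_row_step gW).
  - exact: (coords_row_stepN 0 gW).
  - exact: (coords_row_stepN 1 gW).
have : row 2 (vec_mx g) \in perp <<[:: e 5; e 6]>>.
  rewrite -W2E -(symplectic_step Ws)//; exact: (coords_row_step gW).
rewrite perp_e56 => /mem_span4[k [l [al [be r2]]]].
exists a, b, c, d, al, be; split=> //.
  apply: flag_line (coords_row_stepN 2 gW); first by rewrite r2 -addrA.
  by rewrite W2E; exact: mem_span2E.
have e5S : e 5 \in <<[:: (a *: e 5 + c *: e 6)%R; (b *: e 5 + d *: e 6)%R;
    (al *: e 1 + be *: e 4)%R]>>%VS.
  apply: (@mem_span3E _ _ _ _ (d / (a * d - b * c)) (- c / (a * d - b * c)) 0).
  by apply/rowP => j; rewrite !mxE; field.
have e6S : e 6 \in <<[:: (a *: e 5 + c *: e 6)%R; (b *: e 5 + d *: e 6)%R;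
    (al *: e 1 + be *: e 4)%R]>>%VS.
  apply: (@mem_span3E _ _ _ _ (- b / (a * d - b * c)) (a / (a * d - b * c)) 0).
  by apply/rowP => j; rewrite !mxE; field.
rewrite add0r in r0; rewrite add0r in r1.
apply: PhiP => //; rewrite (coords_step gW)//; apply: span_rows_sub;
  move=> [[|[|[|//]]] h] //= _.
- by rewrite (_ : Ordinal h = 0) ?r0; [in_span|exact/val_inj].
- by rewrite (_ : Ordinal h = 0) ?r0; [in_span|exact/val_inj].
- by rewrite (_ : Ordinal h = 1) ?r1; [in_span|exact/val_inj].
- by rewrite (_ : Ordinal h = 0) ?r0; [in_span|exact/val_inj].
- by rewrite (_ : Ordinal h = 1) ?r1; [in_span|exact/val_inj].
- rewrite (_ : Ordinal h = 2) ?r2; last exact/val_inj.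
  by rewrite -addrA memvD//; [rewrite memvD ?memvZ|in_span].
Qed.

Lemma fam_56_14_ex (x y : 'rV[F]_2) : x != 0 -> y != 0 ->
  exists W, [/\ X W, step W 1 = <<[:: c1 x]>>%VS & step W 3 = <<[:: e 5; e 6; c3 y]>>%VS].
Proof.
move=> /rV_neq0[i xi] /rV_neq0[j yj].
have [W [_ WE]] := frame_flag (adapted_56_14 xi yj); exists W.
have Ws : symplectic W.
  apply: Phi_symplectic WE _; have [[r01 r02 _ _] r12 _ _] := adapted_56_14 xi yj; by split.
have e56 : (<<[:: c1 x; (if i == 0 then e 6 else e 5)%R]>> <= <<[:: e 5; e 6]>>)%VS.
  apply/span_subvP => t; rewrite !inE => /orP[]/eqP->; first exact: mem_span2E.
  by case: ifP => _; in_span.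
split; [|exact: (step_Phi (k := 1) WE)|].
  by apply/fam_56_14P; split=> //; rewrite (step_Phi (k := 2) WE).
apply: step_span => //; rewrite (step_Phi (k := 3) WE)//=.
apply/span_subvP => t; rewrite !inE => /or3P[]/eqP->; last by in_span.
  by rewrite memvD ?memvZ//; in_span.
by case: ifP => _; in_span.
Qed.

Lemma fam_56_14_iso : isomorphic X [set: hprod P1 P1].
Proof.
have P1orb := orbital_projective_space F 1; have [_ Pex _] := P1orb.
pose R W (PQ : hprod P1 P1) := exists x y : 'rV[F]_2,
  [/\ @coords F P1 x PQ.1, @coords F P1 y PQ.2, (step W 1 <= <<[:: c1 x]>>)%VS &
      (step W 3 <= <<[:: e 5; e 6; c3 y]>>)%VS].
have BA (PQ : hprod P1 P1) : setT PQ -> exists2 W, X W & R W PQ.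
  case: PQ => P Q _; have [x xP] := Pex P; have [y yQ] := Pex Q.
  have [W [XW W1 W3]] := fam_56_14_ex (coords_proj_neq0 xP) (coords_proj_neq0 yQ).
  by exists W => //; exists x, y; rewrite W1 W3.
suff [phi [psi [iso _]]] : exists phi psi, inverse_isos X [set: hprod P1 P1] phi psi /\
  forall W, X W -> R W (phi W) by exists phi, psi.
apply: iso_of_graph.
- exact: orbital_flag_variety.
- exact: orbital_hprod.
- have [|P _] := @coords_proj_ex F 1 (delta_mx 0 0).
    by apply: (@coord_neq0 _ _ _ 0); rewrite mxE !eqxx oner_eq0.
  by have [W XW _] := BA (P, P) I; exists W.
- move=> W [a [b [c [d [al [be [abcd ab WE]]]]]]].
  have [|P xP] := @coords_proj_ex F 1 (row_of 2 [:: a; c]).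
    rewrite row_of2_neq0; apply: contra abcd => /eqP[-> ->].
    by rewrite !(mul0r, mulr0) subrr.
  have [|Q yQ] := @coords_proj_ex F 1 (row_of 2 [:: al; be]); first by rewrite row_of2_neq0.
  exists (P, Q) => //; exists (row_of 2 [:: a; c]), (row_of 2 [:: al; be]).
  rewrite !mxE (step_Phi (k := 1) WE)// (step_Phi (k := 3) WE)//; split=> //.
  apply/span_subvP => t; rewrite !inE => /or3P[]/eqP->; last by in_span.
    by rewrite memvD ?memvZ//; in_span.
  by rewrite memvD ?memvZ//; in_span.
- exact: BA.
(* Up to sign, [e 2], [e 3] are dual to [e 5], [e 6], and [e 4], [e 1] are dual to [e 1], [e 4]; the
   pairings read off the direction of [W_1] and that of [W_3] modulo [W_2]. *)
- move=> W g _ _; exists (fun=> 1), (fun g : 'rV[F]_(6 * 6) => row_mx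
    (row_of 2 [:: - <|row 0 (vec_mx g), e 2|>; - <|row 0 (vec_mx g), e 3|>])
    (row_of 2 [:: <|row 2 (vec_mx g), e 4|>; - <|row 2 (vec_mx g), e 1|>])); split.
  + exact: polyfun_cst.
  + exact: oner_neq0.
  + move=> j; apply: polyfun_ratfun; move: j; apply: polyfun_row_mx;
    apply: polyfun_row_of => -[|[|//]] _ /=; do ?apply: polyfunN;
    by apply: polyfun_pairing => l; [exact: polyfun_row|exact: polyfun_cst].
  + move=> W' [P Q] {}g XW' _ [x [y [/= xP yQ W1 W3]]] gW _; rewrite row_mxKl row_mxKr; split.
      have /(subvP W1)/mem_span1[c rE] := coords_row_step gW (k := 0) (j := 1) isT isT.
      rewrite rE (_ : row_of _ _ = c *: x).
        apply: (@coords_projZ _ 1 _ P _ _ xP); apply: contraNneq (coords_row_stepN 0 gW) => c0.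
        by rewrite rE c0 scale0r mem0v.
      rewrite [x in RHS]rV2E !pairingE !pairing_e //=.
      by apply/rowP => j; rewrite !mxE; have [->|->] := ord2P j; rewrite /=; ring.
    have /(subvP W3)/mem_span3[k [l [t rE]]] := coords_row_step gW (k := 2) (j := 3) isT isT.
    rewrite rE (_ : row_of _ _ = t *: y).
      apply: (@coords_projZ _ 1 _ Q _ _ yQ); apply: contraNneq (coords_row_stepN 2 gW) => t0.
      have [_ W2] := (fam_56_14P W').1 XW'.
      rewrite (step_span (k := 2) (s := [:: e 5; e 6]) isT isT W2) rE t0 scale0r addr0.
      exact: mem_span2E.
    rewrite [y in RHS]rV2E !pairingE !pairing_e //=.
    by apply/rowP => j; rewrite !mxE; have [->|->] := ord2P j; rewrite /=; ring.
- move=> [P Q] w _ [wP wQ]; have [i xi] := rV_neq0 (coords_proj_neq0 wP).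
  have [j yj] := rV_neq0 (coords_proj_neq0 wQ).
  exists (fun w : 'rV[F]_(2 + 2) => lsubmx w 0 i * rsubmx w 0 j),
    (fun w : 'rV[F]_(2 + 2) => mxvec (frame
    [:: c1 (lsubmx w); if i == 0 then e 6 else e 5; c3 (rsubmx w); if j == 0 then e 4 else e 1;
        lsubmx w 0 1 *: e 2 + (- lsubmx w 0 0) *: e 3; if i == 0 then e 2 else e 3]));
          split=> //.
  + by apply: polyfunM; [exact: polyfun_lsubmx|exact: polyfun_rsubmx].
  + by rewrite mulf_neq0.
  + move=> k; apply: polyfun_ratfun; apply: polyfun_frame => -[|[|[|[|[|[|//]]]]]] l _ /=;
      do ?exact: polyvec_cst; apply: polyvecD; apply: polyvecZ; do ?apply: polyfunN;
      do ?[exact: polyfun_lsubmx|exact: polyfun_rsubmx|exact: polyvec_cst].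
  + move=> [P' Q'] W y _ /fam_56_14P[Ws W2] [x' [y' [x'P y'Q W1 W3]]] [yP yQ].
    rewrite mulf_eq0 negb_or => /andP[].
    have [c c0 xE] := coords_proj_eq yP x'P; have [d d0 yE] := coords_proj_eq yQ y'Q.
    rewrite {}xE in W1; rewrite {}yE in W3.
    move: (lsubmx y) (rsubmx y) W1 W3 => {yP yQ}y z W1 W3 yi zj.
    apply: (frame_coords (adapted_56_14 yi zj)) => //.
    * apply: (subv_trans W1); apply/span_subvP => t; rewrite inE => /eqP->.
      by rewrite !mxE -!scalerA -scalerDr memvZ//; in_span.
    * apply: (subv_trans W2); apply/span_subvP => t; rewrite !inE => /orP[]/eqP->.
        move: yi; have [->|->] /= := ord2P i => yi; last by in_span.
        apply: (@mem_span2E _ _ _ (y 0 0)^-1 (- y 0 1 / y 0 0)).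
        by apply/rowP => k; rewrite !mxE; field.
      move: yi; have [->|->] /= := ord2P i => yi; first by in_span.
      apply: (@mem_span2E _ _ _ (y 0 1)^-1 (- y 0 0 / y 0 1)).
      by apply/rowP => k; rewrite !mxE; field.
    * apply: (subv_trans W3); apply/span_subvP => t; rewrite !inE => /or3P[]/eqP->; last first.
      - by rewrite !mxE -!scalerA -scalerDr memvZ//; in_span.
      - move: yi; have [->|->] /= := ord2P i => yi; first by in_span.
        apply: (@mem_span3E _ _ _ _ (y 0 1)^-1 (- y 0 0 / y 0 1) 0).
        by apply/rowP => k; rewrite !mxE; field.
      - move: yi; have [->|->] /= := ord2P i => yi; last by in_span.
        apply: (@mem_span3E _ _ _ _ (y 0 0)^-1 (- y 0 1 / y 0 0) 0).
        by apply/rowP => k; rewrite !mxE; field.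
Qed.

Lemma closed_fam_56_14 : closed X.
Proof.
rewrite (_ : X = [set W | symplectic W] `&` [set W | (step W 2 <= <<[:: e 5; e 6]>>)%VS]).
  by apply: closedI; [exact: closed_symplectic|exact: closed_step_sub].
by apply/seteqP; split=> W; [move=> /fam_56_14P[]|move=> ?; apply/fam_56_14P].
Qed.

Lemma irreducible_fam_56_14 : irreducible X.
Proof.
have [phi [psi iso]] := fam_56_14_iso.
exact: inverse_isos_irreducible iso (irreducible_P1xP1 F).
Qed.

End FiberedSurface.

(** * The blown-up plane: [W_1] fixed, [W_3] in a fixed space of dimension 4 *)

Section BlownUpPlane.
Notation Y := (fam_6_145_5 F `|` fam_line (e 6) (e 5) (e 1) (e 4)).
Notation c2 x := (x 0 0 *: e 1 + x 0 1 *: e 4 + x 0 2 *: e 5)%R.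
Notation c3 y := (y 0 0 *: e 1 + y 0 1 *: e 4)%R.

Lemma bundle_coordE (x : 'rV[F]_3) : (bundle_coord 0 0 x = x 0 0) * (bundle_coord 1 0 x = x 0
  1) *
  (forall i, bundle_coord i 1 x = x 0 2).
Proof. by do !split; rewrite /bundle_coord /=; congr (x 0 _); exact/val_inj. Qed.

Lemma bundle_coord_ex (x : 'rV[F]_3) (y : 'rV[F]_2) i : x != 0 -> y 0 i != 0 ->
  x 0 0 * y 0 1 = x 0 1 * y 0 0 -> exists j, bundle_coord i j x != 0.
Proof.
move=> x0 yi xy; have [x2|x2] := eqVneq (x 0 2) 0; last first.
  by exists 1; rewrite bundle_coordE.
exists 0; apply: contraNneq x0 => xi; apply/eqP/rowP => k; rewrite mxE.
have /andP[/eqP x00 /eqP x01] : (x 0 0 == 0) && (x 0 1 == 0).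
  move: yi xi; have [->|->] := ord2P i => yi; rewrite bundle_coordE => xi.
    rewrite xi eqxx /=; have /eqP := xy; rewrite xi mul0r eq_sym mulf_eq0 (negPf yi) orbF.
    by [].
  rewrite xi eqxx andbT; have /eqP := xy; rewrite xi mul0r mulf_eq0 (negPf yi) orbF.
  by [].
by case: k => [[|[|[|//]]] k3]; [rewrite -[RHS]x00|rewrite -[RHS]x01|rewrite -[RHS]x2];
  congr (x 0 _); exact/val_inj.
Qed.

(** Orthogonality of [c2 x] and [c3 y] is precisely the equation [x_0 y_1 = x_1 y_0] of the
    blowing-up. The third row completes [c2 x] to [e 6], [e 5], [c3 y] in the chart [j], and the
    fourth row is orthogonal to [c2 x] by cancellation of two terms. *)
Lemma adapted_blowup (x : 'rV[F]_3) (y : 'rV[F]_2) i j :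
  y 0 i != 0 -> bundle_coord i j x != 0 -> x 0 0 * y 0 1 = x 0 1 * y 0 0 ->
  adapted (e 6) (c2 x) (if j == 0 then e 5 else c3 y)
    (if i == 0 then x 0 2 *: e 4 + x 0 0 *: e 2 else x 0 2 *: e 1 + (- x 0 1) *: e 2)
    (if j == 0 then (if i == 0 then e 4 else e 1) else e 2) (e 3).
Proof.
move=> yi xj xy; have xyj := mulf_neq0 xj yi; rewrite /adapted; move: yi xj xyj.
have xy0 : x 0 0 * y 0 1 - x 0 1 * y 0 0 = 0 by rewrite xy subrr.
have F1 : (1 : F) != 0 := oner_neq0 F.
have [->|->] := ord2P i; have [->|->] /= := ord2P j; rewrite !bundle_coordE => yi xj xyj;
  rewrite !pairingE !pairing_e //=; (split; [split|..|split]); try ring;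
  by first [rewrite -[RHS]xy0; ring
           |apply: (eq_neq0 xj); ring | apply: (eqN_neq0 xj); ring
           |apply: (eq_neq0 xyj); ring | apply: (eqN_neq0 xyj); ring
           |apply: (eq_neq0 F1); ring | apply: (eqN_neq0 F1); ring].
Qed.

Lemma adapted_6514 : adapted (e 6) (e 5) (e 1) (e 4) (e 2) (e 3).
Proof.
have F1 : (1 : F) != 0 := oner_neq0 F; rewrite /adapted !pairing_e //=.
by split; [split|..|split]; first [ring|apply: (eq_neq0 F1); ring|apply: (eqN_neq0 F1); ring].
Qed.

(** On the span of [e 1], [e 4], [e 5] the pairing has radical spanned by [e 5], so an isotropic
    plane contains [e 5]. If row 1 has a nonzero part [(a, b)] on [e 1] and [e 4], isotropy makes
    the part of row 2 proportional to it and [W_3] is determined by [W_2]; otherwise [W_2] is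
    spanned by [e 6] and [e 5]. *)
Lemma blowup_famP W : Y W <-> [/\ symplectic W, (step W 1 <= <<[:: e 6]>>)%VS &
  (step W 3 <= <<[:: e 6; e 5; e 1; e 4]>>)%VS].
Proof.
split=> [[[a [b [c [_ WE]]]]|[a [b [_ WE]]]]|[Ws W1 W3]].
- rewrite (step_Phi (k := 1) WE)// (step_Phi (k := 3) WE)//; split=> //.
    by apply: Phi_symplectic WE _; split; rewrite ?pairingE !pairing_e //=; ring.
  apply/span_subvP => x; rewrite !inE => /or3P[]/eqP->; [by in_span| |by in_span].
  by rewrite !memvD// memvZ//; in_span.
- rewrite (step_Phi (k := 1) WE)// (step_Phi (k := 3) WE)//; split=> //.
    by apply: Phi_symplectic WE _; split; rewrite ?pairingE !pairing_e //=; ring.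
  apply/span_subvP => x; rewrite !inE => /or3P[]/eqP->; [by in_span|by in_span|].
  by rewrite !memvD// memvZ//; in_span.
have [g gW] := coords_ex W.
have rE (k : 'I_6) : (k < 3)%N -> exists t c a b,
    row k (vec_mx g) = t *: e 6 + c *: e 5 + a *: e 1 + b *: e 4.
  by move=> k3; have /(subvP W3)/mem_span4 := coords_row_step gW k3 isT.
have [t1 [c [a [b r1]]]] := rE 1 isT; have [t2 [c' [a' [b' r2]]]] := rE 2 isT.
have /(subvP W1)/mem_span1[t0 r0] := coords_row_step gW (k := 0) (j := 1) isT isT.
have [ab0|ab0] := eqVneq (a, b) (0, 0).
  right; apply/(fam_lineP adapted_6514); split=> //.
  rewrite (coords_step gW)//; apply: span_rows_sub => -[[|[|//]] h] _.
    by rewrite (_ : Ordinal h = 0) ?r0; [rewrite memvZ//; in_span|exact/val_inj].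
  rewrite (_ : Ordinal h = 1) ?r1; last exact/val_inj.
  by case: ab0 => -> ->; rewrite !scale0r !addr0 memvD// memvZ//; in_span.
have [r12 _ _] := symplectic_isotropic3 Ws (coords_row_step gW (k := 1) (j := 3) isT isT)
  (coords_row_step gW (k := 2) (j := 3) isT isT) (coords_row_step gW (k := 2) (j := 3) isT isT).
have {}r12 : a * b' = b * a'.
  apply/eqP; rewrite -subr_eq0; apply/eqP; rewrite -[RHS]r12 r1 r2 !pairingE !pairing_e //=.
  by ring.
left; exists a, b, c; split.
  by move=> [t [a0 b0 _]]; rewrite a0 b0 eqxx in ab0.
apply: PhiP => //; rewrite (coords_step gW)//; apply: span_rows_sub;
  move=> [[|[|[|//]]] h] //= _.
- by rewrite (_ : Ordinal h = 0) ?r0; [rewrite memvZ//; in_span|exact/val_inj].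
- rewrite (_ : Ordinal h = 1) ?r1; last exact/val_inj.
  by apply: (@mem_span2E _ _ _ t1 1); apply/rowP => k; rewrite !mxE; ring.
- by rewrite (_ : Ordinal h = 0) ?r0; [rewrite memvZ//; in_span|exact/val_inj].
- rewrite (_ : Ordinal h = 1) ?r1; last exact/val_inj.
  by apply: (@mem_span3E _ _ _ _ t1 1 0); apply/rowP => k; rewrite !mxE; ring.
rewrite (_ : Ordinal h = 2) ?r2; last exact/val_inj.
have [a0|a0] := eqVneq a 0.
  have b0 : b != 0 by apply: contra ab0 => /eqP->; rewrite a0.
  have -> : a' = a * b' / b by rewrite r12 mulrAC divff ?mul1r.
  apply: (@mem_span3E _ _ _ _ t2 (b' / b) (c' - c * b' / b)).
  by apply/rowP => k; rewrite !mxE; field.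
have -> : b' = b * a' / a by rewrite -r12 mulrAC divff ?mul1r.
apply: (@mem_span3E _ _ _ _ t2 (a' / a) (c' - c * a' / a)).
by apply/rowP => k; rewrite !mxE; field.
Qed.

(* On the blowing-up the first two coordinates of x are proportional to y. *)
Lemma c2E (x : 'rV[F]_3) (y : 'rV[F]_2) i : y 0 i != 0 -> x 0 0 * y 0 1 = x 0 1 * y 0 0 ->
  c2 x = (bundle_coord i 0 x / y 0 i) *: c3 y + x 0 2 *: e 5.
Proof.
move=> yi xy; congr (_ + _); move: yi; have [->|->] := ord2P i => yi;
  rewrite bundle_coordE scalerDr !scalerA.
  by rewrite divfK// mulrAC xy mulfK.
by rewrite divfK// mulrAC -xy mulfK.
Qed.

Lemma blowup_eq (PQ : hprod P2 P1) (x : 'rV[F]_3) (y : 'rV[F]_2) : blowup_P2 F PQ ->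
  @coords F P2 x PQ.1 -> @coords F P1 y PQ.2 -> x 0 0 * y 0 1 = x 0 1 * y 0 0.
Proof.
move=> [x' [y' [x'P y'Q xy]]] xP yQ.
have [c _ ->] := @coords_proj_eq F 2 x' x PQ.1 x'P xP.
have [d _ ->] := @coords_proj_eq F 1 y' y PQ.2 y'Q yQ.
by rewrite !mxE mulrACA xy mulrACA.
Qed.

(** [W_2 / W_1] is a point of the projective plane on [e 1], [e 4], [e 5], and [W_3], which contains
    [e 5], gives a point of the projective line on [e 1] and [e 4]. *)
Definition blowup_graph W (PQ : hprod P2 P1) := exists (x : 'rV[F]_3) (y : 'rV[F]_2),
  [/\ @coords F P2 x PQ.1, @coords F P1 y PQ.2, (step W 2 <= <<[:: e 6; c2 x]>>)%VS &
      (step W 3 <= <<[:: e 6; e 5; c3 y]>>)%VS].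

Lemma blowup_graph_fam W : Y W -> exists2 PQ, blowup_P2 F PQ & blowup_graph W PQ.
Proof.
move=> [[a [b [c [abc WE]]]]|[a [b [ab WE]]]].
  have ab : (a, b) != (0, 0) by apply/eqP => -[a0 b0]; apply: abc; exists c; rewrite a0 b0.
  have [|P xP] := @coords_proj_ex F 2 (row_of 3 [:: a; b; c]).
    apply: contra ab => /eqP/rowP abc0; have := abc0 0; have := abc0 1.
    by rewrite !mxE /= => -> ->.
  have [|Q yQ] := @coords_proj_ex F 1 (row_of 2 [:: a; b]); first by rewrite row_of2_neq0.
  exists (P, Q); exists (row_of 3 [:: a; b; c]), (row_of 2 [:: a; b]).
    by split; rewrite // !mxE /= mulrC.
  rewrite !mxE (step_Phi (k := 2) WE)// (step_Phi (k := 3) WE)//; split=> //.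
  apply/span_subvP => t; rewrite !inE => /or3P[]/eqP->; [by in_span| |by in_span].
  by apply: (@mem_span3E _ _ _ _ 0 c 1); apply/rowP => k; rewrite !mxE /=; ring.
have [|P xP] := @coords_proj_ex F 2 (row_of 3 [:: 0; 0; 1]).
  by apply: (@coord_neq0 _ _ _ 2); rewrite mxE oner_eq0.
have [|Q yQ] := @coords_proj_ex F 1 (row_of 2 [:: a; b]); first by rewrite row_of2_neq0.
exists (P, Q); exists (row_of 3 [:: 0; 0; 1]), (row_of 2 [:: a; b]).
  by split; rewrite // !mxE /= !mul0r.
rewrite !mxE (step_Phi (k := 2) WE)// (step_Phi (k := 3) WE)//; split=> //.
by rewrite /= !scale0r !add0r scale1r.
Qed.

Lemma blowup_graph_ex (PQ : hprod P2 P1) : blowup_P2 F PQ -> exists2 W, Y W & blowup_graph W PQ.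
Proof.
move=> BPQ; case: (BPQ) => x [y [xP yQ xy]].
have x0 : x != 0 by exact: (@coords_proj_neq0 _ 2 x PQ.1).
have /rV_neq0[i yi] : y != 0 by exact: (@coords_proj_neq0 _ 1 y PQ.2).
have [j xj] := bundle_coord_ex x0 yi xy.
have ad := adapted_blowup yi xj xy; have [W [_ WE]] := frame_flag ad.
have Ws : symplectic W.
  by apply: Phi_symplectic WE _; have [[r01 r02 _ _] r12 _ _] := ad; split.
have W3 : (step W 3 <= <<[:: e 6; e 5; c3 y]>>)%VS.
  rewrite (step_Phi (k := 3) WE)//; apply/span_subvP => t; rewrite !inE => /or3P[]/eqP->.
  - by in_span.
  - rewrite (c2E yi xy); apply: (@mem_span3E _ _ _ _ 0 (x 0 2) (bundle_coord i 0 x / y 0 i)).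
    by rewrite scale0r add0r addrC.
  - by case: ifP => _; in_span.
exists W; last by exists x, y; rewrite (step_Phi (k := 2) WE).
apply/blowup_famP; split; rewrite // ?(step_Phi (k := 1) WE)//.
apply: (subv_trans W3); apply/span_subvP => t; rewrite !inE => /or3P[]/eqP->;
  [by in_span|by in_span|].
by rewrite memvD// memvZ//; in_span.
Qed.

Definition coord14 (i : 'I_2) (v : 'rV[F]_6) := if i == 0 then <|v, e 4|> else - <|v, e 1|>.

Lemma coord14_c3 t u v (y : 'rV[F]_2) i : coord14 i (t *: e 6 + u *: e 5 + v *: c3 y) = v * y 0
  i.
Proof.
by rewrite /coord14 !pairingE !pairing_e //=; have [->|->] := ord2P i; rewrite /=; ring.
Qed.

Lemma polyfun_coord14 i k : polyfun (fun g : 'rV[F]_(6 * 6) => coord14 i (row k (vec_mx g))).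
Proof.
by rewrite /coord14; case: eqP => _; [|apply: polyfunN]; apply: polyfun_pairing => l;
  [exact: polyfun_row|exact: polyfun_cst|exact: polyfun_row|exact: polyfun_cst].
Qed.

(** The direction [y] can be read from any of the first three rows lying outside the span of [e 6]
    and [e 5]. Which row this is depends on the flag, but one exists since [W_3] has dimension 3. *)
Lemma blowup_chart_row W g : Y W -> coords g W ->
  exists (k : 'I_6) i, (k < 3)%N /\ coord14 i (row k (vec_mx g)) != 0.
Proof.
move=> YW gW; have [PQ _ [x [y [_ yQ _ W3]]]] := blowup_graph_fam YW.
have /rV_neq0[i yi] : y != 0 by exact: (@coords_proj_neq0 _ 1 y PQ.2).
apply: contrapT => nk; suff /dimvS : (step W 3 <= <<[:: e 6; e 5]>>)%VS.
  by rewrite step_dim// => /leq_trans/(_ (dim_span _)).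
rewrite (coords_step gW)//; apply: span_rows_sub => k k3.
have /(subvP W3)/mem_span3[t [u [v rE]]] := coords_row_step gW k3 isT.
have v0 : v = 0.
  apply/eqP/negPn/negP => v0; apply: nk; exists k, i; split=> //.
  by rewrite rE coord14_c3 mulf_neq0.
by rewrite rE v0 scale0r addr0; exact: mem_span2E.
Qed.

Lemma blowup_fam_iso : exists phi psi, inverse_isos Y (blowup_P2 F) phi psi /\
  forall W, Y W -> blowup_graph W (phi W).
Proof.
have P1orb := orbital_projective_space F 1; have P2orb := orbital_projective_space F 2.
apply: iso_of_graph.
- exact: orbital_flag_variety.
- exact: orbital_hprod.
- have pair10 : (1, 0) != (0, 0) :> F * F by rewrite xpair_eqE oner_eq0.
  have [W WE] := fam_line_ex adapted_6514 (a := 1) (b := 0) pair10.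
  by exists W; right; exists 1, 0.
- exact: blowup_graph_fam.
- exact: blowup_graph_ex.
- move=> W g YW gW; have [k [i [k3 ki]]] := blowup_chart_row YW gW.
  exists (fun g : 'rV[F]_(6 * 6) => coord14 i (row k (vec_mx g))),
    (fun g : 'rV[F]_(6 * 6) => row_mx
    (row_of 3 [:: coord14 0 (row 1 (vec_mx g)); coord14 1 (row 1 (vec_mx g));
      - <|row 1 (vec_mx g), e 2|>])
    (row_of 2 [:: coord14 0 (row k (vec_mx g)); coord14 1 (row k (vec_mx g))])); split.
  + exact: polyfun_coord14.
  + exact: ki.
  + move=> j; apply: polyfun_ratfun; move: j; apply: polyfun_row_mx; apply: polyfun_row_of.
      move=> -[|[|[|//]]] _ /=; do ?exact: polyfun_coord14; apply: polyfunN.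
      by apply: polyfun_pairing => l; [exact: polyfun_row|exact: polyfun_cst].
    by move=> -[|[|//]] _ /=; exact: polyfun_coord14.
  + move=> W' [P Q] {}g /blowup_famP[W's W'1 _] _ [x [y [/= xP yQ W2 W3]]] {}gW {}ki.
    rewrite row_mxKl row_mxKr; split.
      have /(subvP W2)/mem_span2[t [c rE]] := coords_row_step gW (k := 1) (j := 2) isT isT.
      rewrite rE (_ : row_of _ _ = c *: x).
        apply: (@coords_projZ _ 2 _ P _ _ xP); apply: contraNneq (coords_row_stepN 1 gW) => c0.
        rewrite (step_span (k := 1) (s := [:: e 6]) isT isT W'1).
        by rewrite rE c0 scale0r addr0 memvZ//; in_span.
      rewrite /coord14 !pairingE !pairing_e //=.
      apply/rowP => -[[|[|[|//]]] h]; rewrite !mxE /=.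
      * by rewrite (_ : Ordinal h = 0); [ring|exact/val_inj].
      * by rewrite (_ : Ordinal h = 1); [ring|exact/val_inj].
      * by rewrite (_ : Ordinal h = 2); [ring|exact/val_inj].
    have /(subvP W3)/mem_span3[t [u [v rE]]] := coords_row_step gW k3 isT.
    move: ki; rewrite rE !coord14_c3 mulf_eq0 negb_or => /andP[v0 _].
    rewrite (_ : row_of _ _ = v *: y); first exact: (@coords_projZ _ 1 _ Q _ _ yQ).
    by apply/rowP => j; rewrite !mxE; have [->|->] := ord2P j.
- move=> [P Q] w BPQ [wP wQ]; have [i yi] := rV_neq0 (coords_proj_neq0 wQ).
  have xy := blowup_eq BPQ wP wQ.
  have [j xj] := bundle_coord_ex (coords_proj_neq0 wP) yi xy.
  exists (fun w : 'rV[F]_(3 + 2) => rsubmx w 0 i * bundle_coord i j (lsubmx w)),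
    (fun w : 'rV[F]_(3 + 2) => mxvec (frame
    [:: e 6; c2 (lsubmx w); if j == 0 then e 5 else c3 (rsubmx w);
        if i == 0 then lsubmx w 0 2 *: e 4 + lsubmx w 0 0 *: e 2
        else lsubmx w 0 2 *: e 1 + (- lsubmx w 0 1) *: e 2;
        if j == 0 then (if i == 0 then e 4 else e 1) else e 2; e 3])); split=> //.
  + by apply: polyfunM; [exact: polyfun_rsubmx|exact: polyfun_bundle_coord].
  + by rewrite mulf_neq0.
  + move=> k; apply: polyfun_ratfun; apply: polyfun_frame.
    case: (i == 0); case: (j == 0) => -[|[|[|[|[|[|//]]]]]] l _ /=; do ?exact: polyvec_cst;
      do ?apply: polyvecD; apply: polyvecZ;
      do ?apply: polyfunN; do ?[exact: polyfun_lsubmx|exact: polyfun_rsubmx|exact: polyvec_cst].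
  + move=> {xy}[P' Q'] W y BPQ' /blowup_famP[Ws W1 _] [x' [y' [/= x'P y'Q W2 W3]]] [yP yQ].
    rewrite mulf_eq0 negb_or => /andP[].
    have xy := blowup_eq BPQ' yP yQ.
    have [c c0 xE] := coords_proj_eq yP x'P; have [d d0 yE] := coords_proj_eq yQ y'Q.
    rewrite {}xE in W2; rewrite {}yE in W3.
    move: (lsubmx y) (rsubmx y) xy W2 W3 => {yP yQ yi xj}x {}y xy W2 W3 yi xj.
    apply: (frame_coords (adapted_blowup yi xj xy)) => //.
    * apply: (subv_trans W2); apply/span_subvP => t; rewrite !inE => /orP[]/eqP->.
        by in_span.
      by rewrite !mxE -!scalerA -!scalerDr memvZ//; in_span.
    * have c2S := c2E yi xy.
      apply: (subv_trans W3); apply/span_subvP => t; rewrite !inE => /or3P[]/eqP->.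
      - by in_span.
      - move: xj; have [->|->] /= := ord2P j; rewrite ?bundle_coordE => xj; first by in_span.
        apply: (@mem_span3E _ _ _ _ 0 (x 0 2)^-1 (- (bundle_coord i 0 x / y 0 i) / x 0 2)).
        by rewrite c2S; apply/rowP => k; rewrite !mxE; field; rewrite xj yi.
      - rewrite !mxE -!scalerA -!scalerDr memvZ//.
        move: xj; have [->|->] /= := ord2P j; rewrite ?bundle_coordE => xj; last by in_span.
        apply: (@mem_span3E _ _ _ _ 0 (y 0 i / bundle_coord i 0 x)
                  (- (y 0 i / bundle_coord i 0 x * x 0 2))).
        by rewrite c2S; apply/rowP => k; rewrite !mxE; field; rewrite xj yi.
Qed.

(** Lying in the product surface means that [W_2] is spanned by [e 5] and [e 6], that is, [c2 x] has
    no component on [e 1] and [e 4]: the centre [[0 : 0 : 1]] of the blowing-up. *)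
Lemma blowup_graph_exceptional W PQ : Y W -> blowup_P2 F PQ -> blowup_graph W PQ ->
  fam_56_14 F W <-> exceptional_curve F PQ.
Proof.
move=> /blowup_famP[Ws _ _] BPQ [x [y [xP _ W2 _]]].
have x0 : x != 0 by exact: (@coords_proj_neq0 _ 2 x PQ.1).
have d0 : delta_mx 0 2 != 0 :> 'rV[F]_3.
  by apply: (@coord_neq0 _ _ _ 2); rewrite mxE !eqxx oner_eq0.
split=> [/fam_56_14P[_ W2']|[_ PE]].
  have c2W : c2 x \in step W 2.
    by rewrite (step_span (k := 2) (s := [:: e 6; c2 x]) isT isT W2); in_span.
  have /(subvP W2')/mem_span2[a [b c2E']] := c2W.
  have x1 : x 0 1 = 0.
    have /eqP := congr1 (fun v => <|v, e 1|>) c2E';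
      rewrite !pairingE !pairing_e //= -subr_eq0 => /eqP h.
    by rewrite -[RHS]oppr0 -h; ring.
  have x00 : x 0 0 = 0.
    have /eqP := congr1 (fun v => <|v, e 4|>) c2E';
      rewrite !pairingE !pairing_e //= -subr_eq0 => /eqP h.
    by rewrite -[RHS]h; ring.
  split=> //; rewrite -[LHS]/(val PQ.1) xP; apply/(vline_eqP _ d0).
  have x2 : x 0 2 != 0.
    apply: contraNneq x0 => x2; apply/eqP/rowP => -[[|[|[|//]]] k]; rewrite mxE.
    - by rewrite -[RHS]x00; congr (x 0 _); exact/val_inj.
    - by rewrite -[RHS]x1; congr (x 0 _); exact/val_inj.
    - by rewrite -[RHS]x2; congr (x 0 _); exact/val_inj.
  exists (x 0 2)^-1; rewrite ?invr_eq0//; apply/rowP => -[[|[|[|//]]] k]; rewrite !mxE /=.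
  - by rewrite (_ : Ordinal k = 0) ?x00 ?mulr0//; exact/val_inj.
  - by rewrite (_ : Ordinal k = 1) ?x1 ?mulr0//; exact/val_inj.
  - by rewrite (_ : Ordinal k = 2) ?mulVf//; exact/val_inj.
apply/fam_56_14P; split=> //; apply: (subv_trans W2).
have [c _ ->] := @coords_proj_eq F 2 (delta_mx 0 2) x PQ.1 PE xP.
apply/span_subvP => t; rewrite !inE => /orP[]/eqP->; first by in_span.
by rewrite !mxE /= !mulr0 !scale0r !add0r memvZ//; in_span.
Qed.

Lemma closed_blowup_fam : closed Y.
Proof.
rewrite (_ : Y = [set W | symplectic W] `&` [set W | (step W 1 <= <<[:: e 6]>>)%VS] `&`
  [set W | (step W 3 <= <<[:: e 6; e 5; e 1; e 4]>>)%VS]).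
  by apply: closedI; [apply: closedI; [exact: closed_symplectic|]|]; exact: closed_step_sub.
by apply/seteqP; split=> W; [move=> /blowup_famP[]|move=> [[? ?] ?]; apply/blowup_famP].
Qed.

Lemma irreducible_blowup_fam : irreducible Y.
Proof.
have [phi [psi [iso _]]] := blowup_fam_iso.
exact: inverse_isos_irreducible iso (irreducible_blowup_P2 F).
Qed.

End BlownUpPlane.

End Surfaces.

(** * Flags stable under F and V *)

Section FrobeniusMaps.
Variables (p : nat) (F : closedFieldType).
Hypothesis pcharFp : p \in [pchar F].
Notation e := (@e F).
Local Notation "<| x , y |>" := (@pairing F x y) (at level 2, format "<| x ,  y |>").

(** The properties shared by Frobenius and its inverse, so that the lemmas on semilinear maps serve
    both [F] and [V]. *)
Definition twist (tau : F -> F) := [/\ {morph tau : x y / x + y}, {morph tau : x y / x * y},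
  tau 0 = 0, tau 1 = 1 & forall x, tau x = 0 -> x = 0].

Lemma frobE (x : F) : frob p x = pFrobenius_aut pcharFp x.
Proof. by []. Qed.

Lemma frob_twist : twist (@frob p F).
Proof.
split=> [x y|x y|||x].
- by rewrite !frobE rmorphD.
- by rewrite !frobE rmorphM.
- by rewrite !frobE rmorph0.
- by rewrite !frobE rmorph1.
- by move=> /eqP; rewrite frobE fmorph_eq0 => /eqP.
Qed.

Lemma frob_inj : injective (@frob p F).
Proof. by move=> x y; rewrite !frobE => /fmorph_inj. Qed.

Lemma frob_invK (x : F) : frob p (frob_inv p x) = x.
Proof.
have p0 : (0 < p)%N by exact: prime_gt0 (pcharf_prime pcharFp).
have [y yE] := solve_monicpoly (fun i => if i == 0 then x else 0) p0.
apply: (@xgetPex _ 0 [set y | y ^+ p = x]); exists y; rewrite /= yE.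
rewrite (bigD1 (Ordinal p0))//= expr0 mulr1 big1 ?addr0// => i.
by rewrite -val_eqE /= => /negPf->; rewrite mul0r.
Qed.

Lemma frob_inv_twist : twist (@frob_inv p F).
Proof.
have [fD fM f0 f1 fi] := frob_twist.
by split=> [x y|x y|||x xE]; [apply: frob_inj; rewrite fD !frob_invK|
  apply: frob_inj; rewrite fM !frob_invK|apply: frob_inj; rewrite f0 frob_invK|
  apply: frob_inj; rewrite f1 frob_invK|rewrite -[x]frob_invK xE].
Qed.

Section Twist.
Variable tau : F -> F.
Hypothesis tau_twist : twist tau.
Variable b : nat -> 'rV[F]_6.
Notation S := (semilinear_ext tau b).

Lemma semilinear_extD x y : S (x + y) = S x + S y.
Proof.
have [tD _ _ _ _] := tau_twist; rewrite /semilinear_ext -big_split /=.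
by apply: eq_bigr => i _; rewrite !mxE tD scalerDl.
Qed.

Lemma semilinear_extZ a x : S (a *: x) = tau a *: S x.
Proof.
have [_ tM _ _ _] := tau_twist; rewrite /semilinear_ext scaler_sumr /=.
by apply: eq_bigr => i _; rewrite !mxE tM scalerA.
Qed.

(* S acts nilpotently, hence trivially, on the lines W_(k+1) / W_k. *)
Lemma semilinear_nilpotent_row n (W : flag_variety F 6) g (k : 'I_6) :
  (forall x, iter n S x = 0) -> (forall (i : 'I_7) x, x \in steps W i -> S x \in steps W i) ->
  coords g W -> S (row k (vec_mx g)) \in step W k.
Proof.
have [_ _ _ _ ti] := tau_twist; move=> Sn WS gW; set v := row k (vec_mx g).
have vN : v \notin step W k := coords_row_stepN k gW.
have Wk x : x \in step W k.+1 -> exists w l, w \in step W k /\ x = w + l *: v.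
  rewrite (coords_step gW)// => /mem_span_rows[c c0 ->]; rewrite mulmx_sum_row (bigD1 k)//=.
  exists (\sum_(i < 6 | i != k) c 0 i *: row i (vec_mx g)), (c 0 k); split;
    last by rewrite addrC.
  apply: memv_suml => i ik; have [ki|ki] := ltnP k i; first by rewrite c0// scale0r mem0v.
  rewrite memvZ//; apply: (coords_row_step gW); last exact/ltnW/ltn_ord.
  by rewrite ltn_neqAle ik ki.
have [w [l [wW SvE]]] := Wk _ (WS _ _ (coords_row_step gW (leqnn k.+1) (ltn_ord k))).
have [l0|l0] := eqVneq l 0; first by rewrite SvE l0 scale0r addr0.
have it m : exists w' l', [/\ w' \in step W k, l' != 0 & iter m S v = w' + l' *: v].
  elim: m => [|m [w' [l' [w'W l'0 E]]]].
    by exists 0, 1; rewrite mem0v oner_neq0 scale1r add0r.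
  exists (S w' + tau l' *: w), (tau l' * l); split.
  - by rewrite memvD ?memvZ//; exact: WS.
  - by rewrite mulf_neq0//; apply: contra l'0 => /eqP/ti->.
  - by rewrite iterS E semilinear_extD semilinear_extZ SvE scalerDr scalerA addrA.
have [w' [l' [w'W l'0]]] := it n; rewrite Sn => /esym/eqP; rewrite addrC addr_eq0 => /eqP E.
have : v \in step W k by rewrite -[v](scalerK l'0) E memvZ// memvN.
by rewrite (negPf vN).
Qed.

Lemma semilinear_span x (s : seq 'rV[F]_6) (U : {vspace 'rV[F]_6}) :
  (forall y, y \in s -> S y \in U) -> x \in <<s>>%VS -> S x \in U.
Proof.
have [_ _ t0 _ _] := tau_twist.
elim: s x => [|y s IHs] x sU.
  rewrite span_nil memv0 => /eqP->; rewrite -[0](scale0r 0) semilinear_extZ t0 scale0r.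
  exact: mem0v.
move=> /mem_span_cons[a [z [zs ->]]]; rewrite semilinear_extD semilinear_extZ memvD ?memvZ//.
  by apply: sU; rewrite mem_head.
by apply: IHs zs => t ts; apply: sU; rewrite in_cons ts orbT.
Qed.

End Twist.

Definition v6 (a1 a2 a3 a4 a5 a6 : F) : 'rV[F]_6 := row_of 6 [:: a1; a2; a3; a4; a5; a6].

Lemma v6P (x : 'rV[F]_6) : exists a1 a2 a3 a4 a5 a6, x = v6 a1 a2 a3 a4 a5 a6.
Proof.
exists (x 0 0), (x 0 1), (x 0 2), (x 0 3), (x 0 4), (x 0 5).
by apply/rowP => -[[|[|[|[|[|[|//]]]]]] k]; rewrite mxE /=; congr (x 0 _); exact/val_inj.
Qed.

Lemma v6_inj a1 a2 a3 a4 a5 a6 b1 b2 b3 b4 b5 b6 :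
  v6 a1 a2 a3 a4 a5 a6 = v6 b1 b2 b3 b4 b5 b6 ->
  [/\ a1 = b1, a2 = b2, a3 = b3 & [/\ a4 = b4, a5 = b5 & a6 = b6]].
Proof.
move=> /rowP h; have := h 0; have := h 1; have := h 2; have := h 3; have := h 4; have := h 5.
by rewrite !mxE /=.
Qed.

Lemma v6_0 : 0 = v6 0 0 0 0 0 0.
Proof. by apply/rowP => -[[|[|[|[|[|[|//]]]]]] k]; rewrite !mxE. Qed.

Lemma v6D a1 a2 a3 a4 a5 a6 b1 b2 b3 b4 b5 b6 :
  v6 a1 a2 a3 a4 a5 a6 + v6 b1 b2 b3 b4 b5 b6 =
  v6 (a1 + b1) (a2 + b2) (a3 + b3) (a4 + b4) (a5 + b5) (a6 + b6).
Proof. by apply/rowP => -[[|[|[|[|[|[|//]]]]]] k]; rewrite !mxE. Qed.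

Lemma v6Z k a1 a2 a3 a4 a5 a6 :
  k *: v6 a1 a2 a3 a4 a5 a6 = v6 (k * a1) (k * a2) (k * a3) (k * a4) (k * a5) (k * a6).
Proof. by apply/rowP => -[[|[|[|[|[|[|//]]]]]] h]; rewrite !mxE. Qed.

Lemma v6N a1 a2 a3 a4 a5 a6 :
  - v6 a1 a2 a3 a4 a5 a6 = v6 (- a1) (- a2) (- a3) (- a4) (- a5) (- a6).
Proof. by apply/rowP => -[[|[|[|[|[|[|//]]]]]] h]; rewrite !mxE. Qed.

Lemma v6_e : (e 1 = v6 1 0 0 0 0 0) * (e 2 = v6 0 1 0 0 0 0) * (e 3 = v6 0 0 1 0 0 0) *
  (e 4 = v6 0 0 0 1 0 0) * (e 5 = v6 0 0 0 0 1 0) * (e 6 = v6 0 0 0 0 0 1).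
Proof.
by do !split; apply/rowP => -[[|[|[|[|[|[|//]]]]]] k]; rewrite !mxE -!val_eqE /= ?inordK.
Qed.

Lemma pairing_v6 a1 a2 a3 a4 a5 a6 b1 b2 b3 b4 b5 b6 :
  <|v6 a1 a2 a3 a4 a5 a6, v6 b1 b2 b3 b4 b5 b6|> =
  a1 * b4 - a4 * b1 + (a2 * b5 - a5 * b2) + (a3 * b6 - a6 * b3).
Proof. by rewrite /pairing !big_ord_recl big_ord0 !mxE /=; ring. Qed.

Notation "x ^F" := (frob p x) (at level 2, format "x ^F").
Notation "x ^V" := (frob_inv p x) (at level 2, format "x ^V").

Lemma FmapE w a1 a2 a3 a4 a5 a6 : Fmap p w (v6 a1 a2 a3 a4 a5 a6) =
  match w with
  | s3 => v6 a3^F 0 0 0 a2^F a1^F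
  | s23 => v6 a2^F 0 0 0 a3^F a1^F
  | s323 => v6 a2^F a3^F 0 0 0 a1^F
  end.
Proof.
rewrite /Fmap /semilinear_ext !big_ord_recl big_ord0 !mxE /=.
by case: w; rewrite /= !v6_e !(v6Z, v6_0, v6D); congr v6; ring.
Qed.

Lemma VmapE w a1 a2 a3 a4 a5 a6 : Vmap p w (v6 a1 a2 a3 a4 a5 a6) =
  match w with
  | s3 => v6 0 0 0 (- a3^V) (- a2^V) a4^V
  | s23 => v6 0 0 0 (- a3^V) a4^V (- a2^V)
  | s323 => v6 0 0 0 (- a3^V) a4^V a5^V
  end.
Proof.
rewrite /Vmap /semilinear_ext !big_ord_recl big_ord0 !mxE /=.
by case: w; rewrite /= !v6_e !(v6N, v6Z, v6_0, v6D); congr v6; ring.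
Qed.

Lemma semilinear_ext_e tau (b : nat -> 'rV[F]_6) k : twist tau -> (0 < k <= 6)%N ->
  semilinear_ext tau b (e k) = b k.
Proof.
move=> [_ _ t0 t1 _] /andP[k0 k6]; have k5 : (k.-1 < 6)%N by rewrite prednK.
rewrite /semilinear_ext (bigD1 (Ordinal k5))//= big1 => [|i].
  by rewrite mxE -!val_eqE /= inordK// eqxx t1 scale1r addr0 prednK.
by rewrite -val_eqE /= mxE -!val_eqE /= inordK// => /negPf->; rewrite t0 scale0r.
Qed.

Lemma Fmap_e w k : (0 < k <= 6)%N -> Fmap p w (e k) = F_basis F w k.
Proof. exact/semilinear_ext_e/frob_twist. Qed.

Lemma Vmap_e w k : (0 < k <= 6)%N -> Vmap p w (e k) = V_basis F w k.
Proof. exact/semilinear_ext_e/frob_inv_twist. Qed.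

(** The exponent 4 comes from the longest chain, [e 3], [e 2], [e 1], [e 6], 0 for [s323]; for [V]
    it is [e 3], [e 4], [e 5], [e 6], 0 up to sign. *)
Lemma Fmap_nilpotent w x : iter 4 (@Fmap p F w) x = 0.
Proof.
have [_ _ f0 _ _] := frob_twist.
have [a1 [a2 [a3 [a4 [a5 [a6 ->]]]]]] := v6P x.
by case: w; rewrite /= !FmapE !f0 -v6_0.
Qed.

Lemma Vmap_nilpotent w x : iter 4 (@Vmap p F w) x = 0.
Proof.
have [_ _ f0 _ _] := frob_inv_twist.
have [a1 [a2 [a3 [a4 [a5 [a6 ->]]]]]] := v6P x.
by case: w; rewrite /= !VmapE !(f0, oppr0) -v6_0.
Qed.

(** The usual relation between [F], [V] and a polarization. It transfers stability under both maps
    from a subspace to its complement. *)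
Lemma Fmap_adjoint w x y : <|Fmap p w x, y|> = <|x, Vmap p w y|>^F.
Proof.
have [a1 [a2 [a3 [a4 [a5 [a6 ->]]]]]] := v6P x.
have [b1 [b2 [b3 [b4 [b5 [b6 ->]]]]]] := v6P y.
by case: w; rewrite FmapE VmapE !pairing_v6 !frobE !(rmorphD, rmorphN, rmorphM, rmorph0) /=
  -!frobE
  ?frob_invK; ring.
Qed.

(** The hypothesis concerns [W_1], [W_2], [W_3] only. For larger [i], [W_i] is the complement of
    some [W_k] with [k < 3], and stability passes to it by adjointness of [F] and [V]. *)
Lemma stable_flag w (W : flag_variety F 6) : symplectic W ->
  (forall k x, (k < 3)%N -> x \in step W k.+1 ->
     Fmap p w x \in step W k /\ Vmap p w x \in step W k) ->
  Flag_perp_FV p F w W.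
Proof.
move=> Ws WFV; split=> // i x; rewrite (_ : steps W i = step W i);
  last by rewrite /step inord_val.
have small k y : (k <= 3)%N -> y \in step W k -> Fmap p w y \in step W k /\ Vmap p w y \in step
  W k.
  case: k => [|k] k3 yk.
    have [F0 V0] := WFV 0%N y isT (subvP (step_sub W (leq0n 1) isT) y yk).
    by split.
  have k6 : (k.+1 <= 6)%N by rewrite (leq_trans k3).
  have /subvP sub := step_sub W (leqnSn k) k6.
  by have [Fy Vy] := WFV k y k3 yk; split; exact: sub.
have i6 : (i <= 6)%N by rewrite -ltnS.
have [i3|i3] := leqP i 3; first exact: small.
rewrite -(subKn i6) symplectic_step//; last exact: leq_subr.
move=> /mem_perp xi.
have s y : y \in step W (6 - i) -> Fmap p w y \in step W (6 - i) /\ Vmap p w y \in step W (6 -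
  i).
  by apply: small; lia.
have [_ _ f0 _ fi] := frob_twist.
split; apply/mem_perp => y yi; have [Fy Vy] := s _ yi.
  by rewrite Fmap_adjoint xi.
by apply: fi; rewrite pairingC frobE rmorphN /= -frobE -Fmap_adjoint pairingC xi// !oppr0.
Qed.

Lemma stable_flag_rows w (W : flag_variety F 6) g : Flag_perp_FV p F w W -> coords g W ->
  let c k := row k (vec_mx g) in
  [/\ symplectic W, isotropic3 (c 0) (c 1) (c 2) & [/\ Fmap p w (c 0) = 0, Vmap p w (c 0) = 0,
    exists k, Fmap p w (c 1) = k *: c 0, exists k, Vmap p w (c 1) = k *: c 0 &
    (exists k l, Fmap p w (c 2) = k *: c 0 + l *: c 1) /\
    (exists k l, Vmap p w (c 2) = k *: c 0 + l *: c 1)]].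
Proof.
move=> [Ws WFV] gW c; split=> //.
  apply: (symplectic_isotropic3 Ws); exact: (coords_row_step gW).
have Fc k : Fmap p w (c k) \in step W k.
  apply: (semilinear_nilpotent_row frob_twist (n := 4)) gW => [x|i x xi];
    first exact: Fmap_nilpotent.
  by case: (WFV i x xi).
have Vc k : Vmap p w (c k) \in step W k.
  apply: (semilinear_nilpotent_row frob_inv_twist (n := 4)) gW => [x|i x xi];
    first exact: Vmap_nilpotent.
  by case: (WFV i x xi).
have W0 : step W 0 = 0%VS by apply/eqP; rewrite -dimv_eq0 step_dim.
have W1 x : x \in step W 1 -> exists k, x = k *: c 0.
  move=> xW; apply: mem_span1; apply: subvP xW; rewrite (coords_step gW)//.
  apply: span_rows_sub => -[[|//] h] _; rewrite (_ : Ordinal h = 0); last exact/val_inj.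
  by in_span.
have W2 x : x \in step W 2 -> exists k l, x = k *: c 0 + l *: c 1.
  move=> xW; apply: mem_span2; apply: subvP xW; rewrite (coords_step gW)//.
  apply: span_rows_sub => -[[|[|//]] h] _.
    by rewrite (_ : Ordinal h = 0); [in_span|exact/val_inj].
  by rewrite (_ : Ordinal h = 1); [in_span|exact/val_inj].
split; [apply/eqP|apply/eqP|exact: W1|exact: W1|split; exact: W2];
  by rewrite -memv0 -W0.
Qed.

End FrobeniusMaps.

(** * Solving the stability equations for each label *)

Section Classification.
Variables (p : nat) (F : closedFieldType).
Hypothesis pcharFp : p \in [pchar F].
Notation e := (@e F).
Implicit Types (W : flag_variety F 6) (U : {vspace 'rV[F]_6}).
Local Notation "<| x , y |>" := (@pairing F x y) (at level 2, format "<| x ,  y |>").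
Local Notation "x ^F" := (frob p x) (at level 2, format "x ^F").
Local Notation "x ^V" := (frob_inv p x) (at level 2, format "x ^V").
Local Notation fam_blowup := (fam_6_145_5 F `|` fam_line (e 6) (e 5) (e 1) (e 4)).

Local Ltac e_pairings := rewrite ?pairingE !pairing_e //=;
  first [ring | by apply: (eq_neq0 (oner_neq0 F)); ring | by apply: (eqN_neq0 (oner_neq0 F));
    ring].
Local Ltac e_adapted := split; [split|..|split]; e_pairings.

Lemma adapted_6125 : adapted (e 6) (e 1) (e 2) (e 5) (e 4) (e 3).
Proof. e_adapted. Qed.

Lemma adapted_5436 : adapted (e 5) (e 4) (e 3) (e 6) (e 1) (e 2).
Proof. e_adapted. Qed.

Lemma frame_546 : lagrangian_frame (e 5) (e 4) (e 6) (e 2) (- e 1) (- e 3).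
Proof. split; [split|split|..]; e_pairings. Qed.

Lemma frame_615 : lagrangian_frame (e 6) (e 1) (e 5) (e 3) (e 4) (- e 2).
Proof. split; [split|split|..]; e_pairings. Qed.

Section Stable.
Variables (w : EOlabel) (W : flag_variety F 6).
Let stable x U := Fmap p w x \in U /\ Vmap p w x \in U.

Lemma stable_span (s : seq 'rV[F]_6) U x :
  (forall y, y \in s -> stable y U) -> x \in <<s>>%VS -> stable x U.
Proof.
move=> sU xs; split.
  by apply: (semilinear_span (frob_twist pcharFp) (b := F_basis F w) _ xs) => y /sU[].
by apply: (semilinear_span (frob_inv_twist pcharFp) (b := V_basis F w) _ xs) => y /sU[].
Qed.

(** Whatever [W_3] is, it lies in the complement of [W_2], spanned by [u1], [u2], [v], [z]. Checking
    these four vectors therefore treats all members of the pencil at once. *)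
Lemma stable_fam_line u1 u2 v z u2' u1' : adapted u1 u2 v z u2' u1' ->
  stable u1 0 -> stable u2 <<[:: u1]>> -> stable v <<[:: u1; u2]>> -> stable z <<[:: u1;
    u2]>> ->
  fam_line u1 u2 v z W -> Flag_perp_FV p F w W.
Proof.
move=> ad S1 S2 Sv Sz /(fam_lineP ad)[Ws W1 W2].
have W1E := step_span (k := 1) (s := [:: u1]) isT isT W1.
have W2E := step_span (k := 2) (s := [:: u1; u2]) isT isT W2.
have S0 U x : stable x 0 -> stable x U.
  by move=> [Fx Vx]; split; apply: subvP (sub0v U) _ _.
have W3 : (step W 3 <= <<[:: u1; u2; v; z]>>)%VS.
  rewrite -(perp_frame ad) -W2E -(symplectic_step Ws)//; exact: step_sub.
have sub12 : (<<[:: u1]>> <= <<[:: u1; u2]>>)%VS by apply/span_subvP => x;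
  rewrite inE => /eqP->; in_span.
apply: (stable_flag pcharFp Ws) => -[|[|[|//]]] x _ xW.
- rewrite (_ : step W 0 = 0%VS); last by apply/eqP; rewrite -dimv_eq0 step_dim.
  by move: xW; rewrite W1E; apply: stable_span => y; rewrite inE => /eqP->.
- rewrite W1E; move: xW; rewrite W2E; apply: stable_span => y; rewrite !inE => /orP[]/eqP->//.
  exact: S0.
- rewrite W2E; apply: stable_span (subvP W3 x xW) => y; rewrite !inE => /or4P[]/eqP->//.
    exact: S0.
  by case: S2 => Fx Vx; split; exact: (subvP sub12).
Qed.

(** Made for the families in which [W_2] moves: if all of [W_3] is mapped into [W_1], the choice of
    [W_2] between them imposes no condition. *)
Lemma stable_step3 u (s : seq 'rV[F]_6) : symplectic W ->
  (step W 1 <= <<[:: u]>>)%VS -> (step W 3 <= <<s>>)%VS ->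
  stable u 0 -> (forall y, y \in s -> stable y <<[:: u]>>) -> Flag_perp_FV p F w W.
Proof.
move=> Ws W1 W3 Su Ss; have W1E := step_span (k := 1) (s := [:: u]) isT isT W1.
have S3 x : x \in step W 3 -> stable x (step W 1).
  by move=> xW; rewrite W1E; exact: stable_span (subvP W3 x xW).
apply: (stable_flag pcharFp Ws) => -[|[|[|//]]] x _ xW.
- rewrite (_ : step W 0 = 0%VS); last by apply/eqP; rewrite -dimv_eq0 step_dim.
  by move: xW; rewrite W1E; apply: stable_span => y; rewrite inE => /eqP->.
- by apply: S3; apply: subvP xW; exact: step_sub.
- by have [Fx Vx] := S3 x xW; split; [apply: subvP Fx|apply: subvP Vx]; exact: step_sub.
Qed.

Lemma stable_fam_56_14 : stable (e 5) 0 -> stable (e 6) 0 ->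
  stable (e 1) <<[:: e 5; e 6]>> -> stable (e 4) <<[:: e 5; e 6]>> ->
  fam_56_14 F W -> Flag_perp_FV p F w W.
Proof.
move=> S5 S6 S1 S4 /fam_56_14P[Ws W2].
have W2E := step_span (k := 2) (s := [:: e 5; e 6]) isT isT W2.
have S0 U x : stable x 0 -> stable x U.
  by move=> [Fx Vx]; split; apply: subvP (sub0v U) _ _.
have W3 : (step W 3 <= <<[:: e 5; e 6; e 1; e 4]>>)%VS.
  rewrite -perp_e56 -W2E -(symplectic_step Ws)//; exact: step_sub.
have S2 x : x \in step W 2 -> stable x 0.
  by rewrite W2E; apply: stable_span => y; rewrite !inE => /orP[]/eqP->.
apply: (stable_flag pcharFp Ws) => -[|[|[|//]]] x _ xW.
- by apply/S0/S2; apply: subvP xW; exact: step_sub.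
- exact/S0/S2.
- rewrite W2E; apply: stable_span (subvP W3 x xW) => y; rewrite !inE => /or4P[]/eqP->//;
    exact: S0.
Qed.

End Stable.

Local Ltac e_stable := rewrite ?(Fmap_e pcharFp) ?(Vmap_e pcharFp) //=; split;
  rewrite ?mem0v ?memvN //; in_span.

Lemma step1_sub W g U : coords g W -> row 0 (vec_mx g) \in U -> (step W 1 <= U)%VS.
Proof.
move=> gW r0; rewrite (coords_step gW)//; apply: span_rows_sub => -[[|//] h] _.
by rewrite (_ : Ordinal h = 0)//; exact/val_inj.
Qed.

Lemma step2_sub W g U : coords g W -> row 0 (vec_mx g) \in U -> row 1 (vec_mx g) \in U ->
  (step W 2 <= U)%VS.
Proof.
move=> gW r0 r1; rewrite (coords_step gW)//; apply: span_rows_sub => -[[|[|//]] h] _.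
  by rewrite (_ : Ordinal h = 0)//; exact/val_inj.
by rewrite (_ : Ordinal h = 1)//; exact/val_inj.
Qed.

Lemma step3_sub W g U : coords g W -> row 0 (vec_mx g) \in U -> row 1 (vec_mx g) \in U ->
  row 2 (vec_mx g) \in U -> (step W 3 <= U)%VS.
Proof.
move=> gW r0 r1 r2; rewrite (coords_step gW)//; apply: span_rows_sub => -[[|[|[|//]]] h] _.
- by rewrite (_ : Ordinal h = 0)//; exact/val_inj.
- by rewrite (_ : Ordinal h = 1)//; exact/val_inj.
- by rewrite (_ : Ordinal h = 2)//; exact/val_inj.
Qed.

Lemma frob_eq0 (x : F) : x^F = 0 -> x = 0.
Proof. by have [_ _ _ _] := frob_twist pcharFp; apply. Qed.

Lemma frob_inv_eq0 (x : F) : x^V = 0 -> x = 0.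
Proof. by have [_ _ _ _] := frob_inv_twist pcharFp; apply. Qed.

Lemma mulf_eq0l (a b : F) : b != 0 -> a * b = 0 -> a = 0.
Proof. by move=> b0 /eqP; rewrite mulf_eq0 (negPf b0) orbF => /eqP. Qed.

Lemma mulf_eq0r (a b : F) : a != 0 -> a * b = 0 -> b = 0.
Proof. by rewrite mulrC; exact: mulf_eq0l. Qed.

Lemma mem_span1E (u x : 'rV[F]_6) a : x = a *: u -> x \in <<[:: u]>>%VS.
Proof. by move=> ->; rewrite memvZ//; in_span. Qed.

Lemma mem_span4E (u v w z x : 'rV[F]_6) a b c d :
  x = a *: u + b *: v + c *: w + d *: z -> x \in <<[:: u; v; w; z]>>%VS.
Proof. by move=> ->; rewrite !memvD// memvZ//; in_span. Qed.

Local Ltac v6_eq := rewrite !v6_e !(v6Z, v6D); congr v6; ring.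

Lemma frob0 : (0 : F)^F = 0.
Proof. by have [_ _ -> _ _] := frob_twist pcharFp. Qed.

Lemma frob_inv0 : (0 : F)^V = 0.
Proof. by have [_ _ -> _ _] := frob_inv_twist pcharFp. Qed.

Lemma Flag_s3 W : Flag_perp_FV p F s3 W <-> fam_56_14 F W \/ fam_blowup W.
Proof.
split=> [WFV|[|/blowup_famP[Ws W1 W3]]]; last 2 first.
- by apply: stable_fam_56_14; e_stable.
- apply: (stable_step3 Ws W1 W3); first by e_stable.
  by move=> y; rewrite !inE => /or4P[]/eqP->; e_stable.
have [g gW] := coords_ex W.
have [Ws [i01 i02 _] [F0 V0 [k F1] [k' V1] [[l [m F2]] _]]] := stable_flag_rows pcharFp WFV gW.
have n0 := coords_row_stepN 0 gW.
have [a1 [a2 [a3 [a4 [a5 [a6 E0]]]]]] := v6P (row 0 (vec_mx g)).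
have [b1 [b2 [b3 [b4 [b5 [b6 E1]]]]]] := v6P (row 1 (vec_mx g)).
have [d1 [d2 [d3 [d4 [d5 [d6 E2]]]]]] := v6P (row 2 (vec_mx g)).
rewrite E0 E1 E2 in F0 V0 F1 V1 F2 i01 i02 n0.
(* The first row is killed by [F] and [V], hence lies in the span of [e 5] and [e 6]. *)
move: F0; rewrite FmapE v6_0 => /v6_inj[/frob_eq0 a30 _ _ [_ /frob_eq0 a20 /frob_eq0 a10]].
move: V0; rewrite VmapE v6_0 => /v6_inj[_ _ _ [_ _ /frob_inv_eq0 a40]].
move: F1; rewrite FmapE v6Z => /v6_inj[b3E _ _ [_ b2E b1E]].
move: V1; rewrite VmapE v6Z => /v6_inj[_ _ _ [_ b2E' b4E]].
move: F2; rewrite FmapE !v6Z v6D => /v6_inj[d3E _ _ [b4m d2E _]].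
rewrite !pairing_v6 in i01 i02; subst a1 a2 a3 a4.
have b30 : b3 = 0 by apply: frob_eq0; rewrite b3E mulr0.
subst b3.
have {}i01 : a5 * b2 = 0 by rewrite -[RHS]oppr0 -i01; ring.
have XP : b1 = 0 -> b2 = 0 -> b4 = 0 -> fam_56_14 F W.
  move=> b10 b20 b40; subst; apply/fam_56_14P; split=> //; apply: (step2_sub gW).
    by rewrite E0; apply: (@mem_span2E _ _ _ _ a5 a6); v6_eq.
  by rewrite E1; apply: (@mem_span2E _ _ _ _ b5 b6); v6_eq.
(* If [a5] is nonzero, isotropy kills [b2]; then the [e 5]-coefficients of [F c_1 = k c_0] and
   [V c_1 = k' c_0] give [k = k' = 0], so [b1] and [b4] vanish and [W_2] is spanned by [e 5] and
   [e 6]. *)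
have [a50|a50] := eqVneq a5 0; last first.
  left; have b20 := mulf_eq0r a50 i01; subst b2.
  have k0 : k = 0 by apply: (mulf_eq0l a50); rewrite -b2E frob0.
  have k'0 : k' = 0 by apply: (mulf_eq0l a50); rewrite -b2E' frob_inv0 oppr0.
  apply: XP => //; first by apply: frob_eq0; rewrite b1E k0 mul0r.
  by apply: frob_inv_eq0; rewrite b4E k'0 mul0r.
subst a5; have a60 : a6 != 0.
  by apply: contraNneq n0 => ->; rewrite -v6_0 mem0v.
have b20 : b2 = 0 by apply: frob_eq0; rewrite b2E mulr0.
have d30 : d3 = 0 by apply: (mulf_eq0r a60); rewrite -[RHS]oppr0 -i02; ring.
subst b2 d3; rewrite mulr0 add0r in d2E; rewrite frob0 mulr0 add0r in d3E.
rewrite mulr0 add0r in b4m.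
(* In [F c_2 = l c_0 + m c_1] a nonzero [d2] forces [m] to be nonzero, and then the coefficients on
   [e 1] and [e 4] kill [b1] and [b4]. With [d2 = 0] no row involves [e 2] or [e 3], which is the
   blown-up plane. *)
have [d20|d20] := eqVneq d2 0; last first.
  have m0 : m != 0.
    by apply: contraNneq d20 => m0; apply/eqP/frob_eq0; rewrite d2E m0 mul0r.
  by left; apply: XP => //; apply: (mulf_eq0r m0).
subst d2; right; apply/blowup_famP; split=> //.
  by apply: (step1_sub gW); rewrite E0; apply: (@mem_span1E _ _ a6); v6_eq.
apply: (step3_sub gW).
- by rewrite E0; apply: (@mem_span4E _ _ _ _ _ a6 0 0 0); v6_eq.
- by rewrite E1; apply: (@mem_span4E _ _ _ _ _ b6 b5 b1 b4); v6_eq.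
- by rewrite E2; apply: (@mem_span4E _ _ _ _ _ d6 d5 d1 d4); v6_eq.
Qed.

Lemma Flag_s23 W : Flag_perp_FV p F s23 W <->
  [\/ fam_56_14 F W, fam_gl2 (e 5) (e 4) (e 6) W, fam_gl2 (e 6) (e 1) (e 5) W |
      fam_line (e 6) (e 1) (e 2) (e 5) W \/ fam_line (e 5) (e 4) (e 3) (e 6) W].
Proof.
split=> [WFV|[|/(fam_gl2P frame_546)[Ws W1 W3]|/(fam_gl2P frame_615)[Ws W1 W3]|[]]];
  last 5 first.
- by apply: stable_fam_56_14; e_stable.
- apply: (stable_step3 Ws W1 W3); first by e_stable.
  by move=> y; rewrite !inE => /or3P[]/eqP->; e_stable.
- apply: (stable_step3 Ws W1 W3); first by e_stable.
  by move=> y; rewrite !inE => /or3P[]/eqP->; e_stable.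
- by apply: (stable_fam_line adapted_6125); e_stable.
- by apply: (stable_fam_line adapted_5436); e_stable.
have [g gW] := coords_ex W.
have [Ws [i01 i02 i12] [F0 V0 [k F1] [k' V1] [[l [m F2]] [l' [m' V2]]]]] :=
  stable_flag_rows pcharFp WFV gW.
have n0 := coords_row_stepN 0 gW.
have [a1 [a2 [a3 [a4 [a5 [a6 E0]]]]]] := v6P (row 0 (vec_mx g)).
have [b1 [b2 [b3 [b4 [b5 [b6 E1]]]]]] := v6P (row 1 (vec_mx g)).
have [d1 [d2 [d3 [d4 [d5 [d6 E2]]]]]] := v6P (row 2 (vec_mx g)).
rewrite E0 E1 E2 in F0 V0 F1 V1 F2 V2 i01 i02 i12 n0.
move: F0; rewrite FmapE v6_0 => /v6_inj[/frob_eq0 a20 _ _ [_ /frob_eq0 a30 /frob_eq0 a10]].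
move: V0; rewrite VmapE v6_0 => /v6_inj[_ _ _ [_ /frob_inv_eq0 a40 _]].
move: F1; rewrite FmapE v6Z => /v6_inj[b2E _ _ [_ b3E b1E]].
move: V1; rewrite VmapE v6Z => /v6_inj[_ _ _ [b3E' b4E b2E']].
move: F2; rewrite FmapE !v6Z v6D => /v6_inj[d2E _ _ [_ d3E _]].
move: V2; rewrite VmapE !v6Z v6D => /v6_inj[_ _ _ [d3E' _ d2E']].
rewrite !pairing_v6 in i01 i02 i12; subst a1 a2 a3 a4.
have b20 : b2 = 0 by apply: frob_eq0; rewrite b2E mulr0.
have b30 : b3 = 0 by apply: frob_inv_eq0; apply: oppr_inj; rewrite b3E' mulr0 oppr0.
subst b2 b3; rewrite mulr0 add0r in d2E; rewrite mulr0 add0r in d3E'.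
rewrite frob0 in b3E; rewrite frob_inv0 oppr0 in b2E'.
have XP : b1 = 0 -> b4 = 0 -> fam_56_14 F W.
  move=> b10 b40; subst; apply/fam_56_14P; split=> //; apply: (step2_sub gW).
    by rewrite E0; apply: (@mem_span2E _ _ _ _ a5 a6); v6_eq.
  by rewrite E1; apply: (@mem_span2E _ _ _ _ b5 b6); v6_eq.
have [a50|a50] := eqVneq a5 0.
  subst a5; have a60 : a6 != 0.
    by apply: contraNneq n0 => ->; rewrite -v6_0 mem0v.
  have b40 : b4 = 0 by apply: frob_inv_eq0; rewrite b4E mulr0.
  have d30 : d3 = 0 by apply: (mulf_eq0r a60); rewrite -[RHS]oppr0 -i02; ring.
  subst b4 d3; have [b10|b10] := eqVneq b1 0; first by constructor 1; exact: XP.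
  have {}i12 : b1 * d4 = b5 * d2 by apply/eqP; rewrite -subr_eq0 -[X in _ == X]i12; apply/eqP;
    ring.
  rewrite frob0 mulr0 add0r in d3E.
  have W1 : (step W 1 <= <<[:: e 6]>>)%VS.
    by apply: (step1_sub gW); rewrite E0; apply: (@mem_span1E _ _ a6); v6_eq.
  (* Now [W_1] is spanned by [e 6] and [b1] is nonzero. Either [W_2] is spanned by [e 6] and [e 1],
     or the [e 5]-coefficient of [F c_2] gives [m = 0], hence [d2 = 0] and, by isotropy, [d4 = 0]:
     then [W_3] is fixed. *)
  have [b50|b50] := eqVneq b5 0.
    subst b5; constructor 4; left; apply/(fam_lineP adapted_6125); split=> //.
    apply: (step2_sub gW).
      by rewrite E0; apply: (@mem_span2E _ _ _ _ a6 0); v6_eq.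
    by rewrite E1; apply: (@mem_span2E _ _ _ _ b6 b1); v6_eq.
  have m0 : m = 0 by apply: (mulf_eq0l b50).
  have d20 : d2 = 0 by apply: frob_eq0; rewrite d2E m0 mul0r.
  have d40 : d4 = 0 by apply: (mulf_eq0r b10); rewrite i12 d20 mulr0.
  subst d2 d4; constructor 3; apply/(fam_gl2P frame_615); split=> //; apply: (step3_sub gW).
  - by rewrite E0; apply: (@mem_span3E _ _ _ _ _ a6 0 0); v6_eq.
  - by rewrite E1; apply: (@mem_span3E _ _ _ _ _ b6 b1 b5); v6_eq.
  - by rewrite E2; apply: (@mem_span3E _ _ _ _ _ d6 d1 d5); v6_eq.
have k0 : k = 0 by apply: (mulf_eq0l a50).
have b10 : b1 = 0 by apply: frob_eq0; rewrite b1E k0 mul0r.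
have [b40|b40] := eqVneq b4 0; first by constructor 1; exact: XP.
(* Otherwise the [e 6]-coefficient of [V c_1 = k' c_0] would give [k' = 0] and thus [b4 = 0]. So
   [W_1] is spanned by [e 5], and the rest mirrors the previous case with [V] in the role of [F]. *)
have a60 : a6 = 0.
  apply/eqP/negPn/negP => a60; have k'0 : k' = 0 by apply: (mulf_eq0l a60).
  by move/eqP: b40; apply; apply: frob_inv_eq0; rewrite b4E k'0 mul0r.
subst b1 a6.
have d20 : d2 = 0 by apply: (mulf_eq0r a50); rewrite -[RHS]oppr0 -i02; ring.
subst d2; rewrite frob_inv0 oppr0 mulr0 add0r in d2E'.
have {}i12 : b4 * d1 = - b6 * d3.
  by apply/eqP; rewrite -subr_eq0 -oppr_eq0 -[X in _ == X]i12; apply/eqP; ring.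
have W1 : (step W 1 <= <<[:: e 5]>>)%VS.
  by apply: (step1_sub gW); rewrite E0; apply: (@mem_span1E _ _ a5); v6_eq.
have [b60|b60] := eqVneq b6 0.
  subst b6; constructor 4; right; apply/(fam_lineP adapted_5436); split=> //.
  apply: (step2_sub gW).
    by rewrite E0; apply: (@mem_span2E _ _ _ _ a5 0); v6_eq.
  by rewrite E1; apply: (@mem_span2E _ _ _ _ b5 b4); v6_eq.
have m'0 : m' = 0 by apply: (mulf_eq0l b60).
have d30 : d3 = 0 by apply: frob_inv_eq0; apply: oppr_inj; rewrite d3E' m'0 mul0r oppr0.
have d10 : d1 = 0 by apply: (mulf_eq0r b40); rewrite i12 d30 mulr0.
subst d1 d3; constructor 2; apply/(fam_gl2P frame_546); split=> //; apply: (step3_sub gW).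
- by rewrite E0; apply: (@mem_span3E _ _ _ _ _ a5 0 0); v6_eq.
- by rewrite E1; apply: (@mem_span3E _ _ _ _ _ b5 b4 b6); v6_eq.
- by rewrite E2; apply: (@mem_span3E _ _ _ _ _ d5 d4 d6); v6_eq.
Qed.

Lemma Flag_s323 W : Flag_perp_FV p F s323 W <->
  [\/ fam_line (e 6) (e 1) (e 2) (e 5) W, fam_line (e 6) (e 5) (e 1) (e 4) W |
      fam_gl2 (e 6) (e 1) (e 5) W].
Proof.
split=> [WFV|[| |/(fam_gl2P frame_615)[Ws W1 W3]]]; last 3 first.
- by apply: (stable_fam_line adapted_6125); e_stable.
- by apply: (stable_fam_line (@adapted_6514 F)); e_stable.
- apply: (stable_step3 Ws W1 W3); first by e_stable.
  by move=> y; rewrite !inE => /or3P[]/eqP->; e_stable.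
have [g gW] := coords_ex W.
have [Ws [i01 i02 i12] [F0 V0 [k F1] [k' V1] [[l [m F2]] [l' [m' V2]]]]] :=
  stable_flag_rows pcharFp WFV gW.
have n0 := coords_row_stepN 0 gW.
have [a1 [a2 [a3 [a4 [a5 [a6 E0]]]]]] := v6P (row 0 (vec_mx g)).
have [b1 [b2 [b3 [b4 [b5 [b6 E1]]]]]] := v6P (row 1 (vec_mx g)).
have [d1 [d2 [d3 [d4 [d5 [d6 E2]]]]]] := v6P (row 2 (vec_mx g)).
rewrite E0 E1 E2 in F0 V0 F1 V1 F2 V2 i01 i02 i12 n0.
move: F0; rewrite FmapE v6_0 => /v6_inj[/frob_eq0 a20 /frob_eq0 a30 _ [_ _ /frob_eq0 a10]].
move: V0; rewrite VmapE v6_0 => /v6_inj[_ _ _ [_ /frob_inv_eq0 a40 /frob_inv_eq0 a50]].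
move: F1; rewrite FmapE v6Z => /v6_inj[b2E b3E _ [_ _ _]].
move: V1; rewrite VmapE v6Z => /v6_inj[_ _ _ [_ b4E _]].
move: F2; rewrite FmapE !v6Z v6D => /v6_inj[d2E _ _ [_ b5m _]].
move: V2; rewrite VmapE !v6Z v6D => /v6_inj[b1m' _ _ [_ d4E _]].
rewrite !pairing_v6 in i01 i02 i12; subst a1 a2 a3 a4 a5.
have b20 : b2 = 0 by apply: frob_eq0; rewrite b2E mulr0.
have b30 : b3 = 0 by apply: frob_eq0; rewrite b3E mulr0.
have b40 : b4 = 0 by apply: frob_inv_eq0; rewrite b4E mulr0.
have a60 : a6 != 0.
  by apply: contraNneq n0 => ->; rewrite -v6_0 mem0v.
have d30 : d3 = 0 by apply: (mulf_eq0r a60); rewrite -[RHS]oppr0 -i02; ring.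
subst b2 b3 b4 d3; rewrite mulr0 add0r in d2E; rewrite mulr0 add0r in b5m.
rewrite mulr0 add0r in b1m'; rewrite mulr0 add0r in d4E.
have W1 : (step W 1 <= <<[:: e 6]>>)%VS.
  by apply: (step1_sub gW); rewrite E0; apply: (@mem_span1E _ _ a6); v6_eq.
(* Here [W_1] is spanned by [e 6] and [c_1] only adds [e 1] and [e 5]. If [b1] or [b5] vanishes,
   [W_2] is fixed. If neither does, the [e 5]-coefficient of [F c_2] and the [e 1]-coefficient of
   [V c_2] give [m = m' = 0], so [d2] and [d4] vanish and [W_3] is fixed. *)
have [b10|b10] := eqVneq b1 0.
  subst b1; constructor 2; apply/(fam_lineP (@adapted_6514 F)); split=> //.
  apply: (step2_sub gW).
    by rewrite E0; apply: (@mem_span2E _ _ _ _ a6 0); v6_eq.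
  by rewrite E1; apply: (@mem_span2E _ _ _ _ b6 b5); v6_eq.
have [b50|b50] := eqVneq b5 0.
  subst b5; constructor 1; apply/(fam_lineP adapted_6125); split=> //.
  apply: (step2_sub gW).
    by rewrite E0; apply: (@mem_span2E _ _ _ _ a6 0); v6_eq.
  by rewrite E1; apply: (@mem_span2E _ _ _ _ b6 b1); v6_eq.
have m0 : m = 0 by apply: (mulf_eq0l b50).
have d20 : d2 = 0 by apply: frob_eq0; rewrite d2E m0 mul0r.
have m'0 : m' = 0 by apply: (mulf_eq0l b10).
have d40 : d4 = 0 by apply: frob_inv_eq0; rewrite d4E m'0 mul0r.
subst d2 d4; constructor 3; apply/(fam_gl2P frame_615); split=> //; apply: (step3_sub gW).
- by rewrite E0; apply: (@mem_span3E _ _ _ _ _ a6 0 0); v6_eq.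
- by rewrite E1; apply: (@mem_span3E _ _ _ _ _ b6 b1 b5); v6_eq.
- by rewrite E2; apply: (@mem_span3E _ _ _ _ _ d6 d1 d5); v6_eq.
Qed.

End Classification.

(** * Components, intersections and dimensions *)

Section Separation.
Variable F : closedFieldType.
Notation e := (@e F).
Implicit Types (W : flag_variety F 6).
Local Notation "<| x , y |>" := (@pairing F x y) (at level 2, format "<| x ,  y |>").
Local Notation X := (fam_56_14 F).
Local Notation Y := (fam_6_145_5 F `|` fam_line (e 6) (e 5) (e 1) (e 4)).
Local Notation Y1 := (fam_gl2 (e 5) (e 4) (e 6)).
Local Notation Y2 := (fam_gl2 (e 6) (e 1) (e 5)).
Local Notation Z1 := (fam_line (e 6) (e 1) (e 2) (e 5)).
Local Notation Z2 := (fam_line (e 5) (e 4) (e 3) (e 6)).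
Local Notation L := (fam_line (e 6) (e 5) (e 1) (e 4)).

Lemma step_notin W k (s : seq 'rV[F]_6) c t : (step W k <= <<s>>)%VS -> c \in step W k ->
  (forall u, u \in s -> <|u, t|> = 0) -> <|c, t|> <> 0 -> False.
Proof.
move=> Ws cW st ct; apply: ct; have := subvP Ws c cW.
elim: s st {Ws cW} c => [|u s IHs] st c.
  by rewrite span_nil memv0 => /eqP->; rewrite pairing0l.
move=> /mem_span_cons[a [y [ys ->]]]; rewrite !pairingE st ?mem_head// mulr0 add0r.
by apply: IHs => // v vs; apply: st; rewrite in_cons vs orbT.
Qed.

Local Ltac e_neq0 := first [by apply: (eq_neq0 (oner_neq0 F)); ring
                           |by apply: (eqN_neq0 (oner_neq0 F)); ring].
(* t is orthogonal to the subspace containing a step of the flag by h, but not to c. *)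
Local Ltac separate h c t WE := exfalso; apply: (@step_notin _ _ _ c t h);
  [rewrite (step_Phi WE) //=; in_span
  |let u := fresh "u" in let us := fresh "us" in
   move=> u us; rewrite !inE in us; repeat (case/orP: us => us); move/eqP: us => ->;
   rewrite ?pairingE !pairing_e //=; ring
  |apply/eqP; rewrite ?pairingE !pairing_e //=; e_neq0].

(** A general point of the product surface: its [W_1] is spanned neither by [e 5] nor by [e 6],
    which are the only possibilities in the other families. *)
Lemma flag_X_ex : exists W, X W /\ steps W = Phi (e 5 + e 6) (e 6) (e 1).
Proof.
have ad : adapted (e 5 + e 6) (e 6) (e 1) (e 4) (e 2 - e 3) (e 2).
  by split; [split|..|split]; rewrite ?pairingE !pairing_e //=; first [ring|e_neq0].
have [W [_ WE]] := frame_flag ad; exists W; split=> //; exists 1, 0, 1, 1, 1, 0; split.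
- by rewrite /gl2 mulr1 mul0r subr0 oner_neq0.
- by rewrite xpair_eqE oner_eq0.
- by rewrite WE !scale1r !scale0r add0r addr0.
Qed.

Lemma flag_line_ex u1 u2 v w u2' u1' : adapted u1 u2 v w u2' u1' ->
  exists W, [/\ fam_line u1 u2 v w W & steps W = Phi u1 u2 v].
Proof.
move=> ad; have [W [_ WE]] := frame_flag ad; exists W; split=> //; exists 1, 0; split.
  by rewrite xpair_eqE oner_eq0.
by rewrite WE scale1r scale0r addr0.
Qed.

(** The combination [v + w] keeps [W_2] away from the two special positions spanned by [u] with [v]
    or with [w], where the pencil may meet other families. *)
Lemma flag_gl2_ex u v w u' v' w' : lagrangian_frame u v w u' v' w' ->
  exists W, [/\ fam_gl2 u v w W & steps W = Phi u (v + w) w].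
Proof.
move=> lf; have := adapted_gl2 lf (x := row_of 2 [:: 1; 1]) (i := 0).
rewrite !mxE /= !scale1r => /(_ (oner_neq0 F))/frame_flag[W [_ WE]]; exists W; split=> //.
exists 1, 0, 1, 1; split; first by rewrite /gl2 mulr1 mul0r subr0 oner_neq0.
by rewrite WE !scale1r !scale0r add0r.
Qed.

(** A point of each member lying in no other member shows both that the list has no repetition and
    that no member contains another. *)
Lemma components_of_witnesses (V : set (flag_variety F 6)) (s : seq (set (flag_variety F 6)))
    (wit : nat -> flag_variety F 6) :
  (forall C, C \in s -> closed C) -> (forall C, C \in s -> irreducible C) ->
  V = [set W | exists2 C, C \in s & C W] ->
  (forall i, (i < size s)%N -> nth set0 s i (wit i)) ->
  (forall i j, (i < size s)%N -> (j < size s)%N -> nth set0 s j (wit i) -> i = j) ->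
  irr_components_are V s.
Proof.
move=> scl sirr VE wi wij; apply: irr_components_areP => //.
  apply/(uniqP set0) => i j; rewrite !inE => si sj E; apply: (wij i j) => //.
  by rewrite -E; exact: wi.
move=> C D /(nthP set0)[i si <-] /(nthP set0)[j sj <-] /(_ _ (wi i si))/(wij i j si sj) ->.
by [].
Qed.

Lemma one_point_Phi (V : set (flag_variety F 6)) c1 c2 c3 r3 r4 r5 :
  adapted c1 c2 c3 r3 r4 r5 ->
  (forall W, V W <-> [/\ symplectic W, (step W 1 <= <<[:: c1]>>)%VS,
     (step W 2 <= <<[:: c1; c2]>>)%VS & (step W 3 <= <<[:: c1; c2; c3]>>)%VS]) ->
  one_point V.
Proof.
move=> ad VE; have [W0 [_ W0E]] := frame_flag ad; exists W0.
apply/seteqP; split=> W /= => [/VE[Ws W1 W2 W3]|->].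
  by apply: flag_eq; rewrite W0E; exact: PhiP.
apply/VE; have [[r01 r02 _ _] r12 _ _] := ad.
by rewrite !(step_Phi W0E)//; split=> //; apply: Phi_symplectic W0E _; split.
Qed.

Lemma sub_spans (s t : seq 'rV[F]_6) : {subset s <= t} -> (<<s>> <= <<t>>)%VS.
Proof. by move=> st; apply/span_subvP => x /st; exact: memv_span. Qed.

Lemma step_sub_trans W k s t : {subset s <= t} -> (step W k <= <<s>>)%VS -> (step W k <=
  <<t>>)%VS.
Proof. by move=> st Ws; exact: subv_trans Ws (sub_spans st). Qed.

Local Ltac e_adapted := split; [split|..|split]; rewrite !pairing_e //=; first [ring|e_neq0].
Local Ltac sub_list := let u := fresh "u" in let us := fresh "us" in
  move=> u us; rewrite !inE in us *; repeat (case/orP: us => us); rewrite us ?orbT //.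

Lemma Y1_X_point : one_point (Y1 `&` X).
Proof.
apply: (@one_point_Phi _ (e 5) (e 6) (e 4) (e 1) (e 3) (e 2)); first by e_adapted.
move=> W; split=> [[/(fam_gl2P (frame_546 F))[Ws W1 W3] /fam_56_14P[_ W2]]|[Ws W1 W2 W3]].
  by split=> //; apply: step_sub_trans W3; sub_list.
by split; [apply/(fam_gl2P (frame_546 F))|apply/fam_56_14P]; split=> //;
  apply: step_sub_trans W3; sub_list.
Qed.

Lemma Y2_X_point : one_point (Y2 `&` X).
Proof.
apply: (@one_point_Phi _ (e 6) (e 5) (e 1) (e 4) (e 2) (e 3)); first by e_adapted.
move=> W; split=> [[/(fam_gl2P (frame_615 F))[Ws W1 W3] /fam_56_14P[_ W2]]|[Ws W1 W2 W3]].
  by split=> //; [apply: step_sub_trans W2|apply: step_sub_trans W3]; sub_list.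
by split; [apply/(fam_gl2P (frame_615 F))|apply/fam_56_14P]; split=> //;
  [apply: step_sub_trans W3|apply: step_sub_trans W2]; sub_list.
Qed.

Lemma Y1_Z2_point : one_point (Y1 `&` Z2).
Proof.
apply: (@one_point_Phi _ (e 5) (e 4) (e 6) (e 3) (e 1) (e 2)); first by e_adapted.
move=> W; split=> [[/(fam_gl2P (frame_546 F))[Ws W1 W3] /(fam_lineP (adapted_5436 F))[_ _
  W2]]|].
  by [].
by move=> [Ws W1 W2 W3]; split; [apply/(fam_gl2P (frame_546 F))|apply/(fam_lineP (adapted_5436
  F))].
Qed.

Lemma Y2_Z1_point : one_point (Y2 `&` Z1).
Proof.
apply: (@one_point_Phi _ (e 6) (e 1) (e 5) (e 2) (e 4) (e 3)); first by e_adapted.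
move=> W; split=> [[/(fam_gl2P (frame_615 F))[Ws W1 W3] /(fam_lineP (adapted_6125 F))[_ _
  W2]]|].
  by [].
by move=> [Ws W1 W2 W3]; split; [apply/(fam_gl2P (frame_615 F))|apply/(fam_lineP (adapted_6125
  F))].
Qed.

Lemma L_Y2_point : one_point (L `&` Y2).
Proof.
apply: (@one_point_Phi _ (e 6) (e 5) (e 1) (e 4) (e 2) (e 3)); first by e_adapted.
move=> W; split=> [[/(fam_lineP (adapted_6514 F))[_ _ W2] /(fam_gl2P (frame_615 F))[Ws W1
  W3]]|].
  by split=> //; apply: step_sub_trans W3; sub_list.
move=> [Ws W1 W2 W3]; split; [apply/(fam_lineP (adapted_6514 F))|apply/(fam_gl2P (frame_615
  F))];
  by split=> //; apply: step_sub_trans W3; sub_list.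
Qed.

Lemma steps_disjoint k (A B : set (flag_variety F 6)) s t c d : (size s <= k)%N -> (k <= 6)%N ->
  (forall W, A W -> (step W k <= <<s>>)%VS) -> (forall W, B W -> (step W k <= <<t>>)%VS) ->
  c \in s -> (forall u, u \in t -> <|u, d|> = 0) -> <|c, d|> <> 0 -> A `&` B = set0.
Proof.
move=> sk k6 As Bt cs td cd; rewrite -subset0 => W [/As Ws /Bt Wt].
by apply: (step_notin Wt _ td cd); rewrite (step_span sk k6 Ws); exact: memv_span.
Qed.

Lemma Y1_Y2_disjoint : Y1 `&` Y2 = set0.
Proof.
apply: (@steps_disjoint 1 _ _ [:: e 5] [:: e 6] (e 5) (e 2)) => //.
- by move=> W /(fam_gl2P (frame_546 F))[].
- by move=> W /(fam_gl2P (frame_615 F))[].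
- by rewrite inE.
- by move=> u; rewrite inE => /eqP->; rewrite pairing_e//= subrr.
- by apply/eqP; rewrite pairing_e//=; e_neq0.
Qed.

Lemma Z1_Z2_disjoint : Z1 `&` Z2 = set0.
Proof.
apply: (@steps_disjoint 1 _ _ [:: e 6] [:: e 5] (e 6) (e 3)) => //.
- by move=> W /(fam_lineP (adapted_6125 F))[].
- by move=> W /(fam_lineP (adapted_5436 F))[].
- by rewrite inE.
- by move=> u; rewrite inE => /eqP->; rewrite pairing_e//= subrr.
- by apply/eqP; rewrite pairing_e//=; e_neq0.
Qed.

Lemma X_Z1_disjoint : X `&` Z1 = set0.
Proof.
apply: (@steps_disjoint 2 _ _ [:: e 5; e 6] [:: e 6; e 1] (e 5) (e 2)) => //.
- by move=> W /fam_56_14P[].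
- by move=> W /(fam_lineP (adapted_6125 F))[].
- by rewrite inE eqxx.
- by move=> u; rewrite !inE => /orP[]/eqP->; rewrite pairing_e//= subrr.
- by apply/eqP; rewrite pairing_e//=; e_neq0.
Qed.

Lemma X_Z2_disjoint : X `&` Z2 = set0.
Proof.
apply: (@steps_disjoint 2 _ _ [:: e 5; e 6] [:: e 5; e 4] (e 6) (e 3)) => //.
- by move=> W /fam_56_14P[].
- by move=> W /(fam_lineP (adapted_5436 F))[].
- by rewrite !inE eqxx orbT.
- by move=> u; rewrite !inE => /orP[]/eqP->; rewrite pairing_e//= subrr.
- by apply/eqP; rewrite pairing_e//=; e_neq0.
Qed.

Lemma Z1_L_disjoint : Z1 `&` L = set0.
Proof.
apply: (@steps_disjoint 2 _ _ [:: e 6; e 1] [:: e 6; e 5] (e 1) (e 4)) => //.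
- by move=> W /(fam_lineP (adapted_6125 F))[].
- by move=> W /(fam_lineP (adapted_6514 F))[].
- by rewrite !inE eqxx orbT.
- by move=> u; rewrite !inE => /orP[]/eqP->; rewrite pairing_e//= subrr.
- by apply/eqP; rewrite pairing_e//=; e_neq0.
Qed.

(** The bottom of the chains used for dimension. The point is closed because it is the intersection
    of two closed families. *)
Lemma closed_point : exists W, [/\ L W, Y2 W & closed [set W]].
Proof.
have [W WE] := L_Y2_point; exists W.
have [LW Y2W] : (L `&` Y2) W by rewrite WE.
split=> //; rewrite -WE; apply: closedI; first exact: closed_fam_line (adapted_6514 F).
exact: closed_fam_gl2 (frame_615 F).
Qed.

(** The curve [L] lies in both surfaces, so a single chain, a point inside [L] inside [V], gives the
    lower bound for each; [W] shows that [L] is a proper subset of [V]. *)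
Lemma has_dim_surface (V : set (flag_variety F 6)) W : closed V -> irreducible V ->
  L `<=` V -> V W -> ~ L W -> (forall n C, irr_chain V n C -> (n <= 2)%N) -> has_dim V 2.
Proof.
move=> Vcl Virr LV VW nLW Vle; split=> //; have [P [LP Y2P Pcl]] := closed_point.
have Lcl := closed_fam_line (adapted_6514 F); have Lirr := irreducible_fam_line (adapted_6514
  F).
(* [Q] is a second point of [L]: its [W_3] contains [e 4], while that of [P] lies in the span of
   [e 6], [e 1], [e 5]. *)
have [|Q] := fam_line_ex (adapted_6514 F) (a := 0) (b := 1).
  by rewrite xpair_eqE oner_eq0 andbF.
have LQ' : steps Q = Phi (e 6) (e 5) (0 *: e 1 + 1 *: e 4) -> L Q.
  by move=> QE; exists 0, 1; split=> //; rewrite xpair_eqE oner_eq0 andbF.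
move=> /[dup] /LQ' LQ; rewrite scale0r scale1r add0r => QE {LQ'}.
exists (fun i => if i is i'.+1 then if i' is 0 then L else V else [set P]); split.
  move=> [|[|i]] _; split=> //.
  - by exists [set P] => //; apply/seteqP; split=> x //= => [->|[]//]; split=> //; exact: LV.
  - exact: irreducible1.
  - by exists L => //; apply/esym/setIidr.
  - by exists V => //; rewrite setIid.
move=> [|[|//]] _.
  split=> [x -> //|/(_ Q LQ) /= QP].
  by move: Y2P; rewrite -QP => /(fam_gl2P (frame_615 F))[_ _ W3]; separate W3 (e 4) (e 1) QE.
by split=> // /(_ W VW).
Qed.

Lemma isomorphic_sym (A B : hvariety F) (S : set A) (T : set B) :
  isomorphic S T -> isomorphic T S.
Proof. by move=> [phi [psi iso]]; exists psi, phi; exact: inverse_isos_sym. Qed.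

Lemma has_dim_X : has_dim X 2.
Proof.
have [W [XW WE]] := flag_X_ex.
apply: (@has_dim_surface _ W).
- exact: closed_fam_56_14.
- exact: irreducible_fam_56_14.
- move=> V /(fam_lineP (adapted_6514 F))[Vs V1 V2]; apply/fam_56_14P; split=> //.
  by apply: step_sub_trans V2; sub_list.
- exact: XW.
- move=> /(fam_lineP (adapted_6514 F))[_ W1 _]; separate W1 (e 5 + e 6) (e 2) WE.
- move=> n C XC; have [C' PC] := irr_chain_iso (isomorphic_sym (fam_56_14_iso F)) XC.
  exact: irr_chain_P1xP1 PC.
Qed.

Lemma has_dim_Y : has_dim Y 2.
Proof.
have [W [Y2W WE]] := flag_gl2_ex (frame_615 F).
have YW : Y W.
  have [Ws W1 W3] := (fam_gl2P (frame_615 F) W).1 Y2W; apply/blowup_famP; split=> //.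
  by apply: step_sub_trans W3; sub_list.
apply: (@has_dim_surface _ W).
- exact: closed_blowup_fam.
- exact: irreducible_blowup_fam.
- by right.
- exact: YW.
- move=> /(fam_lineP (adapted_6514 F))[_ _ W2]; separate W2 (e 1 + e 5) (e 4) WE.
- move=> n C YC; have [phi [psi [iso _]]] := blowup_fam_iso F.
  have iso' : isomorphic (blowup_P2 F) Y by exists psi, phi; exact: inverse_isos_sym.
  by have [C' BC] := irr_chain_iso iso' YC; exact: irr_chain_blowup_P2 BC.
Qed.

Section Components.
Variable p : nat.
Hypothesis pcharFp : p \in [pchar F].

Lemma components_s3 : irr_components_are (Flag_perp_FV p F s3) [:: X; Y].
Proof.
have [WX [XW XE]] := flag_X_ex; have [WY [Y2W YE]] := flag_gl2_ex (frame_615 F).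
have YW : Y WY.
  have [Ws W1 W3] := (fam_gl2P (frame_615 F) WY).1 Y2W; apply/blowup_famP; split=> //.
  by apply: step_sub_trans W3; sub_list.
apply: (@components_of_witnesses _ _ (nth WX [:: WX; WY])).
- move=> C; rewrite !inE => /orP[]/eqP->; [exact: closed_fam_56_14|exact: closed_blowup_fam].
- move=> C; rewrite !inE => /orP[]/eqP->; [exact: irreducible_fam_56_14|exact:
    irreducible_blowup_fam].
- apply/seteqP; split=> W.
    by move/(Flag_s3 pcharFp) => [XW'|YW']; [exists X|exists Y]; rewrite // !inE eqxx ?orbT.
  move=> [C]; rewrite !inE => /orP[]/eqP->; move=> CW; apply/(Flag_s3 pcharFp);
  by [left|right].
- by move=> [|[|//]] _.
- move=> [|[|//]] [|[|//]] _ _ //=.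
    by move=> /blowup_famP[_ W1 _]; separate W1 (e 5 + e 6) (e 2) XE.
  by move=> /fam_56_14P[_ W2]; separate W2 (e 1 + e 5) (e 4) YE.
Qed.

Lemma components_s23 : irr_components_are (Flag_perp_FV p F s23) [:: X; Y1; Y2; Z1; Z2].
Proof.
have [WX [XW XE]] := flag_X_ex.
have [WY1 [Y1W Y1E]] := flag_gl2_ex (frame_546 F); have [WY2 [Y2W Y2E]] := flag_gl2_ex
  (frame_615 F).
have [WZ1 [Z1W Z1E]] := flag_line_ex (adapted_6125 F).
have [WZ2 [Z2W Z2E]] := flag_line_ex (adapted_5436 F).
have clX := @closed_fam_56_14 F; have irX := @irreducible_fam_56_14 F.
have clY1 := closed_fam_gl2 (frame_546 F); have irY1 := irreducible_fam_gl2 (frame_546 F).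
have clY2 := closed_fam_gl2 (frame_615 F); have irY2 := irreducible_fam_gl2 (frame_615 F).
have clZ1 := closed_fam_line (adapted_6125 F); have irZ1 := irreducible_fam_line (adapted_6125
  F).
have clZ2 := closed_fam_line (adapted_5436 F); have irZ2 := irreducible_fam_line (adapted_5436
  F).
apply: (@components_of_witnesses _ _ (nth WX [:: WX; WY1; WY2; WZ1; WZ2])).
- by move=> C; rewrite !inE => /or4P[/eqP->|/eqP->|/eqP->|/orP[]/eqP->].
- by move=> C; rewrite !inE => /or4P[/eqP->|/eqP->|/eqP->|/orP[]/eqP->].
- apply/seteqP; split=> W.
    move/(Flag_s23 pcharFp) => [W1|W1|W1|[W1|W1]]; [exists X|exists Y1|exists Y2|exists
      Z1|exists Z2];
    by rewrite // !inE eqxx ?orbT.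
  move=> [C]; rewrite !inE => /or4P[/eqP->|/eqP->|/eqP->|/orP[]/eqP->] CW;
    apply/(Flag_s23 pcharFp).
  + by constructor 1.
  + by constructor 2.
  + by constructor 3.
  + by constructor 4; left.
  + by constructor 4; right.
- by move=> [|[|[|[|[|//]]]]] _.
have XP W : X W -> (step W 2 <= <<[:: e 5; e 6]>>)%VS by move=> /fam_56_14P[].
have Y1P W : Y1 W -> (step W 1 <= <<[:: e 5]>>)%VS /\ (step W 3 <= <<[:: e 5; e 4; e 6]>>)%VS.
  by move=> /(fam_gl2P (frame_546 F))[].
have Y2P W : Y2 W -> (step W 1 <= <<[:: e 6]>>)%VS /\ (step W 3 <= <<[:: e 6; e 1; e 5]>>)%VS.
  by move=> /(fam_gl2P (frame_615 F))[].
have Z1P W : Z1 W -> (step W 1 <= <<[:: e 6]>>)%VS /\ (step W 2 <= <<[:: e 6; e 1]>>)%VS.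
  by move=> /(fam_lineP (adapted_6125 F))[].
have Z2P W : Z2 W -> (step W 1 <= <<[:: e 5]>>)%VS /\ (step W 2 <= <<[:: e 5; e 4]>>)%VS.
  by move=> /(fam_lineP (adapted_5436 F))[].
move=> [|[|[|[|[|//]]]]] [|[|[|[|[|//]]]]] _ _ //=.
- by move=> /Y1P[h _]; separate h (e 5 + e 6) (e 3) XE.
- by move=> /Y2P[h _]; separate h (e 5 + e 6) (e 2) XE.
- by move=> /Z1P[h _]; separate h (e 5 + e 6) (e 2) XE.
- by move=> /Z2P[h _]; separate h (e 5 + e 6) (e 3) XE.
- by move=> /XP h; separate h (e 4 + e 6) (e 1) Y1E.
- by move=> /Y2P[h _]; separate h (e 5) (e 2) Y1E.
- by move=> /Z1P[h _]; separate h (e 5) (e 2) Y1E.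
- by move=> /Z2P[_ h]; separate h (e 4 + e 6) (e 3) Y1E.
- by move=> /XP h; separate h (e 1 + e 5) (e 4) Y2E.
- by move=> /Y1P[h _]; separate h (e 6) (e 3) Y2E.
- by move=> /Z1P[_ h]; separate h (e 1 + e 5) (e 2) Y2E.
- by move=> /Z2P[h _]; separate h (e 6) (e 3) Y2E.
- by move=> /XP h; separate h (e 1) (e 4) Z1E.
- by move=> /Y1P[h _]; separate h (e 6) (e 3) Z1E.
- by move=> /Y2P[_ h]; separate h (e 2) (e 5) Z1E.
- by move=> /Z2P[h _]; separate h (e 6) (e 3) Z1E.
- by move=> /XP h; separate h (e 4) (e 1) Z2E.
- by move=> /Y1P[_ h]; separate h (e 3) (e 6) Z2E.
- by move=> /Y2P[h _]; separate h (e 5) (e 2) Z2E.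
- by move=> /Z1P[h _]; separate h (e 5) (e 2) Z2E.
Qed.

Lemma components_s323 : irr_components_are (Flag_perp_FV p F s323) [:: Z1; L; Y2].
Proof.
have [WZ [ZW ZE]] := flag_line_ex (adapted_6125 F).
have [WY [YW YE]] := flag_gl2_ex (frame_615 F).
have [|WL] := fam_line_ex (adapted_6514 F) (a := 0) (b := 1).
  by rewrite xpair_eqE oner_eq0 andbF.
have LW' : steps WL = Phi (e 6) (e 5) (0 *: e 1 + 1 *: e 4) -> L WL.
  by move=> LE; exists 0, 1; split=> //; rewrite xpair_eqE oner_eq0 andbF.
move=> /[dup] /LW' LW; rewrite scale0r scale1r add0r => LE {LW'}.
have clZ := closed_fam_line (adapted_6125 F); have irZ := irreducible_fam_line (adapted_6125 F).
have clL := closed_fam_line (adapted_6514 F); have irL := irreducible_fam_line (adapted_6514 F).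
have clY := closed_fam_gl2 (frame_615 F); have irY := irreducible_fam_gl2 (frame_615 F).
apply: (@components_of_witnesses _ _ (nth WZ [:: WZ; WL; WY])).
- by move=> C; rewrite !inE => /or3P[]/eqP->.
- by move=> C; rewrite !inE => /or3P[]/eqP->.
- apply/seteqP; split=> W.
    by move/(Flag_s323 pcharFp) => [W1|W1|W1]; [exists Z1|exists L|exists Y2];
      rewrite // !inE eqxx ?orbT.
  move=> [C]; rewrite !inE => /or3P[]/eqP-> CW; apply/(Flag_s323 pcharFp).
  + by constructor 1.
  + by constructor 2.
  + by constructor 3.
- by move=> [|[|[|//]]] _.
move=> [|[|[|//]]] [|[|[|//]]] _ _ //=.
- by move=> /(fam_lineP (adapted_6514 F))[_ _ h]; separate h (e 1) (e 4) ZE.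
- by move=> /(fam_gl2P (frame_615 F))[_ _ h]; separate h (e 2) (e 5) ZE.
- by move=> /(fam_lineP (adapted_6125 F))[_ _ h]; separate h (e 5) (e 2) LE.
- by move=> /(fam_gl2P (frame_615 F))[_ _ h]; separate h (e 4) (e 1) LE.
- by move=> /(fam_lineP (adapted_6125 F))[_ _ h]; separate h (e 1 + e 5) (e 2) YE.
- by move=> /(fam_lineP (adapted_6514 F))[_ _ h]; separate h (e 1 + e 5) (e 4) YE.
Qed.

End Components.

Lemma fam_X_blowup_exceptional (phi : flag_variety F 6 -> hprod (projective_space F 2)
  (projective_space F 1)) :
  (forall W, Y W -> blowup_P2 F (phi W)) -> (forall W, Y W -> blowup_graph W (phi W)) ->
  X `&` Y = Y `&` phi @^-1` exceptional_curve F.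
Proof.
move=> phiB phiR; apply/seteqP; split=> W [].
  by move=> XW YW; split=> //; apply/(blowup_graph_exceptional YW (phiB W YW) (phiR W YW)).
by move=> YW EW; split=> //; apply/(blowup_graph_exceptional YW (phiB W YW) (phiR W YW)).
Qed.

End Separation.

Theorem mainTheorem3 (p : nat) (p_pr : prime p)
    (F : closedFieldType) (iota : {rmorphism 'F_p -> F})
    (F_alg : forall x : F, algebraicOver iota x) :
  let P1 := [set: projective_space F 1] in
  let P1xP1 := [set: hprod (projective_space F 1) (projective_space F 1)] in
  (* (1) *)
  (let X := fam_56_14 F in
   let Y := fam_6_145_5 F `|` fam_line (e F 6) (e F 5) (e F 1) (e F 4) in
   [/\ irr_components_are (Flag_perp_FV p F s3) [:: X; Y],
       isomorphic X P1xP1,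
       (exists phi psi, inverse_isos Y (blowup_P2 F) phi psi /\
          X `&` Y = Y `&` phi @^-1` (exceptional_curve F)),
       has_dim X 2 & has_dim Y 2]) /\
  (* (2) *)
  (let X := fam_56_14 F in
   let Y1 := fam_gl2 (e F 5) (e F 4) (e F 6) in
   let Y2 := fam_gl2 (e F 6) (e F 1) (e F 5) in
   let Z1 := fam_line (e F 6) (e F 1) (e F 2) (e F 5) in
   let Z2 := fam_line (e F 5) (e F 4) (e F 3) (e F 6) in
   [/\ irr_components_are (Flag_perp_FV p F s23) [:: X; Y1; Y2; Z1; Z2],
       [/\ isomorphic X P1xP1, isomorphic Y1 P1, isomorphic Y2 P1,
           isomorphic Z1 P1 & isomorphic Z2 P1],
       [/\ Y1 `&` Y2 = set0, Z1 `&` Z2 = set0, X `&` Z1 = set0 &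
           X `&` Z2 = set0],
       one_point (Y1 `&` X) /\ one_point (Y2 `&` X) &
       one_point (Y1 `&` Z2) /\ one_point (Y2 `&` Z1)]) /\
  (* (3) *)
  (let X := fam_line (e F 6) (e F 1) (e F 2) (e F 5) in
   let Y := fam_line (e F 6) (e F 5) (e F 1) (e F 4) in
   let Z := fam_gl2 (e F 6) (e F 1) (e F 5) in
   [/\ irr_components_are (Flag_perp_FV p F s323) [:: X; Y; Z],
       [/\ isomorphic X P1, isomorphic Y P1 & isomorphic Z P1],
       X `&` Y = set0 &
       one_point (X `&` Z) /\ one_point (Y `&` Z)]).
Proof.
have pcharFp : p \in [pchar F].
  apply/andP; split=> //; have /andP[_ /eqP p0] := pchar_Fp p_pr.
  by rewrite -(rmorph_nat iota) p0 rmorph0.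
have [phi [psi [iso phiR]]] := blowup_fam_iso F.
split; [|split].
- split; [exact: components_s3|exact: fam_56_14_iso| |exact: has_dim_X|exact: has_dim_Y].
  by exists phi, psi; split=> //; apply: fam_X_blowup_exceptional => //; case: iso => -[].
- split; [exact: components_s23| | | |].
  + split; [exact: fam_56_14_iso|exact: fam_gl2_iso (frame_546 F)|exact: fam_gl2_iso (frame_615 F)
      |exact: fam_line_iso (adapted_6125 F)|exact: fam_line_iso (adapted_5436 F)].
  + split; [exact: Y1_Y2_disjoint|exact: Z1_Z2_disjoint|exact: X_Z1_disjoint|exact: X_Z2_disjoint].
  + by split; [exact: Y1_X_point|exact: Y2_X_point].
  + by split; [exact: Y1_Z2_point|exact: Y2_Z1_point].
- split; [exact: components_s323| |exact: Z1_L_disjoint|].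
  + split; [exact: fam_line_iso (adapted_6125 F)|exact: fam_line_iso (adapted_6514 F)
      |exact: fam_gl2_iso (frame_615 F)].
  + by split; [rewrite setIC; exact: Y2_Z1_point|exact: L_Y2_point].
Qed.
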